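(* Fix $q\in(1,3/2)$. For each small $\varepsilon>0$ let $(\widetilde{\mathbf u}^\varepsilon,\widetilde p^\varepsilon,\widetilde T^\varepsilon)$ be a solution of the dilated Darcy-Brinkman/heat problem described in the context, and let $\widetilde{\mathbf u}^\star=(\widetilde u_1^\star,\widetilde u_2^\star)$, $\widetilde p^\star$, $\widetilde T^\star$ be limit functions of a subsequence of it as $\varepsilon\to0$, in the sense described in the context. Then $$\left\{\begin{array}{ll} -\mu_{\rm eff}\,\partial_{z_3}^2\widetilde{\mathbf u}^\star+\dfrac{\mu}{K}\widetilde{\mathbf u}^\star=\mathbf f'(x')-\nabla_{x'}\widetilde p^\star(x') & \text{in }\Omega,\\[2mm] \mathrm{div}_{x'}\left(\displaystyle\int_0^{h(x')}\widetilde{\mathbf u}^\star\,dz_3\right)=0 & \text{in }\omega,\\[2mm] -k\,\partial_{z_3}^2\widetilde T^\star=\dfrac{\mu}{K}|\widetilde{\mathbf u}^\star|^2+\mu_{\rm eff}|\partial_{z_3}\widetilde{\mathbf u}^\star|^2 & \text{in }\Omega,\\[2mm] \widetilde{\mathbf u}^\star=0 & \text{on }\Gamma_0\cup\Gamma_1,\\ \widetilde T^\star=0 & \text{on }\Gamma_1,\\ -k\,\partial_{z_3}\widetilde T^\star=b & \text{on }\Gamma_0, \end{array}\right.$$ where the system is understood in the weak sense described in the context.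
   Context: Setting. $\omega\subset\mathbb R^2$ is a bounded domain with Lipschitz boundary; $h$ is a smooth bounded function with $0<h_{\min}\le h(x')<h_{\max}$. For $0<\varepsilon\ll1$, $\Omega^\varepsilon=\{(x',x_3): x'\in\omega,\ 0<x_3<\varepsilon h(x')\}$, and the rescaled domain ($z_3=x_3/\varepsilon$) is $\Omega=\{(x',z_3): x'\in\omega,\ 0<z_3<h(x')\}$, with boundary parts $\Gamma_0=\{x'\in\omega,\ z_3=0\}$, $\Gamma_1=\{x'\in\omega,\ z_3=h(x')\}$, $\Gamma_\ell=\partial\Omega\setminus(\Gamma_0\cup\Gamma_1)$. The constants $\mu,\mu_{\rm eff},K,k>0$ are independent of $\varepsilon$; $\mathbf f'\in L^2(\omega)^2$ and $b\in L^\infty(\omega)$ are given and independent of $\varepsilon$. (In $\Omega^\varepsilon$ this corresponds to permeability $\varepsilon^2K$, body force $\varepsilon^{-2}(\mathbf f',0)$ and bottom heat flux $\varepsilon^{-1}b$.) A prime denotes the first two components of a vector in $\mathbb R^3$. Operators on $\Omega$: $(D_\varepsilon\mathbf v)_{ij}=\partial_{x_j}v_i$ for $j=1,2$, $(D_\varepsilon\mathbf v)_{i3}=\varepsilon^{-1}\partial_{z_3}v_i$; $\mathbb D_\varepsilon[\mathbf v]=\frac12(D_\varepsilon\mathbf v+(D_\varepsilon\mathbf v)^T)$; $\nabla_\varepsilon\varphi=(\nabla_{x'}\varphi,\varepsilon^{-1}\partial_{z_3}\varphi)$; $\mathrm{div}_\varepsilon\mathbf v=\mathrm{div}_{x'}\mathbf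 v'+\varepsilon^{-1}\partial_{z_3}v_3$. Spaces: $W^{1,r}_{\Gamma_1\cup\Gamma_\ell}(\Omega)=\{\psi\in W^{1,r}(\Omega):\psi=0\text{ on }\Gamma_1\cup\Gamma_\ell\}$; $L^2_0$ denotes mean-zero $L^2$ functions; $V^r_{z_3}=\{v\in L^r(\Omega):\partial_{z_3}v\in L^r(\Omega)\}$ with the graph norm, and $V^r_{z_3,\Theta}=\{v\in V^r_{z_3}: v=0\text{ on }\Theta\}$. Dilated problem. With $q\in(1,3/2)$, $q'=q/(q-1)$, a solution is a triple $\widetilde{\mathbf u}^\varepsilon\in H^1_0(\Omega)^3$, $\widetilde p^\varepsilon\in L^2_0(\Omega)$, $\widetilde T^\varepsilon\in W^{1,q}_{\Gamma_1\cup\Gamma_\ell}(\Omega)$, such that for all $\widetilde{\mathbf v}\in H^1_0(\Omega)^3$, $\widetilde\psi\in H^1_0(\Omega)$, $\widetilde\zeta\in W^{1,q'}_{\Gamma_1\cup\Gamma_\ell}(\Omega)$: $$2\mu_{\rm eff}\int_\Omega\mathbb D_\varepsilon[\widetilde{\mathbf u}^\varepsilon]:\mathbb D_\varepsilon[\widetilde{\mathbf v}]+\frac{\mu}{K}\varepsilon^{-2}\int_\Omega\widetilde{\mathbf u}^\varepsilon\cdot\widetilde{\mathbf v}-\int_\Omega\widetilde p^\varepsilon\,\mathrm{div}_\varepsilon\widetilde{\mathbf v}=\int_\Omega\varepsilon^{-2}\mathbf f'\cdot\widetilde{\mathbf v}',\qquad \int_\Omega\widetilde{\mathbf u}^\varepsilon\cdot\nabla_\varepsilon\widetilde\psi=0,$$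 $$\varepsilon^2\int_\Omega k\nabla_\varepsilon\widetilde T^\varepsilon\cdot\nabla_\varepsilon\widetilde\zeta=\frac{\mu}{K}\int_\Omega|\widetilde{\mathbf u}^\varepsilon|^2\widetilde\zeta+2\mu_{\rm eff}\varepsilon^2\int_\Omega|\mathbb D_\varepsilon[\widetilde{\mathbf u}^\varepsilon]|^2\widetilde\zeta+\int_\omega b\,\widetilde\zeta(x',0)\,dx'.$$ The undilated pressure is $p^\varepsilon(x',x_3)=\widetilde p^\varepsilon(x',x_3/\varepsilon)$ on $\Omega^\varepsilon$. Pressure decomposition. $p^\varepsilon=p_0^\varepsilon+p_1^\varepsilon$, where $p_0^\varepsilon\in H^1(\omega)$ is independent of $x_3$, $p_1^\varepsilon\in L^2(\Omega^\varepsilon)$, and $\varepsilon^{3/2}\|p_0^\varepsilon\|_{H^1(\omega)}+\|p_1^\varepsilon\|_{L^2(\Omega^\varepsilon)}\le C\|\nabla p^\varepsilon\|_{H^{-1}(\Omega^\varepsilon)^3}$ with $C$ independent of $\varepsilon$ (such a decomposition exists and is fixed). Limit functions. $\widetilde{\mathbf u}^\star\in(V^2_{z_3,\Gamma_0\cup\Gamma_1})^2$, $\widetilde p^\star\in L^2_0(\omega)\cap H^1(\omega)$ (independent of $z_3$), $\widetilde T^\star\in V^q_{z_3,\Gamma_1}$ are limit functions if along a subsequence $\varepsilon\to0$, weakly: $\widetilde u_i^\varepsilon\rightharpoonup\widetilde u_i^\star$ in $V^2_{z_3,\Gamma_0\cup\Gamma_1}$ ($i=1,2$); $\widetilde u_3^\varepsilon\rightharpoonup0$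 in $L^2(\Omega)$; $\varepsilon\partial_{x_j}\widetilde u_i^\varepsilon\rightharpoonup0$ in $L^2(\Omega)$ ($i,j=1,2$); $\varepsilon^2p_0^\varepsilon\rightharpoonup\widetilde p^\star$ in $H^1(\omega)$; $\widetilde T^\varepsilon\rightharpoonup\widetilde T^\star$ in $V^q_{z_3,\Gamma_1}$; $\varepsilon\partial_{x_i}\widetilde T^\varepsilon\rightharpoonup0$ in $L^q(\Omega)$ ($i=1,2$). Weak sense of the limit system. The velocity and divergence equations hold in the sense of distributions; the Dirichlet conditions hold as traces in $z_3$; the heat equation with its condition on $\Gamma_0$ means $\int_\Omega k\,\partial_{z_3}\widetilde T^\star\partial_{z_3}\zeta=\frac{\mu}{K}\int_\Omega|\widetilde{\mathbf u}^\star|^2\zeta+\mu_{\rm eff}\int_\Omega|\partial_{z_3}\widetilde{\mathbf u}^\star|^2\zeta+\int_\omega b\,\zeta(x',0)\,dx'$ for all smooth $\zeta$ on $\overline\Omega$ vanishing near $\Gamma_1\cup\Gamma_\ell$. *)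

(* Defs.v *)
From HB Require Import structures.
From mathcomp Require Import all_boot all_order all_algebra.
From mathcomp Require Import all_classical all_reals all_analysis.
Import Order.TTheory GRing.Theory Num.Theory.
Import numFieldNormedType.Exports.

Set Implicit Arguments.
Unset Strict Implicit.
Unset Printing Implicit Defensive.

Local Open Scope classical_set_scope.
Local Open Scope ring_scope.

Section smooth.
Context {R : realType} {V : normedModType R}.

Definition iter_derive (s : seq V) (f : V -> R) : V -> R :=
  foldr (fun v g x => 'D_v g x) f s.

(* C^infinity on the open set U: all iterated directional derivatives exist
   and are continuous at every point of U *)
Definition smooth_on (U : set V) (f : V -> R) : Prop :=
  forall (s : seq V) (x : V), U x ->
    {for x, continuous (iter_derive s f)} /\
    forall v, derivable (iter_derive s f) x v.

Definition test_fun (U : set V) (f : V -> R) : Prop :=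
  [/\ smooth_on setT f, compact (closure [set x | f x != 0])
    & closure [set x | f x != 0] `<=` U].

Definition frontier (A : set V) : set V := closure A `\` A°.

End smooth.

(* On R * R and R * R * R the normed (topological) and the measurable
   structures have convertible carriers but no common library structure; this
   record gives access to what is needed of both in a dimension-independent way. *)
Record euclid (R : realType) := Euclid {
  edisp : measure_display ;
  pt : measurableType edisp ;
  vol : {measure set pt -> \bar R} ;
  edim : nat ;
  pder : 'I_edim -> (pt -> R) -> pt -> R ;
  testf : set pt -> (pt -> R) -> Prop }.
Arguments pt {R} e.
Arguments vol {R} e.

Section plane_space.
Context (R : realType).

Definition leb1 : {measure set (measurableTypeR R) -> \bar R} :=
  @lebesgue_measure R.

Definition leb2 :
    {measure set (measurableTypeR R * measurableTypeR R)%type -> \bar R} :=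
  (leb1 \x @lebesgue_measure R)%E.

Definition leb3 :
    {measure set (measurableTypeR R * measurableTypeR R
                  * measurableTypeR R)%type -> \bar R} :=
  (leb2 \x @lebesgue_measure R)%E.

Definition e2 (i : 'I_2) : R * R := ((i == 0 :> nat)%:R, (i == 1%N :> nat)%:R).
Definition e3 (i : 'I_3) : R * R * R :=
  ((i == 0 :> nat)%:R, (i == 1%N :> nat)%:R, (i == 2%N :> nat)%:R).

Definition plane2 : euclid R := {|
  vol := leb2 ;
  pder := fun i (f : R * R -> R) x => 'D_(e2 i) f x ;
  testf := @test_fun R (R * R)%type |}.

Definition space3 : euclid R := {|
  vol := leb3 ;
  pder := fun i (f : R * R * R -> R) x => 'D_(e3 i) f x ;
  testf := @test_fun R (R * R * R)%type |}.

End plane_space.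

Section function_spaces.
Context {R : realType}.
Local Open Scope ereal_scope.

Definition weak_cvg (E : lmodType R) (S : set E) (N : E -> \bar R)
    (u_ : nat -> E) (u : E) : Prop :=
  [/\ forall n, S (u_ n), S u &
    forall l : E -> R,
      (forall a v w, S v -> S w -> l (a *: v + w)%R = (a * l v + l w)%R) ->
      (exists C : R, forall v, S v -> `|l v|%:E <= C%:E * N v) ->
      l (u_ n) @[n --> \oo] --> l u].

Section over.
Context {G : euclid R}.
Implicit Types (U : set (pt G)) (r : \bar R) (f : pt G -> R).

Definition LN U r f : \bar R := Lnorm (vol G) r (EFin \o (f \_ U)).

Definition Lr U r : set (pt G -> R) := [set f | (f \_ U) \in Lfun (vol G) r].

Definition Lr0 U r : set (pt G -> R) :=
  [set f | Lr U r f /\ (\int[vol G]_(x in U) f x = 0)%R].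

(* w is the weak derivative of v on U in the i-th coordinate direction *)
Definition weak_pder U (i : 'I_(edim G)) (v w : pt G -> R) : Prop :=
  forall phi, testf U phi ->
    (\int[vol G]_(x in U) (v x * pder i phi x)
     = - \int[vol G]_(x in U) (w x * phi x))%R.

(* Sobolev functions are carried together with their weak gradient. *)
Definition jet : lmodType R :=
  ((pt G -> R) * ('I_(edim G) -> pt G -> R))%type.

Definition classical_jet f : jet := (f, fun i => pder i f).

Definition W1N U r (u : jet) : \bar R := LN U r u.1 + \sum_i LN U r (u.2 i).

Definition W1 U r : set jet :=
  [set u | [/\ Lr U r u.1, forall i, Lr U r (u.2 i)
             & forall i, weak_pder U i u.1 (u.2 i)]].

Definition H10 U : set jet :=
  [set u | W1 U 2%:E u /\
    exists phi : nat -> pt G -> R, (forall n, testf U (phi n)) /\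
      W1N U 2%:E (classical_jet (phi n) - u)%R @[n --> \oo] --> 0].

(* || grad p ||_{H^{-1}(U)^d} *)
Definition grad_Hm1N U (p : pt G -> R) : \bar R :=
  ereal_sup [set `|\int[vol G]_(x in U) (p x * \sum_i (v i).2 i x)|%R%:E |
    v in [set v : 'I_(edim G) -> jet |
           (forall i, H10 U (v i)) /\ \sum_i W1N U 2%:E (v i) <= 1]].

End over.
End function_spaces.
Arguments jet {R} G.
Arguments LN {R} G.
Arguments Lr {R} G.
Arguments Lr0 {R} G.
Arguments weak_pder {R} G.
Arguments classical_jet {R} G.
Arguments W1N {R} G.
Arguments W1 {R} G.
Arguments H10 {R} G.
Arguments grad_Hm1N {R} G.

Section traces.
Context {R : realType}.
Local Notation R3 := (R * R * R)%type.
Local Open Scope ereal_scope.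

Definition sqdist (x y : R3) : R :=
  ((x.1.1 - y.1.1) ^+ 2 + (x.1.2 - y.1.2) ^+ 2 + (x.2 - y.2) ^+ 2)%R.

Definition sqdiam (A : set R3) : \bar R :=
  maxe 0 (ereal_sup [set (sqdist z.1 z.2)%:E | z in A `*` A]).

(* Two-dimensional Hausdorff measure in R^3, as an outer measure; integrals
   against it only evaluate it on Borel sets, where it is additive. *)
Definition surface (A : set R3) : \bar R :=
  (pi / 4)%:E * ereal_sup [set
    ereal_inf [set \sum_(k <oo) sqdiam (B k) | B in [set B : nat -> set R3 |
      A `<=` \bigcup_k B k /\ forall k, sqdiam (B k) <= delta%:E]]
    | delta in [set delta : R | (0 < delta)%R]].

(* g is the trace of the W^{1,r} function u on the part Gam of the boundary of
   U: the trace operator is the continuous extension to W^{1,r}(U) of the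
   restriction of smooth functions, with values in L^r(Gam). Measurability of
   g is needed since the integral is a lower integral otherwise. *)
Definition has_trace (U : set R3) (r : R) (Gam : set R3) (u : jet (space3 R))
    (g : R3 -> R) : Prop :=
  exists phi : nat -> R3 -> R,
    [/\ measurable_fun (Gam : set (pt (space3 R))) (g : pt (space3 R) -> R),
        forall n, smooth_on setT (phi n),
        W1N (space3 R) U r%:E (classical_jet (space3 R) (phi n) - u)%R
          @[n --> \oo] --> 0 &
        \int[surface]_(x in Gam) ((`|phi n x - g x| `^ r)%R%:E : \bar R)
          @[n --> \oo] --> 0].

Definition W1_zero (U : set R3) (r : R) (Gam : set R3) : set (jet (space3 R)) :=
  [set u | W1 (space3 R) U r%:E u /\ has_trace U r Gam u (cst 0%R)].
End traces.

Definition lipschitz_boundary {R : realType} (om : set (R * R)) : Prop :=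
  forall a, frontier om a ->
    exists (c s r : R) (g : R -> R),
      [/\ c ^+ 2 + s ^+ 2 = 1, 0 < r, lipschitz g &
        forall x, ball a r x ->
          (om x <-> g (c * (x.1 - a.1) + s * (x.2 - a.2))
                    < c * (x.2 - a.2) - s * (x.1 - a.1))].

Section problem.
Context {R : realType}.
Local Notation R2 := (R * R)%type.
Local Notation R3 := (R * R * R)%type.
Local Notation jet3 := (jet (space3 R)).
Implicit Types (om : set R2) (h : R2 -> R) (eps : R).

Definition vert : 'I_3 := ord_max.
Definition horiz (i : 'I_2) : 'I_3 := widen_ord (leqnSn 2) i.

Definition layer om h : set R3 := [set x | om x.1 /\ 0 < x.2 < h x.1].
Definition Gamma0 om : set R3 := [set x | om x.1 /\ x.2 = 0].
Definition Gamma1 om h : set R3 := [set x | om x.1 /\ x.2 = h x.1].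
Definition Gammal om h : set R3 :=
  frontier (layer om h) `\` (Gamma0 om `|` Gamma1 om h).

(* {v in L^r : d_z v in L^r}, carried as pairs (v, d_z v) *)
Definition zjet : lmodType R := ((R3 -> R) * (R3 -> R))%type.
Definition zjet_of (u : jet3) : zjet := (u.1, u.2 vert).
Definition VzN (U : set R3) (r : R) (v : zjet) : \bar R :=
  (LN (space3 R) U r%:E v.1 + LN (space3 R) U r%:E v.2)%E.
Definition Vz (U : set R3) (r : R) : set zjet :=
  [set v | [/\ Lr (space3 R) U r%:E v.1, Lr (space3 R) U r%:E v.2
             & weak_pder (space3 R) U vert v.1 v.2]].

(* For a.e. x', v(x', .) has a continuous representative on [0, h(x')];
   the trace in z is the value of that representative. *)
Definition ztrace_zero om h (Theta : set R3) (v : R3 -> R) : Prop :=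
  {ae @leb2 R, forall x', om x' -> exists V : R -> R,
    [/\ {within `[0, h x'], continuous V},
        {ae @leb1 R, forall z, 0 < z < h x' -> v (x', z) = V z} &
        forall z, 0 <= z <= h x' -> Theta (x', z) -> V z = 0]}.

Definition Vz_zero om h (r : R) (Theta : set R3) : set zjet :=
  [set v | Vz (layer om h) r v /\ ztrace_zero om h Theta v.1].

Definition grade eps (u : jet3) (j : 'I_3) (x : R3) : R :=
  if j == vert then eps^-1 * u.2 j x else u.2 j x.
Definition syme eps (v : 'I_3 -> jet3) (i j : 'I_3) (x : R3) : R :=
  (grade eps (v i) j x + grade eps (v j) i x) / 2.
Definition dive eps (v : 'I_3 -> jet3) (x : R3) : R :=
  \sum_i grade eps (v i) i x.

Definition dilated_solution om h (mu mueff K k q : R)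
    (f : 'I_2 -> R2 -> R) (b : R2 -> R) eps
    (u : 'I_3 -> jet3) (p : R3 -> R) (T : jet3) : Prop :=
  let Om := layer om h in
  let q' := q / (q - 1) in
  let Gam1l := Gamma1 om h `|` Gammal om h in
  [/\ [/\ forall i, H10 (space3 R) Om (u i), Lr0 (space3 R) Om 2%:E p
        & W1_zero Om q Gam1l T],
    (forall v : 'I_3 -> jet3, (forall i, H10 (space3 R) Om (v i)) ->
      2 * mueff * \int[leb3 R]_(x in Om)
          (\sum_i \sum_j syme eps u i j x * syme eps v i j x)
      + mu / K * eps ^- 2 * \int[leb3 R]_(x in Om)
          (\sum_i (u i).1 x * (v i).1 x)
      - \int[leb3 R]_(x in Om) (p x * dive eps v x)
      = \int[leb3 R]_(x in Om)
          (eps ^- 2 * \sum_i f i x.1 * (v (horiz i)).1 x)),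
    (forall psi : jet3, H10 (space3 R) Om psi ->
      \int[leb3 R]_(x in Om) (\sum_i (u i).1 x * grade eps psi i x) = 0) &
    (forall (zeta : jet3) (zeta0 : R3 -> R), W1_zero Om q' Gam1l zeta ->
      has_trace Om q' (Gamma0 om) zeta zeta0 ->
      eps ^+ 2 * \int[leb3 R]_(x in Om)
          (k * \sum_i grade eps T i x * grade eps zeta i x)
      = mu / K * \int[leb3 R]_(x in Om) ((\sum_i (u i).1 x ^+ 2) * zeta.1 x)
        + 2 * mueff * eps ^+ 2 * \int[leb3 R]_(x in Om)
            ((\sum_i \sum_j syme eps u i j x ^+ 2) * zeta.1 x)
        + \int[leb2 R]_(x' in om) (b x' * zeta0 (x', 0)))].

Definition undilate eps (p : R3 -> R) : R3 -> R := fun x => p (x.1, x.2 / eps).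

Definition pressure_decomposition om h (C eps : R) (p : R3 -> R)
    (p0 : jet (plane2 R)) (p1 : R3 -> R) : Prop :=
  let Omeps := layer om (fun x' => eps * h x') in
  [/\ W1 (plane2 R) om 2%:E p0, Lr (space3 R) Omeps 2%:E p1,
      {ae leb3 R, forall x, Omeps x -> p x = p0.1 x.1 + p1 x} &
      ((eps `^ (3 / 2))%:E * W1N (plane2 R) om 2%:E p0
        + LN (space3 R) Omeps 2%:E p1
        <= C%:E * grad_Hm1N (space3 R) Omeps p)%E].

Definition limit_functions om h (q : R)
    (u : R -> 'I_3 -> jet3) (p0 : R -> jet (plane2 R)) (T : R -> jet3)
    (e : nat -> R)
    (us : 'I_2 -> zjet) (ps : jet (plane2 R)) (Ts : zjet) : Prop :=
  let Om := layer om h in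
  let L r := Lr (space3 R) Om r%:E in
  let N r := LN (space3 R) Om r%:E in
  let Gam01 := Gamma0 om `|` Gamma1 om h in
  [/\ [/\ forall i, Vz_zero om h 2 Gam01 (us i),
          W1 (plane2 R) om 2%:E ps, Lr0 (plane2 R) om 2%:E ps.1
        & Vz_zero om h q (Gamma1 om h) Ts],
      [/\ forall i, weak_cvg (Vz_zero om h 2 Gam01) (VzN Om 2)
            (fun n => zjet_of (u (e n) (horiz i))) (us i),
          weak_cvg (L 2) (N 2) (fun n => (u (e n) vert).1) 0
        & forall i j : 'I_2, weak_cvg (L 2) (N 2)
            (fun n => e n *: (u (e n) (horiz i)).2 (horiz j)) 0],
      weak_cvg (W1 (plane2 R) om 2%:E) (W1N (plane2 R) om 2%:E)
        (fun n => e n ^+ 2 *: p0 (e n)) ps &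
      weak_cvg (Vz_zero om h q (Gamma1 om h)) (VzN Om q)
        (fun n => zjet_of (T (e n))) Ts /\
      forall i : 'I_2, weak_cvg (L q) (N q)
        (fun n => e n *: (T (e n)).2 (horiz i)) 0].

Definition limit_system om h (mu mueff K k : R)
    (f : 'I_2 -> R2 -> R) (b : R2 -> R)
    (us : 'I_2 -> zjet) (ps : jet (plane2 R)) (Ts : zjet) : Prop :=
  let Om := layer om h in
  let dz (phi : R3 -> R) := pder (e := space3 R) vert phi in
  [/\ (forall (i : 'I_2) (phi : R3 -> R), test_fun Om phi ->
        - mueff * \int[leb3 R]_(x in Om) ((us i).1 x * dz (dz phi) x)
        + mu / K * \int[leb3 R]_(x in Om) ((us i).1 x * phi x)
        = \int[leb3 R]_(x in Om) ((f i x.1 - ps.2 i x.1) * phi x)),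
      (forall phi : R2 -> R, test_fun om phi ->
        \int[leb2 R]_(x' in om)
          (\sum_i (\int[leb1 R]_(z in `]0, h x'[) (us i).1 (x', z))
                  * pder (e := plane2 R) i phi x') = 0),
      (forall zeta : R3 -> R, smooth_on setT zeta ->
        (exists O : set R3, [/\ open O, Gamma1 om h `|` Gammal om h `<=` O
           & forall x, O x -> closure Om x -> zeta x = 0]) ->
        \int[leb3 R]_(x in Om) (k * (Ts.2 x * dz zeta x))
        = mu / K * \int[leb3 R]_(x in Om)
              ((\sum_i (us i).1 x ^+ 2) * zeta x)
          + mueff * \int[leb3 R]_(x in Om)
              ((\sum_i (us i).2 x ^+ 2) * zeta x)
          + \int[leb2 R]_(x' in om) (b x' * zeta (x', 0))),
      (forall i, ztrace_zero om h (Gamma0 om `|` Gamma1 om h) (us i).1)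
    & ztrace_zero om h (Gamma1 om h) Ts.1].

End problem.

(* Main.v *)
(* Proof idea. The divergence constraint, extended from H^1_0 to all W^{1,2} test
   functions, makes the pressure disappear from the energy identity
     mueff eps^2 |D_eps u|^2 + mu/K |u|^2 = (f, u'),
   where Korn's identity 2 |sym D|^2 = |D|^2 has been used; its right-hand side
   converges by weak convergence, which gives the a priori bounds. Testing the
   momentum equation with dilated fields bounds the H^{-1} norm of the pressure
   gradient, so that eps^2 p1, dilated, is O(eps) in L^2; together with the weak
   limit of eps^2 p0 this gives the limit momentum equation. That equation and
   the limit divergence equation yield the energy identity of the limit, with the
   limit of (f, u') as right-hand side. Hence eps D_eps u and u converge strongly
   in L^2 and one can pass to the limit in the quadratic sources of the heat
   equation. A smooth zeta vanishing near Gamma_1 and Gamma_l is an admissible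
   temperature test function, being its own approximating sequence for traces. *)
Require Import Defs.
From HB Require Import structures.
From mathcomp Require Import all_boot all_order all_algebra.
From mathcomp Require Import all_classical all_reals all_analysis.
From mathcomp Require Import measurable_realfun.
From mathcomp Require Import ring lra.
Import Order.TTheory GRing.Theory Num.Theory.
Import numFieldNormedType.Exports.

Local Open Scope classical_set_scope.
Local Open Scope ring_scope.

Set Implicit Arguments.
Unset Strict Implicit.
Unset Printing Implicit Defensive.

(** * Integration over products *)

(** The heat sources are quadratic in the velocity, while the horizontal derivatives are controlled
    only after multiplication by [e n]. There is thus no compactness in x', and strong convergence
    has to come from convergence of the energy. The obstacle is the energy identity of the limit:
    [us] is only known to have a vertical derivative, so it is not at hand as an H10 test function
    in its own equation. The limit momentum equation, with one vertical derivative on each factor,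
    is tested with the velocities [U n], and the weak limit is then taken in the resulting linear
    expression. The limit pressure must drop out of that identity although it has no boundary
    values; hence the divergence constraint for W^{1,2} functions. It holds because the divergence
    of [u] is an L2 limit of test functions, so orthogonal to itself. Powers in the pressure
    estimate: a dilated field has gradient of order eps^(-1/2) and, by the vertical Poincaré
    inequality, size eps^(1/2), which balances the factors eps^(-2) of drag and force. Dilating [p1]
    costs another eps^(-1/2), so eps^2 leaves eps. *)

Section fubini.
Context (R : realType).
Local Open Scope ereal_scope.
Local Notation lam := (@lebesgue_measure R).
Local Notation T1 := (measurableTypeR R).
Local Notation T2 := (T1 * T1)%type.

(* [leb2] is a product measure packed as a mere measure; the copy [leb2_fun]
   carries the sigma-finite instance that Fubini needs for [leb3]. *)
Definition leb2_fun : set T2 -> \bar R := leb2 R.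

HB.instance Definition _ := isMeasure.Build _ _ _ leb2_fun
  (measure0 (leb2 R)) (measure_ge0 (leb2 R)) (@measure_semi_sigma_additive _ _ _ (leb2 R)).

Lemma sigma_finite_leb2 : sigma_finite setT leb2_fun.
Proof.
have /sigma_finiteP[F [TF ndF Foo]] := sigma_finiteT lam.
exists (fun n => F n `*` F n).
  rewrite -setXTT TF predeqE => -[x y]; split.
    move=> [/= [n _ Fnx] [k _ Gky]]; exists (maxn n k) => //; split.
    - by move: x Fnx; exact/subsetPset/ndF/leq_maxl.
    - by move: y Gky; exact/subsetPset/ndF/leq_maxr.
  by move=> [n _ []/= ? ?]; split; exists n.
move=> k; have [? ?] := Foo k.
split; first exact: measurableX.
have -> : leb2_fun (F k `*` F k) = lam (F k) * lam (F k).
  exact: (product_measure1E (leb1 R) lam).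
by rewrite lte_mul_pinfty// ge0_fin_numE.
Qed.

HB.instance Definition _ := Measure_isSigmaFinite.Build _ _ _ leb2_fun sigma_finite_leb2.

Definition sleb2 : {sigma_finite_measure set T2 -> \bar R} := leb2_fun.

Lemma leb3_fubini (f : T2 * T1 -> \bar R) : (leb3 R).-integrable setT f ->
  \int[leb3 R]_x f x = \int[leb2 R]_x \int[leb1 R]_z f (x, z).
Proof.
move=> fi; symmetry.
exact: (@integral12_prod_meas1 _ _ T2 T1 R sleb2 lam f fi).
Qed.

Lemma leb3_fubiniC (f : T2 * T1 -> \bar R) : (leb3 R).-integrable setT f ->
  \int[leb3 R]_x f x = \int[leb1 R]_z \int[leb2 R]_x f (x, z).
Proof.
move=> fi; symmetry.
exact: (@integral21_prod_meas1 _ _ T2 T1 R sleb2 lam f fi).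
Qed.

Lemma leb2_fubini (f : T2 -> \bar R) : (leb2 R).-integrable setT f ->
  \int[leb2 R]_x f x = \int[leb1 R]_x \int[leb1 R]_y f (x, y).
Proof.
move=> fi; symmetry.
exact: (@integral12_prod_meas1 _ _ T1 T1 R lam lam f fi).
Qed.

Lemma leb2_fubiniC (f : T2 -> \bar R) : (leb2 R).-integrable setT f ->
  \int[leb2 R]_x f x = \int[leb1 R]_y \int[leb1 R]_x f (x, y).
Proof.
move=> fi; symmetry.
exact: (@integral21_prod_meas1 _ _ T1 T1 R lam lam f fi).
Qed.

Lemma leb3_tonelli (f : T2 * T1 -> \bar R) : measurable_fun setT f ->
  (forall x, 0 <= f x) ->
  \int[leb3 R]_x f x = \int[leb2 R]_x \int[leb1 R]_z f (x, z).
Proof.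
move=> mf f0.
exact: (@fubini_tonelli1 _ _ T2 T1 R sleb2 lam f mf f0).
Qed.

Lemma leb3_integrable_fubini (f : T2 * T1 -> \bar R) :
  (leb3 R).-integrable setT f ->
  (leb2 R).-integrable setT (fun x => \int[leb1 R]_z f (x, z)).
Proof.
move=> fi; exact: (@integrable_fubini_F _ _ T2 T1 R sleb2 lam f fi).
Qed.

End fubini.

Lemma Rintegral_sum d (T : measurableType d) (R : realType)
    (mu : {measure set T -> \bar R}) (D : set T) (I : Type) (r : seq I)
    (F : I -> T -> R) : measurable D ->
  (forall i, mu.-integrable D (EFin \o F i)) ->
  mu.-integrable D (EFin \o (fun x => \sum_(i <- r) F i x)) /\
  \int[mu]_(x in D) (\sum_(i <- r) F i x) = \sum_(i <- r) \int[mu]_(x in D) F i x.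
Proof.
move=> mD iF; have E : EFin \o (fun x => \sum_(i <- r) F i x) =
    (fun x => \sum_(i <- r) (EFin \o F i) x)%E.
  by apply/funext => x; rewrite /= sumEFin.
split; first by rewrite E; exact: integrable_sum.
rewrite /Rintegral -[X in integral _ _ X]/(EFin \o _) E integral_sum// -sum_fine// => i _.
exact: integrable_fin_num.
Qed.

(** * Lebesgue spaces on a measurable set and the L2 inner product *)

Section lebesgue_spaces.
Context d (T : measurableType d) (R : realType).
Variables (mu : {measure set T -> \bar R}) (U : set T).
Hypothesis mU : measurable U.
Implicit Types f g : T -> R.

(** Convertible with [Lr], as [normL] is with [LN], but stated for a bare measure: the facts below
    then apply both to the plane and to the space. *)
Definition inL (r : \bar R) f : Prop := (f \_ U) \in Lfun mu r.
Definition normL (r : \bar R) f : \bar R := Lnorm mu r (EFin \o (f \_ U)).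
Definition inner f g : R := \int[mu]_(x in U) (f x * g x).
Definition norm2 f : R := Num.sqrt (inner f f).

Lemma inL_measurable r f : inL r f -> measurable_fun U f.
Proof.
rewrite /inL inE => /andP[]; rewrite inE /= => mf _.
by apply/(measurable_restrictT f mU).
Qed.

Lemma inL_fin r f : inL r f -> (normL r f < +oo)%E.
Proof. by rewrite /inL inE => /andP[_]; rewrite inE. Qed.

Lemma inL_fine r f : inL r f -> (fine (normL r f))%:E = normL r f.
Proof. by move=> /inL_fin H; rewrite fineK// ge0_fin_numE// Lnorm_ge0. Qed.

Lemma inL_lin (r : R) f g a : 1 <= r ->
  inL r%:E f -> inL r%:E g -> inL r%:E (a *: f + g).
Proof.
move=> r1 Lf Lg; rewrite /inL.
have -> : (a *: f + g) \_ U = a *: (f \_ U) + (g \_ U).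
  apply/funext => x; rewrite /patch !fctE /=; case: ifPn => _ //.
  by rewrite scaler0 addr0.
have r1E : (1 <= r%:E)%E by rewrite lee_fin.
by have [_] := Lfun_submod_closed mu r1E; apply.
Qed.

Lemma inL0 (r : R) : 1 <= r -> inL r%:E 0.
Proof.
move=> r1; rewrite /inL.
have -> : (0 : T -> R) \_ U = cst 0.
  by apply/funext => x; rewrite /patch; case: ifP.
have r1E : (1 <= r%:E)%E by rewrite lee_fin.
by have [] := Lfun_submod_closed mu r1E.
Qed.

Lemma hoelder_in (p q : R) f g : 0 < p -> 0 < q -> p^-1 + q^-1 = 1 ->
  inL p%:E f -> inL q%:E g ->
  mu.-integrable U (EFin \o (fun x => f x * g x)) /\
  (`|inner f g|%:E <= normL p%:E f * normL q%:E g)%E.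
Proof.
move=> p0 q0 pq Lf Lg.
have mf := inL_measurable Lf; have mg := inL_measurable Lg.
have mfU : measurable_fun [set: T] (f \_ U) by apply/(measurable_restrictT f mU).
have mgU : measurable_fun [set: T] (g \_ U) by apply/(measurable_restrictT g mU).
have := hoelder mu mfU mgU p0 q0 pq.
rewrite Lnorm1 => H.
have fin : (normL p%:E f * normL q%:E g < +oo)%E.
  by rewrite -(inL_fine Lf) -(inL_fine Lg) -EFinM ltry.
have absE : (\int[mu]_x `|(EFin \o (f \_ U \* g \_ U)%R) x| =
     \int[mu]_(x in U) `|(EFin \o (fun x => f x * g x)%R) x|)%E.
  rewrite [RHS]integral_mkcond; apply: eq_integral => x _.
  rewrite /= /patch; case: ifP => _ //=.
  by rewrite mul0r normr0.
have ifg : mu.-integrable U (EFin \o (fun x => f x * g x)).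
  apply/integrableP; split.
    by apply/measurable_EFinP; exact: measurable_funM.
  by rewrite -absE; apply: le_lt_trans H fin.
split=> //.
apply: le_trans H; rewrite absE EFin_normr_Rintegral//.
by apply: le_abse_integral => //; case/integrableP: ifg.
Qed.

Lemma ip_integrable f g : inL 2%:E f -> inL 2%:E g ->
  mu.-integrable U (EFin \o (fun x => f x * g x)).
Proof.
move=> Lf Lg; have [] := @hoelder_in 2 2 f g _ _ _ Lf Lg => //.
by rewrite [RHS]splitr !div1r.
Qed.

Lemma ipC f g : inner f g = inner g f.
Proof. by apply: eq_Rintegral => x _; rewrite mulrC. Qed.

Lemma ip_linl a f g k : inL 2%:E f -> inL 2%:E g -> inL 2%:E k ->
  inner (a *: f + g) k = a * inner f k + inner g k.
Proof.
move=> Lf Lg Lk.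
rewrite -RintegralZl//; last exact: ip_integrable.
rewrite -RintegralD//; last 2 first.
- rewrite (_ : _ \o _ = EFin \o (fun x => (a *: f) x * k x)).
    apply: ip_integrable => //; rewrite -[a *: f]addr0.
    by apply: inL_lin => //; [rewrite ler1n|apply: inL0; rewrite ler1n].
  by apply/funext => x; rewrite /= !fctE mulrA.
- exact: ip_integrable.
by apply: eq_Rintegral => x _; rewrite !fctE mulrDl mulrA.
Qed.

Lemma ip_ge0 f : 0 <= inner f f.
Proof. by apply: Rintegral_ge0 => x _; rewrite -expr2 sqr_ge0. Qed.

Lemma nrm_ge0 f : 0 <= norm2 f.
Proof. exact: sqrtr_ge0. Qed.

Lemma sqr_nrm f : norm2 f ^+ 2 = inner f f.
Proof. by rewrite sqr_sqrtr// ip_ge0. Qed.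

Lemma normL2 f : inL 2%:E f -> normL 2%:E f = (norm2 f)%:E.
Proof.
move=> Lf; rewrite /normL unlock /=.
have -> : (\int[mu]_x (`|(EFin \o f \_ U) x| `^ 2) = (inner f f)%:E)%E.
  rewrite /inner /Rintegral fineK; last exact: integrable_fin_num (ip_integrable Lf Lf).
  rewrite [RHS]integral_mkcond; apply: eq_integral => x _.
  rewrite /= /patch; case: ifP => _.
    by rewrite powR_mulrn// -normrX ger0_norm ?sqr_ge0// expr2.
  by rewrite normr0 powR0// pnatr_eq0.
by rewrite poweR_EFin /norm2 powR12_sqrt ?ip_ge0.
Qed.

Lemma cauchy_schwarz f g : inL 2%:E f -> inL 2%:E g ->
  `|inner f g| <= norm2 f * norm2 g.
Proof.
move=> Lf Lg; rewrite -lee_fin EFinM -!normL2//.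
have [] := @hoelder_in 2 2 f g _ _ _ Lf Lg => //.
by rewrite [RHS]splitr !div1r.
Qed.

Lemma inL_bounded (r M : R) f : 1 <= r -> (mu U < +oo)%E ->
  measurable_fun U f -> (forall x, U x -> `|f x| <= M) -> inL r%:E f.
Proof.
move=> r1 Ufin mf fM; rewrite /inL inE; apply/andP; rewrite !inE; split.
  by apply/(measurable_restrictT f mU).
rewrite /= /finite_norm unlock poweR_lty//.
apply: (@le_lt_trans _ _ (\int[mu]_(x in U) (M `^ r)%:E)%E).
  rewrite [leRHS]integral_mkcond; apply: ge0_le_integral => //=.
  - apply/measurable_EFinP; apply: (measurableT_comp (measurable_powR _)); apply: measurableT_comp => //.
    by apply/(measurable_restrictT f mU).
  - by apply/(measurable_restrictT _ mU).
  - move=> x _; rewrite /patch; case: ifP => xU.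
      rewrite lee_fin ge0_ler_powR ?nnegrE//; first lra.
        by apply: le_trans (fM x _); [exact: normr_ge0|exact: set_mem].
      by apply: fM; exact: set_mem.
    by rewrite normr0 powR0// gt_eqF//; lra.
by rewrite integral_cst// lte_mul_pinfty// lee_fin powR_ge0.
Qed.

End lebesgue_spaces.

Section L2_space.
Context d (T : measurableType d) (R : realType).
Variables (mu : {measure set T -> \bar R}) (U : set T).
Hypothesis mU : measurable U.
Implicit Types f g : T -> R.
Local Notation L2 := (inL mu U 2%:E).
Local Notation ip := (inner mu U).
Local Notation nrm := (norm2 mu U).

Lemma L2_lin f g a : L2 f -> L2 g -> L2 (a *: f + g).
Proof. by apply: inL_lin => //; rewrite ler1n. Qed.

Lemma L2_0 : L2 0.
Proof. by apply: inL0; rewrite ler1n. Qed.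

Lemma L2_Z f a : L2 f -> L2 (a *: f).
Proof. by move=> Lf; rewrite -[a *: f]addr0; apply: L2_lin => //; exact: L2_0. Qed.

Lemma L2_D f g : L2 f -> L2 g -> L2 (f + g).
Proof. by move=> Lf Lg; rewrite -[f]scale1r; exact: L2_lin. Qed.

Lemma L2_B f g : L2 f -> L2 g -> L2 (f - g).
Proof.
by move=> Lf Lg; apply: L2_D => //; rewrite -scaleN1r; exact: L2_Z.
Qed.

Lemma L2_sum (I : Type) (r : seq I) (P : pred I) (F : I -> T -> R) :
  (forall i, L2 (F i)) -> L2 (\sum_(i <- r | P i) F i).
Proof. by move=> LF; elim/big_ind: _ => //; [exact: L2_0|move=> *; exact: L2_D]. Qed.

Lemma ipDl f g k : L2 f -> L2 g -> L2 k -> ip (f + g) k = ip f k + ip g k.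
Proof. by move=> *; rewrite -[f]scale1r ip_linl// scale1r mul1r. Qed.

Lemma ip0l k : ip 0 k = 0.
Proof.
rewrite /inner -[RHS](_ : \int[mu]_(x in U) cst 0 x = 0).
  by apply: eq_Rintegral => x _; rewrite fctE mul0r.
by rewrite Rintegral_cst// mul0r.
Qed.

Lemma ipZl a f k : L2 f -> L2 k -> ip (a *: f) k = a * ip f k.
Proof.
by move=> Lf Lk; rewrite -[a *: f]addr0 ip_linl// ?ip0l ?addr0//; exact: L2_0.
Qed.

Lemma ipBl f g k : L2 f -> L2 g -> L2 k -> ip (f - g) k = ip f k - ip g k.
Proof.
move=> Lf Lg Lk; rewrite ipDl//; last by rewrite -scaleN1r; exact: L2_Z.
by rewrite -scaleN1r ipZl// mulN1r.
Qed.

Lemma ip_suml (I : Type) (r : seq I) (P : pred I) (F : I -> T -> R) k :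
  (forall i, L2 (F i)) -> L2 k ->
  ip (\sum_(i <- r | P i) F i) k = \sum_(i <- r | P i) ip (F i) k.
Proof.
move=> LF Lk; elim: r => [|i r IH]; first by rewrite !big_nil ip0l.
rewrite !big_cons; case: ifP => // _.
by rewrite ipDl ?IH//; exact: L2_sum.
Qed.

Lemma ipDr f g k : L2 f -> L2 g -> L2 k -> ip k (f + g) = ip k f + ip k g.
Proof. by move=> *; rewrite ipC ipDl// !(ipC _ _ k). Qed.

Lemma ipZr a f k : L2 f -> L2 k -> ip k (a *: f) = a * ip k f.
Proof. by move=> *; rewrite ipC ipZl// (ipC _ _ k). Qed.

Lemma ipBr f g k : L2 f -> L2 g -> L2 k -> ip k (f - g) = ip k f - ip k g.
Proof. by move=> *; rewrite ipC ipBl// !(ipC _ _ k). Qed.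

Lemma ip_sumr (I : Type) (r : seq I) (P : pred I) (F : I -> T -> R) k :
  (forall i, L2 (F i)) -> L2 k ->
  ip k (\sum_(i <- r | P i) F i) = \sum_(i <- r | P i) ip k (F i).
Proof. by move=> *; rewrite ipC ip_suml//; under eq_bigr do rewrite ipC. Qed.

Lemma integral_sum_ip (I : finType) (F G : I -> T -> R) :
  (forall i, L2 (F i)) -> (forall i, L2 (G i)) ->
  \int[mu]_(x in U) (\sum_i F i x * G i x) = \sum_i ip (F i) (G i).
Proof.
move=> LF LG; apply: (Rintegral_sum _ mU _).2 => i; exact: ip_integrable.
Qed.

Lemma integral_sum2_ip (I J : finType) (F G : I -> J -> T -> R) :
  (forall i j, L2 (F i j)) -> (forall i j, L2 (G i j)) ->
  \int[mu]_(x in U) (\sum_i \sum_j F i j x * G i j x) =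
  \sum_i \sum_j ip (F i j) (G i j).
Proof.
move=> LF LG; rewrite pair_bigA /=.
rewrite -(@integral_sum_ip _ (fun p => F p.1 p.2) (fun p => G p.1 p.2))//.
by apply: eq_Rintegral => x _; rewrite pair_bigA.
Qed.

Lemma nrmZ a f : L2 f -> nrm (a *: f) = `|a| * nrm f.
Proof.
move=> Lf; rewrite /norm2 ipZl ?ipZr//; last exact: L2_Z.
by rewrite mulrA -expr2 sqrtrM ?sqr_ge0// sqrtr_sqr.
Qed.

Lemma nrmD_le f g : L2 f -> L2 g -> nrm (f + g) <= nrm f + nrm g.
Proof.
move=> Lf Lg; rewrite -(ler_pXn2r (ltn0Sn 1)) ?nnegrE ?addr_ge0 ?nrm_ge0//.
rewrite sqr_nrm ipDl ?ipDr//; last exact: L2_D.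
have := le_trans (ler_norm _) (cauchy_schwarz mU Lf Lg).
by rewrite -!sqr_nrm (ipC _ _ g f) sqrrD; lra.
Qed.

Lemma nrm_le_cvg f g : L2 f -> L2 g -> nrm f <= nrm g + nrm (f - g).
Proof.
by move=> Lf Lg; have := nrmD_le Lg (L2_B Lf Lg); rewrite subrKC.
Qed.

(** Cauchy-Schwarz lets a function of zero norm be dropped from products without passing through
    almost-everywhere equality. This serves for the divergence and for the defect of the pressure
    decomposition. *)
Lemma nrm0_ip f g : L2 f -> L2 g -> nrm f = 0 -> ip f g = 0.
Proof.
move=> Lf Lg f0; apply/eqP; rewrite -normr_eq0 -[_ == _]negbK.
by apply/negP => /negP; rewrite eq_le normr_ge0 andbT
  (le_trans (cauchy_schwarz mU Lf Lg))// f0 mul0r.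
Qed.

(** Membership in L2 is included because [nrm] is total: for a function outside L2 its value carries
    no information. *)
Definition strong_cvg (f_ : nat -> T -> R) f :=
  [/\ forall n, L2 (f_ n), L2 f & nrm (f_ n - f) @[n --> \oo] --> 0].

Lemma strong_cvg_cst f : L2 f -> strong_cvg (fun=> f) f.
Proof.
move=> Lf; split=> //.
by under eq_fun do rewrite subrr /norm2 ip0l sqrtr0; exact: cvg_cst.
Qed.

Lemma strong_cvgD (f_ g_ : nat -> T -> R) f g : strong_cvg f_ f -> strong_cvg g_ g ->
  strong_cvg (fun n => f_ n + g_ n) (f + g).
Proof.
move=> [Lf_ Lf cf] [Lg_ Lg cg]; split=> [n||]; [exact: L2_D..|].
apply: (@squeeze_cvgr _ _ _ _ (cst 0) (fun n => nrm (f_ n - f) + nrm (g_ n - g))).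
- apply: nearW => n; rewrite nrm_ge0 /=.
  by rewrite opprD addrACA nrmD_le//; exact: L2_B.
- exact: cvg_cst.
- by rewrite -[0]addr0; exact: cvgD.
Qed.

Lemma strong_cvgZ a (f_ : nat -> T -> R) f : strong_cvg f_ f ->
  strong_cvg (fun n => a *: f_ n) (a *: f).
Proof.
move=> [Lf_ Lf cf]; split=> [n||]; [exact: L2_Z..|].
have -> : (fun n => nrm (a *: f_ n - a *: f)) = (fun n => `|a| * nrm (f_ n - f)).
  by apply/funext => n; rewrite -scalerBr nrmZ//; exact: L2_B.
by rewrite -[0](mulr0 `|a|); apply: cvgMl_tmp.
Qed.

Lemma strong_cvg_ip (f_ g_ : nat -> T -> R) f g : strong_cvg f_ f -> strong_cvg g_ g ->
  ip (f_ n) (g_ n) @[n --> \oo] --> ip f g.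
Proof.
move=> [Lf_ Lf cf] [Lg_ Lg cg]; apply/subr_cvg0; apply/norm_cvg0P.
(* The norm of [g_ n] is estimated by that of [g] plus that of the difference, which replaces a
   separate boundedness argument for the sequence. *)
apply: (@squeeze_cvgr _ _ _ _ (cst 0) (fun n => nrm (f_ n - f) * (nrm g + nrm (g_ n - g))
   + nrm f * nrm (g_ n - g))).
- apply: nearW => n; rewrite normr_ge0 /=.
  have -> : ip (f_ n) (g_ n) - ip f g = ip (f_ n - f) (g_ n) + ip f (g_ n - g).
    by rewrite ipBl ?ipBr// subrKA.
  apply: le_trans (ler_normD _ _) _; apply: lerD.
    apply: le_trans (cauchy_schwarz mU _ _) _ => //; first exact: L2_B.
    by apply: ler_wpM2l; [exact: nrm_ge0|exact: nrm_le_cvg].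
  by apply: cauchy_schwarz => //; exact: L2_B.
- exact: cvg_cst.
- rewrite -[X in _ --> X](_ : 0 * (nrm g + 0) + nrm f * 0 = 0).
    by apply: cvgD; [apply: cvgM => //; apply: cvgD => //; exact: cvg_cst|exact: cvgMl_tmp].
  by rewrite mul0r mulr0 addr0.
Qed.

Lemma integral_sqr f : L2 f -> (\int[mu]_(x in U) (f x ^+ 2)%:E = (ip f f)%:E)%E.
Proof.
move=> Lf; rewrite /inner /Rintegral fineK; last first.
  exact: integrable_fin_num (ip_integrable mU Lf Lf).
by apply: eq_integral => x _; rewrite expr2.
Qed.

Lemma inL2_sqr f : measurable_fun U f ->
  (\int[mu]_(x in U) (f x ^+ 2)%:E < +oo)%E -> L2 f.
Proof.
move=> mf ffin; rewrite /inL inE; apply/andP; rewrite !inE; split.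
  by apply/(measurable_restrictT _ mU).
rewrite /= /finite_norm unlock poweR_lty//; apply: le_lt_trans ffin.
rewrite [leRHS]integral_mkcond le_eqVlt; apply/orP; left; apply/eqP.
apply: eq_integral => x _; rewrite /= /patch; case: ifP => _.
  by rewrite powR_mulrn// -normrX ger0_norm ?sqr_ge0.
by rewrite normr0 powR0// pnatr_eq0.
Qed.

Section bounded_multiplier.
Variables (z : T -> R) (M : R).
Hypothesis mz : measurable_fun U z.
Hypothesis zM : forall x, U x -> `|z x| <= M.

Lemma inL_mulb (r : R) f : 1 <= r -> inL mu U r%:E f ->
  inL mu U r%:E (fun x => z x * f x).
Proof.
move=> r1 Lf; have mf := inL_measurable mU Lf.
have r0 : 0 < r by lra.
rewrite /inL inE; apply/andP; rewrite !inE; split.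
  by apply/(measurable_restrictT _ mU); exact: measurable_funM.
have := Lf; rewrite /inL inE => /andP[]; rewrite inE/= => mfU; rewrite inE /=.
rewrite /finite_norm unlock => /(lty_poweRy (invr_neq0 (lt0r_neq0 r0))) ffin.
apply: poweR_lty.
apply: (@le_lt_trans _ _ (\int[mu]_x ((`|M| `^ r)%:E * (`|(f \_ U) x| `^ r)%:E))%E).
  apply: ge0_le_integral => //=.
  - apply/measurable_EFinP; apply: (measurableT_comp (measurable_powR _)).
    apply: measurableT_comp => //.
    by apply/(measurable_restrictT _ mU); exact: measurable_funM.
  - apply: emeasurable_funM => //; apply/measurable_EFinP.
    apply: (measurableT_comp (measurable_powR _)).
    by apply: measurableT_comp => //.
  - move=> x _; rewrite -EFinM lee_fin -powRM//.
    rewrite ge0_ler_powR ?nnegrE ?mulr_ge0 //; first lra.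
    rewrite /patch; case: ifP => xU; last by rewrite normr0 mulr0.
    rewrite normrM ler_wpM2r//; apply: le_trans (ler_norm _).
    by apply: zM; exact: set_mem.
rewrite ge0_integralZl//; last first.
  apply/measurable_EFinP; apply: (measurableT_comp (measurable_powR _)).
  by apply: measurableT_comp => //.
by rewrite lte_mul_pinfty// lee_fin powR_ge0.
Qed.

(** The bound is pointwise. The constant is the absolute value of [M] since [M] may be negative when
    [U] is empty. *)
Lemma nrm_mulb f : L2 f -> nrm (fun x => z x * f x) <= `|M| * nrm f.
Proof.
move=> Lf; have Lzf : L2 (fun x => z x * f x) by apply: inL_mulb => //; rewrite ler1n.
rewrite -(ler_pXn2r (ltn0Sn 1)) ?nnegrE ?mulr_ge0 ?nrm_ge0//.
rewrite exprMn !sqr_nrm -RintegralZl//; last exact: ip_integrable.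
apply: le_Rintegral => //; first exact: ip_integrable.
- rewrite (_ : _ \o _ = EFin \o (fun x => (`|M| ^+ 2 *: f) x * f x)).
    by apply: ip_integrable => //; exact: L2_Z.
  by apply/funext => x; rewrite /= !fctE mulrA.
- move=> x Ux; rewrite -!expr2 exprMn ler_wpM2r ?sqr_ge0//.
  rewrite -[z x ^+ 2]real_normK ?num_real// ler_pXn2r ?nnegrE//.
  by apply: le_trans (zM Ux) (ler_norm _).
Qed.

Lemma strong_cvg_mulb (f_ : nat -> T -> R) f : strong_cvg f_ f ->
  strong_cvg (fun n x => z x * f_ n x) (fun x => z x * f x).
Proof.
move=> [Lf_ Lf cf]; split=> [n||]; [by apply: inL_mulb => //; rewrite ler1n..|].
apply: (@squeeze_cvgr _ _ _ _ (cst 0) (fun n => `|M| * nrm (f_ n - f))).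
- apply: nearW => n; rewrite nrm_ge0 /=.
  have -> : (fun x => z x * f_ n x) - (fun x => z x * f x) =
            (fun x => z x * (f_ n - f) x).
    by apply/funext => x; rewrite !fctE mulrBr.
  by apply: nrm_mulb; exact: L2_B.
- exact: cvg_cst.
- by rewrite -[0](mulr0 `|M|); exact: cvgMl_tmp.
Qed.

End bounded_multiplier.
End L2_space.

(** * Measurability of open sets and boxes *)

Section countable_base.

(** Enough of a countable base to write every open set as a countable union of sets in [meas]. The
    class [meas] is a parameter because on products the topology and the sigma-algebra belong to
    different structures. *)
Definition has_cbase (T : topologicalType) (meas : set T -> Prop) :=
  exists B : nat -> set T, (forall n, meas (B n)) /\
    forall x A, nbhs x A -> exists n, B n x /\ B n `<=` A.

Lemma has_cbase_prod (T1 T2 : topologicalType) (meas1 : set T1 -> Prop)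
    (meas2 : set T2 -> Prop) (meas : set (T1 * T2) -> Prop) :
  (forall A B, meas1 A -> meas2 B -> meas (A `*` B)) ->
  has_cbase meas1 -> has_cbase meas2 -> has_cbase meas.
Proof.
move=> mX [B1 [mB1 b1]] [B2 [mB2 b2]].
(* Pairs of indices are coded by [pickle]; the default for numbers that code no pair only has to lie
   in [meas]. *)
exists (fun n => if unpickle n is Some (i, j) then B1 i `*` B2 j else B1 0%N `*` B2 0%N).
split=> [n|[x y] A].
  by case: unpickle => [[i j]|]; exact: mX.
move=> [[P Q] [/= nP nQ] PQA].
have [i [Bx BP]] := b1 _ _ nP; have [j [By BQ]] := b2 _ _ nQ.
exists (pickle (i, j)); rewrite pickleK; split=> // z [/= /BP Pz /BQ Qz].
exact: PQA.
Qed.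

Lemma has_cbase_open (T : topologicalType) (meas : set T -> Prop) :
  has_cbase meas -> meas set0 ->
  (forall F : nat -> set T, (forall n, meas (F n)) -> meas (\bigcup_n F n)) ->
  forall A, open A -> meas A.
Proof.
move=> [B [mB b]] m0 mU A oA.
have -> : A = \bigcup_n (if `[<B n `<=` A>] then B n else set0).
  apply/seteqP; split=> x.
    move=> Ax; have [n [Bx BA]] := b _ _ (open_nbhs_nbhs (conj oA Ax)).
    by exists n => //=; rewrite asboolT.
  by move=> [n _]; case: asboolP => // BA /BA.
by apply: mU => n; case: ifP.
Qed.

End countable_base.

Section open_measurable.
Context (R : realType).

Lemma has_cbase_R : has_cbase (measurable : set (set (measurableTypeR R))).
Proof.
pose B (a b : rat) : set R := `]ratr a, ratr b[%classic.
exists (fun n => if unpickle n is Some (a, b) then B a b else set0).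
split=> [n|x A].
  by case: unpickle => [[a b]|]; [exact: measurable_itv|exact: measurable0].
move=> /nbhs_ballP[e /= e0 eA].
have [a] : exists a : rat, ratr a \in `]x - e, x[.
  by apply: rat_in_itvoo; lra.
rewrite in_itv /= => /andP[xa ax].
have [b] : exists b : rat, ratr b \in `]x, x + e[.
  by apply: rat_in_itvoo; lra.
rewrite in_itv /= => /andP[xb bx].
exists (pickle (a, b)); rewrite pickleK; split.
  by rewrite /B /= in_itv /= ax.
move=> y; rewrite /B /= in_itv /= => /andP[ay yb]; apply: eA.
by rewrite /ball /= ltr_norml; apply/andP; split; lra.
Qed.

Lemma has_cbase_R2 :
  has_cbase (measurable : set (set (measurableTypeR R * measurableTypeR R))).
Proof.
apply: (has_cbase_prod _ has_cbase_R has_cbase_R) => A B mA mB.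
exact: measurableX.
Qed.

Lemma has_cbase_R3 :
  has_cbase (measurable : set (set (measurableTypeR R * measurableTypeR R * measurableTypeR R))).
Proof.
apply: (has_cbase_prod _ has_cbase_R2 has_cbase_R) => A B mA mB.
exact: measurableX.
Qed.

Lemma open_measurable2 (A : set (R * R)) : open A ->
  measurable (A : set (pt (plane2 R))).
Proof.
apply: (has_cbase_open has_cbase_R2); first exact: measurable0.
by move=> F mF; exact: bigcup_measurable.
Qed.

Lemma open_measurable3 (A : set (R * R * R)) : open A ->
  measurable (A : set (pt (space3 R))).
Proof.
apply: (has_cbase_open has_cbase_R3); first exact: measurable0.
by move=> F mF; exact: bigcup_measurable.
Qed.

Lemma continuous_measurable2 (f : R * R -> R) : continuous f ->
  measurable_fun setT (f : pt (plane2 R) -> R).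
Proof.
move=> /continuousP cf; apply: (measurability _ (RGenOpens.measurableE R)) => //.
move=> _ [_ [a [b ->] <-]]; rewrite setTI; apply: open_measurable2; apply: cf.
exact: interval_open.
Qed.

Lemma continuous_measurable3 (f : R * R * R -> R) : continuous f ->
  measurable_fun setT (f : pt (space3 R) -> R).
Proof.
move=> /continuousP cf; apply: (measurability _ (RGenOpens.measurableE R)) => //.
move=> _ [_ [a [b ->] <-]]; rewrite setTI; apply: open_measurable3; apply: cf.
exact: interval_open.
Qed.

End open_measurable.

Section boxes.
Context (R : realType).
Implicit Types (M : R).

Definition box2 M : set (R * R) := `[-M, M]%classic `*` `[-M, M]%classic.
Definition box3 M : set (R * R * R) := box2 M `*` `[-M, M]%classic.

Lemma compact_box2 M : compact (box2 M).
Proof. by apply: compact_setX; exact: segment_compact. Qed.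

Lemma compact_box3 M : compact (box3 M).
Proof. by apply: compact_setX; [exact: compact_box2|exact: segment_compact]. Qed.

Lemma measurable_box2 M : measurable (box2 M : set (pt (plane2 R))).
Proof. by apply: measurableX; exact: measurable_itv. Qed.

Lemma measurable_box3 M : measurable (box3 M : set (pt (space3 R))).
Proof. by apply: measurableX; [exact: measurable_box2|exact: measurable_itv]. Qed.

Lemma leb1_itv M : (leb1 R [set` `[-M, M]%R] < +oo)%E.
Proof. by rewrite /leb1 /= lebesgue_measure_itv; case: ifP; rewrite /= ?ltry. Qed.

Lemma box2_fin M : (leb2 R (box2 M) < +oo)%E.
Proof.
have -> : leb2 R (box2 M) = (leb1 R [set` `[-M, M]%R] * leb1 R [set` `[-M, M]%R])%E.
  by apply: (product_measure1E (leb1 R) (@lebesgue_measure R)); exact: measurable_itv.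
by apply: lte_mul_pinfty; rewrite ?measure_ge0 ?ge0_fin_numE// leb1_itv.
Qed.

Lemma box3_fin M : (leb3 R (box3 M) < +oo)%E.
Proof.
have -> : leb3 R (box3 M) = (leb2 R (box2 M) * leb1 R [set` `[-M, M]%R])%E.
  apply: (product_measure1E (leb2 R) (@lebesgue_measure R)).
    exact: measurable_box2.
  exact: measurable_itv.
apply: lte_mul_pinfty; rewrite ?measure_ge0 ?ge0_fin_numE//; first exact: box2_fin.
exact: leb1_itv.
Qed.

Lemma bounded_sub_box2 (A : set (R * R)) : bounded_set A -> exists M, A `<=` box2 M.
Proof.
move=> [M [_ /(_ (`|M| + 1))]].
have MM : M < `|M| + 1 by rewrite (le_lt_trans (ler_norm M))//; lra.
move=> /(_ MM) H; exists (`|M| + 1) => -[x y] /H /=.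
by rewrite prod_normE /= ge_max !ler_norml /box2 /= => /andP[]; rewrite !in_itv.
Qed.

Lemma compact_sub_box3 (A : set (R * R * R)) : compact A -> exists M, A `<=` box3 M.
Proof.
move=> /compact_bounded[M [_ /(_ (`|M| + 1))]].
have MM : M < `|M| + 1 by rewrite (le_lt_trans (ler_norm M))//; lra.
move=> /(_ MM) H; exists (`|M| + 1) => -[[x y] z] /H /=.
rewrite !prod_normE /= !ge_max !ler_norml /box3 /box2 /= => /andP[/andP[]].
by rewrite !in_itv.
Qed.

Lemma box2_le M N : M <= N -> box2 M `<=` box2 N.
Proof.
move=> MN [x y] [/=]; rewrite !in_itv /= => /andP[? ?] /andP[? ?].
by split; rewrite /= in_itv /=; apply/andP; split; lra.
Qed.

End boxes.

(** * Smooth and test functions *)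

Section directional_derivatives.
Context (R : realType) (V : normedModType R).
Implicit Types (f g : V -> R) (x y v w : V) (U A : set V).

(** The two difference quotients are the same function. This gives directional derivatives access to
    one-variable calculus: the mean value theorem, the fundamental theorem, differentiation under
    the integral. *)
Lemma is_derive_line f y v (a : R) : derivable f (y + a *: v) v ->
  is_derive a 1 (fun t : R => f (y + t *: v)) ('D_v f (y + a *: v)).
Proof.
pose F (t : R) := f (y + t *: v).
have E : (fun h : R => h^-1 *: ((F \o shift a) (h *: 1) - F a)) =
    (fun h => h^-1 *: ((f \o shift (y + a *: v)) (h *: v) - f (y + a *: v))).
  by apply/funext => h; rewrite /F /= scalerDl [h *: 1]mulr1 addrCA.
move=> df; split.
  by rewrite /derivable E; exact: df.
by rewrite /derive E.
Qed.

Lemma derive_mvt f y v (s : R) : 0 < s -> (forall x, derivable f x v) ->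
  exists2 a : R, 0 < a < s &
    f (y + s *: v) - f y = s * 'D_v f (y + a *: v).
Proof.
move=> s0 df.
pose F (t : R) := f (y + t *: v).
have dF (t : R) : is_derive t 1 F ('D_v f (y + t *: v)).
  by apply: is_derive_line.
have cF : {within `[0, s], continuous F}.
  apply: derivable_within_continuous => t _.
  by have [] := dF t.
have [c] := MVT s0 (fun t _ => dF t) cF.
rewrite in_itv /= => cs E; exists c => //.
by move: E; rewrite /F scale0r addr0 subr0 mulrC.
Qed.

(** Two applications of the mean value theorem: along [v] to the increment of [f] in direction [w],
    then along [w] to the derivative of [f] in direction [v]. *)
Lemma second_difference f x v w (s t : R) : 0 < s -> 0 < t ->
  (forall y, derivable f y v) -> (forall y, derivable ('D_v f) y w) ->
  exists a b : R, [/\ 0 < a < s, 0 < b < t &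
    f (x + s *: v + t *: w) - f (x + s *: v) - (f (x + t *: w) - f x)
    = s * (t * 'D_w ('D_v f) (x + a *: v + b *: w))].
Proof.
move=> s0 t0 dv dwv.
pose g y := f (y + t *: w) - f y.
have dsh y : is_derive y v (fun y => f (y + t *: w)) ('D_v f (y + t *: w)).
  pose F y := f (y + t *: w).
  have E : (fun h : R => h^-1 *: ((F \o shift y) (h *: v) - F y)) =
    (fun h => h^-1 *: ((f \o shift (y + t *: w)) (h *: v) - f (y + t *: w))).
    by apply/funext => h; rewrite /F /= addrA.
  split; first by rewrite /derivable E; exact: dv.
  by rewrite /derive E.
have dg y : is_derive y v g ('D_v f (y + t *: w) - 'D_v f y).
  exact: (is_deriveB (dsh y) (derivableP (dv y))).
have [a as_ Ea] := @derive_mvt g x v s s0 (fun y => ltac:(by have [] := dg y)).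
have [b bt Eb] := @derive_mvt ('D_v f) (x + a *: v) w t t0 dwv.
exists a, b; split=> //.
have -> : f (x + s *: v + t *: w) - f (x + s *: v) - (f (x + t *: w) - f x) =
  g (x + s *: v) - g x by [].
rewrite Ea; congr (_ * _).
by have [_ ->] := dg (x + a *: v).
Qed.

Lemma mulf2I (t a b : R) : t != 0 -> t * (t * a) = t * (t * b) -> a = b.
Proof. by move=> t0 /(mulfI t0) /(mulfI t0). Qed.

Lemma ball00 (r t c d : R) : t < r -> 0 < c < t -> 0 < d < t ->
  ball ((0 : R), (0 : R)) r (c, d).
Proof.
move=> tr /andP[c0 ct] /andP[d0 dt].
by split; rewrite -ball_normE /ball_ /= sub0r normrN gtr0_norm// (lt_trans _ tr).
Qed.

(** Schwarz's theorem. The second difference over a small parallelogram is symmetric in [v] and [w],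
    so the two mixed derivatives take a common value at two points close to [x]; continuity then
    identifies them at [x] up to any [e]. *)
Lemma derive_comm f v w x :
  (forall y, derivable f y v) -> (forall y, derivable f y w) ->
  (forall y, derivable ('D_v f) y w) -> (forall y, derivable ('D_w f) y v) ->
  continuous ('D_w ('D_v f)) -> continuous ('D_v ('D_w f)) ->
  'D_w ('D_v f) x = 'D_v ('D_w f) x.
Proof.
move=> dv dw dwv dvw cwv cvw.
apply/eqP; rewrite -subr_eq0; apply/eqP/le_anti/andP.
pose P (a b : R) := x + a *: v + b *: w.
have cP : forall (h : V -> R), continuous h ->
    h (P z.1 z.2) @[z --> ((0 : R), (0 : R))] --> h x.
  move=> h ch.
  have -> : h x = h (P 0 0) by rewrite /P !scale0r !addr0.
  apply: (@cvg_comp _ _ _ (fun z : R * R => P z.1 z.2) h _ (nbhs (P 0 0))); last exact: ch.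
  rewrite /P; apply: cvgD; last first.
    by apply: cvgZr_tmp; exact: cvg_snd.
  apply: cvgD; first exact: cvg_cst.
  by apply: cvgZr_tmp; exact: cvg_fst.
suff H (e : R) : 0 < e -> `|'D_w ('D_v f) x - 'D_v ('D_w f) x| <= e.
  have : `|'D_w ('D_v f) x - 'D_v ('D_w f) x| <= 0.
    by apply/ler_addgt0Pr => e e0; rewrite add0r; exact: H.
  by rewrite normr_le0 => /eqP ->; rewrite lexx.
move=> e0.
have e20 : 0 < e / 2 by lra.
have := cP _ cwv => /cvgrPdist_lt /(_ _ e20) H1.
have := cP _ cvw => /cvgrPdist_lt /(_ _ e20) H2.
have Hn : nbhs ((0 : R), (0 : R))
    [set z : R * R | `|'D_w ('D_v f) x - 'D_w ('D_v f) (P z.1 z.2)| < e / 2 /\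
       `|'D_v ('D_w f) x - 'D_v ('D_w f) (P z.1 z.2)| < e / 2].
  by apply: filterI; [exact: H1|exact: H2].
have [r /= r0 Hr] := (nbhs_ballP _ _).1 Hn.
have [t t0 tr] : exists2 t, 0 < t & t < r by exists (r / 2); lra.
have [a [b [ha hb E1]]] := second_difference x t0 t0 dv dwv.
have [b' [a' [hb' ha' E2]]] := second_difference x t0 t0 dw dvw.
have tn0 : t != 0 by rewrite gt_eqF.
have EE : 'D_w ('D_v f) (P a b) = 'D_v ('D_w f) (P a' b').
  move: E2; rewrite (addrAC x (t *: w)) (addrAC x (b' *: w)) -/(P a' b') => E2.
  move: E1; rewrite -/(P a b) => E1.
  have E12 : f (x + t *: v + t *: w) - f (x + t *: v) - (f (x + t *: w) - f x) =
    f (x + t *: v + t *: w) - f (x + t *: w) - (f (x + t *: v) - f x).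
    by rewrite !opprB !addrA; rewrite addrAC [RHS]addrAC; congr (_ + _); exact: addrAC.
  have E3 := etrans (esym E1) (etrans E12 E2).
  exact: mulf2I tn0 E3.
have [/= h1 _] := Hr _ (ball00 tr ha hb).
have [/= _ h2] := Hr _ (ball00 tr ha' hb').
have -> : 'D_w ('D_v f) x - 'D_v ('D_w f) x =
   ('D_w ('D_v f) x - 'D_w ('D_v f) (P a b)) - ('D_v ('D_w f) x - 'D_v ('D_w f) (P a' b')).
  by rewrite EE opprB subrKA.
apply: le_trans (ler_normB _ _) _.
rewrite (splitr e); apply: lerD; apply: ltW; [exact: h1|exact: h2].
Qed.

(** The complement of [A] is a neighbourhood of [x] on which [f] vanishes, and derivatives are
    local. *)
Lemma derive_outside f v A x : closed A -> (forall y, ~ A y -> f y = 0) ->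
  ~ A x -> 'D_v f x = 0.
Proof.
move=> cA f0 nAx.
have : \near x, f x = cst 0 x.
  have oA : open (~` A) by exact: closed_openC.
  by apply: filterS (open_nbhs_nbhs (conj oA nAx)) => y /f0.
move=> /(@near_eq_derive R V R).
by move=> /(_ v) ->; rewrite derive_cst.
Qed.

End directional_derivatives.

Section smooth_functions.
Context (R : realType) (V : normedModType R).
Implicit Types (f g : V -> R) (x y v w : V) (U A : set V).

Lemma smooth_on_derive U f v : smooth_on U f -> smooth_on U ('D_v f).
Proof.
move=> sf s x Ux; have := sf (rcons s v) x Ux.
by rewrite /iter_derive foldr_rcons.
Qed.

Lemma smooth_on_derivable U f v x : smooth_on U f -> U x -> derivable f x v.
Proof. by move=> sf Ux; have [_] := sf [::] x Ux; apply. Qed.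

Lemma smooth_on_continuous U f x : smooth_on U f -> U x ->
  {for x, continuous f}.
Proof. by move=> sf Ux; have [+ _] := sf [::] x Ux. Qed.

Lemma smooth_continuous f : smooth_on setT f -> continuous f.
Proof. by move=> sf x; exact: (smooth_on_continuous sf). Qed.

Lemma smooth_derive_comm f v w x : smooth_on setT f ->
  'D_w ('D_v f) x = 'D_v ('D_w f) x.
Proof.
move=> sf; apply: derive_comm => [y|y|y|y||].
- exact: smooth_on_derivable sf _.
- exact: smooth_on_derivable sf _.
- exact: smooth_on_derivable (smooth_on_derive v sf) _.
- exact: smooth_on_derivable (smooth_on_derive w sf) _.
- by apply: smooth_continuous; apply: smooth_on_derive; exact: smooth_on_derive.
- by apply: smooth_continuous; apply: smooth_on_derive; exact: smooth_on_derive.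
Qed.

Lemma supp_outside f x : ~ closure [set x | f x != 0] x -> f x = 0.
Proof.
move=> nfx; apply/eqP; rewrite -[_ == _]negbK; apply/negP => fx; apply: nfx.
exact: subset_closure.
Qed.

Lemma test_fun_outside U f x : test_fun U f -> ~ U x -> f x = 0.
Proof. by move=> [_ _ sU] nUx; apply: supp_outside => /sU. Qed.

Lemma test_fun_smooth U f : test_fun U f -> smooth_on setT f.
Proof. by case. Qed.

Lemma test_fun_derive U f v : test_fun U f -> test_fun U ('D_v f).
Proof.
move=> [sf cf fU].
have sub : closure [set x | 'D_v f x != 0] `<=` closure [set x | f x != 0].
  rewrite [X in _ `<=` X]((closure_id _).1 (@closed_closure _ _)).
  apply: closure_subset => x /= dfx; apply: contrapT => nx.
  move/eqP: dfx; apply; apply: derive_outside nx; first exact: closed_closure.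
  by move=> y; exact: supp_outside.
split; first exact: smooth_on_derive.
- by apply: subclosed_compact cf sub; exact: closed_closure.
- exact: subset_trans sub fU.
Qed.

Lemma smooth_on_cst c : smooth_on setT (cst c : V -> R).
Proof.
move=> s x _.
have [k ->] : exists k, iter_derive s (cst c) = cst k :> (V -> R).
  elim: s => [|v s [k IH]]; first by exists c.
  exists 0; rewrite /iter_derive /= -/(iter_derive s (cst c)) IH.
  by apply/funext => y; rewrite derive_cst.
by split; [exact: cvg_cst|move=> v; exact: derivable_cst].
Qed.

Lemma test_fun0 U : test_fun U (0 : V -> R).
Proof.
have E : [set x : V | (0 : V -> R) x != 0] = set0.
  by apply/seteqP; split=> x //=; rewrite eqxx.
split; rewrite ?E ?closure0//; first exact: smooth_on_cst.
exact: compact0.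
Qed.

End smooth_functions.

(** * Integrals of derivatives of compactly supported functions *)

Section integrable_bounded_support.
Context d (T : measurableType d) (R : realType).
Variables (mu : {measure set T -> \bar R}).

Lemma bounded_support_integrable (B : set T) (M : R) (f : T -> R) :
  measurable B -> (mu B < +oo)%E -> measurable_fun setT f ->
  (forall x, B x -> `|f x| <= M) -> (forall x, ~ B x -> f x = 0) ->
  mu.-integrable setT (EFin \o f).
Proof.
move=> mB Bfin mf fM f0.
have -> : EFin \o f = (EFin \o f) \_ B.
  apply/funext => x; rewrite /patch; case: ifPn => // /negP xB.
  by rewrite /= f0// => Bx; apply: xB; rewrite inE.
apply/(integrable_mkcond _ mB).
apply: measurable_bounded_integrable => //.
  by apply: measurable_funS mf.
exists M; split; first exact: num_real.
by move=> N MN x Bx /=; apply: le_trans (fM _ Bx) (ltW MN).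
Qed.

End integrable_bounded_support.

Section boxes.
Context (R : realType).

Lemma compact_range_bounded (V : topologicalType) (f : V -> R) (A : set V) :
  compact A -> continuous f -> exists M, forall x, A x -> `|f x| <= M.
Proof.
move=> cA cf.
have : compact (f @` A).
  by apply: continuous_compact => //; exact: continuous_subspaceT.
move=> /compact_bounded[M [_ /(_ (`|M| + 1))]].
have MM : M < `|M| + 1 by rewrite (le_lt_trans (ler_norm M))//; lra.
by move=> /(_ MM) H; exists (`|M| + 1) => x Ax; apply: H; exists x.
Qed.

Lemma box3_integrable (f : R * R * R -> R) M : continuous f ->
  (forall x, ~ box3 M x -> f x = 0) ->
  (leb3 R).-integrable setT (EFin \o f).
Proof.
move=> cf f0; have [B fB] := compact_range_bounded (@compact_box3 _ M) cf.
exact: (@bounded_support_integrable _ (pt (space3 R)) R (leb3 R) (box3 M) B f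
  (@measurable_box3 _ M) (box3_fin M) (continuous_measurable3 cf) fB f0).
Qed.

Lemma box2_integrable (f : R * R -> R) M : continuous f ->
  (forall x, ~ box2 M x -> f x = 0) ->
  (leb2 R).-integrable setT (EFin \o f).
Proof.
move=> cf f0; have [B fB] := compact_range_bounded (@compact_box2 _ M) cf.
exact: (@bounded_support_integrable _ (pt (plane2 R)) R (leb2 R) (box2 M) B f
  (@measurable_box2 _ M) (box2_fin M) (continuous_measurable2 cf) fB f0).
Qed.

Lemma integral_derive_compact (f g : R -> R) (M : R) :
  (forall t : R, is_derive t 1 f (g t)) -> continuous g ->
  (forall t : R, ~ (- M <= t <= M) -> f t = 0) ->
  (\int[leb1 R]_t (g t)%:E = 0)%E.
Proof.
move=> df cg f0.
have f0N (a : R) : ~ (-M <= a <= M) -> g a = 0.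
  move=> na; have [_ <-] := df a.
  apply: (@derive_outside _ _ _ _ [set` `[-M, M]]).
  - exact: itv_closed.
  - by move=> y ny; apply: f0 => /= yM; apply: ny; rewrite /= in_itv.
  - by rewrite /= in_itv.
(* Larger than [M], so that [f] vanishes at both endpoints, and positive, so that the interval is
   nondegenerate. *)
pose N : R := `|M| + 1.
have NM : M < N by rewrite /N (le_lt_trans (ler_norm M))//; lra.
have N0 : -N < N by rewrite /N; have := normr_ge0 M; lra.
transitivity (\int[leb1 R]_(t in [set` `[(- N)%R, N]]) (g t)%:E)%E.
  rewrite [RHS]integral_mkcond; apply: eq_integral => t _.
  rewrite /patch; case: ifPn => //; rewrite notin_setE /= in_itv /= => nt.
  rewrite f0N// => /andP[t1 t2]; apply: nt; apply/andP; split; lra.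
rewrite (@continuous_FTC2 _ g f)//.
- by rewrite !f0 ?sube0// => /andP[]; lra.
- exact: continuous_subspaceT.
- have cf : continuous f.
    move=> t; apply: differentiable_continuous.
    by apply/derivable1_diffP; have [] := df t.
  split.
  + by move=> x _; have [] := df x.
  + by apply: cvg_at_right_filter; exact: cf.
  + by apply: cvg_at_left_filter; exact: cf.
- by move=> x _; rewrite derive1E; have [_] := df x.
Qed.

End boxes.

Section integral_of_derivative.
Context (R : realType).
Local Notation R2 := (R * R)%type.
Local Notation R3 := (R * R * R)%type.

Lemma e3_line0 (y z t : R) :
  ((0, y), z) + t *: e3 R (inord 0) = ((t, y), z) :> R3.
Proof.
rewrite /e3 !inordK//=; congr (_, _, _) => /=.
- by rewrite add0r [_ *: _]mulr1.
- by rewrite [_ *: _]mulr0 addr0.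
- by rewrite [_ *: _]mulr0 addr0.
Qed.

Lemma e3_line1 (x z t : R) :
  ((x, 0), z) + t *: e3 R (inord 1) = ((x, t), z) :> R3.
Proof.
rewrite /e3 !inordK//=; congr (_, _, _) => /=.
- by rewrite [_ *: _]mulr0 addr0.
- by rewrite add0r [_ *: _]mulr1.
- by rewrite [_ *: _]mulr0 addr0.
Qed.

Lemma e3_line2 (x : R2) (t : R) : (x, 0) + t *: e3 R vert = (x, t) :> R3.
Proof.
case: x => x y; rewrite /e3 /=; congr (_, _, _) => /=.
- by rewrite [_ *: _]mulr0 addr0.
- by rewrite [_ *: _]mulr0 addr0.
- by rewrite add0r [_ *: _]mulr1.
Qed.

Lemma continuous_pair (T V W : topologicalType) (f : T -> V) (g : T -> W) :
  continuous f -> continuous g -> continuous (fun x => (f x, g x)).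
Proof. by move=> cf cg x; apply: cvg_pair; [exact: cf|exact: cg]. Qed.

Lemma continuous_compT (T V W : topologicalType) (f : T -> V) (g : V -> W) :
  continuous f -> continuous g -> continuous (fun x => g (f x)).
Proof. by move=> cf cg x; exact: (continuous_comp (cf x) (cg _)). Qed.

Lemma continuous_idfun (T : topologicalType) : continuous (fun x : T => x).
Proof. by move=> x; exact: cvg_id. Qed.

Section one_function.
Variables (g : R3 -> R) (M : R).
Hypothesis g0 : forall x, ~ box3 M x -> g x = 0.

Lemma derive_outside_box (v : R3) x : ~ box3 M x -> 'D_v g x = 0.
Proof.
move=> nx; apply: (@derive_outside _ _ g v (box3 M) x _ g0 nx).
exact: (compact_closed (@norm_hausdorff _ _) (@compact_box3 _ M)).
Qed.

Lemma integral_pder_line2 x : (forall x, derivable g x (e3 R vert)) ->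
  continuous ('D_(e3 R vert) g) ->
  (\int[leb1 R]_z ('D_(e3 R vert) g (x, z))%:E = 0)%E.
Proof.
move=> dg cg; apply: (@integral_derive_compact _ (fun z => g (x, z)) _ M).
- move=> t; have := @is_derive_line R _ g (x, 0) (e3 R vert) t (dg _).
  rewrite e3_line2; congr is_derive.
  by apply/funext => s; rewrite e3_line2.
- apply: continuous_compT cg.
  exact: (continuous_pair (@cst_continuous _ _ _) (@continuous_idfun _)).
- move=> t nt; apply: g0 => -[_ /=]; by rewrite in_itv.
Qed.

Lemma integral_pder_line1 x z : (forall x, derivable g x (e3 R (inord 1))) ->
  continuous ('D_(e3 R (inord 1)) g) ->
  (\int[leb1 R]_y ('D_(e3 R (inord 1)) g ((x, y), z))%:E = 0)%E.
Proof.
move=> dg cg; apply: (@integral_derive_compact _ (fun y => g ((x, y), z)) _ M).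
- move=> t; have := @is_derive_line R _ g ((x, 0), z) (e3 R (inord 1)) t (dg _).
  rewrite e3_line1; congr is_derive.
  by apply/funext => s; rewrite e3_line1.
- apply: continuous_compT cg.
  exact: (continuous_pair (continuous_pair (@cst_continuous _ _ _)
    (@continuous_idfun _)) (@cst_continuous _ _ _)).
- move=> t nt; apply: g0 => -[[_ /= +] _]; by rewrite in_itv.
Qed.

Lemma integral_pder_line0 y z : (forall x, derivable g x (e3 R (inord 0))) ->
  continuous ('D_(e3 R (inord 0)) g) ->
  (\int[leb1 R]_x ('D_(e3 R (inord 0)) g ((x, y), z))%:E = 0)%E.
Proof.
move=> dg cg; apply: (@integral_derive_compact _ (fun x => g ((x, y), z)) _ M).
- move=> t; have := @is_derive_line R _ g ((0, y), z) (e3 R (inord 0)) t (dg _).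
  rewrite e3_line0; congr is_derive.
  by apply/funext => s; rewrite e3_line0.
- apply: continuous_compT cg.
  exact: (continuous_pair (continuous_pair (@continuous_idfun _)
    (@cst_continuous _ _ _)) (@cst_continuous _ _ _)).
- move=> t nt; apply: g0 => -[[/= + _] _]; by rewrite in_itv.
Qed.

(** For each direction Fubini is applied in the order that makes the differentiated coordinate
    innermost; the one-dimensional integral is then zero by compact support. *)
Lemma integral_pder (i : 'I_3) : (forall x, derivable g x (e3 R i)) ->
  continuous ('D_(e3 R i) g) ->
  \int[leb3 R]_x 'D_(e3 R i) g x = 0.
Proof.
move=> dg cg.
have f0 x : ~ box3 M x -> 'D_(e3 R i) g x = 0 by exact: derive_outside_box.
have fint : (leb3 R).-integrable setT (EFin \o ('D_(e3 R i) g)).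
  exact: (box3_integrable cg f0).
suff E : (\int[leb3 R]_x ('D_(e3 R i) g x)%:E = 0)%E.
  by rewrite /Rintegral E.
have slice_int z : (leb2 R).-integrable setT
    (EFin \o (fun x => 'D_(e3 R i) g (x, z))).
  apply: (@box2_integrable _ _ M).
    apply: continuous_compT cg.
    exact: (continuous_pair (@continuous_idfun _) (@cst_continuous _ _ _)).
  by move=> x nx; apply: f0 => -[].
have [i0|[i1|i2]] : i = inord 0 \/ i = inord 1 \/ i = vert.
  case: i {fint slice_int dg cg f0} => -[|[|[|//]]] ? ; [left|right; left|right; right];
    by apply/val_inj; rewrite /= ?inordK.
- rewrite i0 in dg cg f0 fint slice_int *.
  apply: etrans (leb3_fubiniC fint) _; apply: integral0_eq => z _.
  apply: etrans (leb2_fubiniC (slice_int z)) _.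
  by apply: integral0_eq => y _; exact: integral_pder_line0.
- rewrite i1 in dg cg f0 fint slice_int *.
  apply: etrans (leb3_fubiniC fint) _; apply: integral0_eq => z _.
  apply: etrans (leb2_fubini (slice_int z)) _.
  by apply: integral0_eq => y _; exact: integral_pder_line1.
- rewrite i2 in dg cg f0 fint slice_int *.
  apply: etrans (leb3_fubini fint) _; apply: integral0_eq => z _.
  exact: integral_pder_line2.
Qed.

End one_function.
End integral_of_derivative.

(** * Integration by parts in Sobolev spaces *)

Section sobolev.
Context (R : realType).
Local Notation R3 := (R * R * R)%type.
Local Notation S3 := (space3 R).
Local Notation jet3 := (jet S3).
Variables (Om : set R3) (B : R).
Hypothesis oOm : open Om.
Hypothesis OmB : Om `<=` box3 B.
Local Notation L2 := (inL (leb3 R) (Om : set (pt S3)) 2%:E).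
Local Notation ip := (@inner _ (pt S3) R (leb3 R) Om).
Local Notation nrm := (@norm2 _ (pt S3) R (leb3 R) Om).
Local Notation strong_cvg := (@strong_cvg _ (pt S3) R (leb3 R) Om).
Local Notation cjet := (classical_jet S3).

Lemma mOm : measurable (Om : set (pt S3)).
Proof. exact: open_measurable3. Qed.
Local Hint Resolve mOm : core.

Lemma Om_fin : (leb3 R (Om : set (pt S3)) < +oo)%E.
Proof.
apply: le_lt_trans (box3_fin B); apply: le_measure; rewrite ?inE//.
exact: measurable_box3.
Qed.

Lemma continuous_inL (r : R) (f : R3 -> R) : 1 <= r -> continuous f ->
  Lr S3 Om r%:E f.
Proof.
move=> r1 cf; have [M fM] := compact_range_bounded (@compact_box3 _ B) cf.
apply: (@inL_bounded _ (pt S3) R (leb3 R) Om mOm r M f r1 Om_fin).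
- by apply: measurable_funS (continuous_measurable3 cf).
- by move=> x /OmB; exact: fM.
Qed.

Lemma continuous_L2 (f : R3 -> R) : continuous f -> L2 f.
Proof. by apply: continuous_inL; rewrite ler1n. Qed.

Lemma test_fun_box (U : set R3) f : test_fun U f ->
  exists M, forall x, ~ box3 M x -> f x = 0.
Proof.
move=> [_ cf _]; have [M fM] := compact_sub_box3 cf.
by exists M => x nx; apply: supp_outside => /fM.
Qed.

Lemma smooth_pder_continuous (f : R3 -> R) i : smooth_on setT f ->
  continuous ('D_(e3 R i) f).
Proof. by move=> sf; apply: smooth_continuous; exact: smooth_on_derive. Qed.

Lemma integral_zero_outside (f : R3 -> R) : (forall x, ~ Om x -> f x = 0) ->
  \int[leb3 R]_(x in Om) f x = \int[leb3 R]_x f x.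
Proof.
move=> f0; rewrite Rintegral_mkcond; apply: eq_Rintegral => x _.
by rewrite /patch; case: ifPn => //; rewrite notin_setE => /f0.
Qed.

(** The product [z * f] is supported in a box, so its derivative integrates to zero. Only one
    continuous partial derivative of [z] is asked for, in order to cover the product of the vertical
    coordinate with a test function in the Poincaré inequality. *)
Lemma c1_ibp (z f : R3 -> R) (i : 'I_3) : continuous z ->
  (forall x, derivable z x (e3 R i)) -> continuous ('D_(e3 R i) z) ->
  test_fun Om f ->
  ip z ('D_(e3 R i) f) = - ip ('D_(e3 R i) z) f.
Proof.
move=> cz dz cdz tf; have sf := test_fun_smooth tf.
have [M fM] := test_fun_box tf.
have cf := smooth_continuous sf.
have cdf : continuous ('D_(e3 R i) f) by exact: smooth_pder_continuous sf.
have df x : derivable f x (e3 R i) by apply: smooth_on_derivable sf _.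
have dzf x : 'D_(e3 R i) (z * f) x =
    z x * 'D_(e3 R i) f x + 'D_(e3 R i) z x * f x.
  by rewrite deriveM// [f x *: _]mulrC.
have tdf := test_fun_derive (e3 R i) tf.
rewrite /inner !integral_zero_outside; last 2 first.
- by move=> x nx; rewrite (test_fun_outside tf nx) mulr0.
- by move=> x nx; rewrite (test_fun_outside tdf nx) mulr0.
apply/eqP; rewrite -subr_eq0 opprK; apply/eqP.
have c1 : continuous (fun x => z x * 'D_(e3 R i) f x).
  by move=> x; apply: cvgM; [exact: cz|exact: cdf].
have c2 : continuous (fun x => 'D_(e3 R i) z x * f x).
  by move=> x; apply: cvgM; [exact: cdz|exact: cf].
rewrite -RintegralD//; last 2 first.
- apply: (@box3_integrable _ _ M) => // x nx.
  by rewrite (derive_outside_box fM)// mulr0.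
- by apply: (@box3_integrable _ _ M) => // x nx; rewrite fM// mulr0.
rewrite -[RHS](@integral_pder _ (z * f) M _ i).
- by apply: eq_Rintegral => x _; rewrite dzf.
- by move=> x nx; rewrite !fctE fM// mulr0.
- by move=> x; apply: derivableM.
- rewrite (_ : 'D_(e3 R i) (z * f) =
    (fun x => z x * 'D_(e3 R i) f x + 'D_(e3 R i) z x * f x)).
    by move=> x; apply: cvgD; [exact: c1|exact: c2].
  by apply/funext => x; rewrite dzf.
Qed.

Lemma smooth_ibp (z f : R3 -> R) (i : 'I_3) : smooth_on setT z -> test_fun Om f ->
  ip z ('D_(e3 R i) f) = - ip ('D_(e3 R i) z) f.
Proof.
move=> sz; apply: c1_ibp.
- exact: smooth_continuous.
- by move=> x; apply: smooth_on_derivable sz _.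
- exact: smooth_pder_continuous.
Qed.

Lemma smooth_W1 (r : R) (f : R3 -> R) : 1 <= r -> smooth_on setT f ->
  W1 S3 Om r%:E (cjet f).
Proof.
move=> r1 sf; split.
- by apply: continuous_inL => //; exact: smooth_continuous.
- by move=> i; apply: continuous_inL => //; exact: smooth_pder_continuous.
- by move=> i phi tphi; exact: smooth_ibp.
Qed.

Lemma LN2 (f : R3 -> R) : L2 f -> LN S3 Om 2%:E f = (nrm f)%:E.
Proof. exact: (normL2 mOm). Qed.

Lemma W1_L2 (u : jet3) : W1 S3 Om 2%:E u -> L2 u.1 /\ forall i, L2 (u.2 i).
Proof. by case. Qed.

Lemma W1N2 (u : jet3) : L2 u.1 -> (forall i, L2 (u.2 i)) ->
  W1N S3 Om 2%:E u = (nrm u.1 + \sum_i nrm (u.2 i))%:E.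
Proof.
move=> L1 L2'; rewrite /W1N LN2//.
rewrite [RHS]EFinD; congr (_ + _)%E.
by rewrite -sumEFin; apply: eq_bigr => i _; rewrite LN2.
Qed.

Lemma test_H10 f : test_fun Om f -> H10 S3 Om (cjet f).
Proof.
move=> tf; split; first by apply: smooth_W1; [rewrite ler1n|exact: test_fun_smooth tf].
exists (fun=> f); split=> // .
rewrite (_ : (fun _ => _) = cst 0%E); first exact: cvg_cst.
apply/funext => n; rewrite subrr W1N2 /=.
- by rewrite /norm2 ip0l ?sqrtr0 ?add0r ?big1//; exact: mOm.
- by apply: L2_0; exact: mOm.
- by move=> i; apply: L2_0; exact: mOm.
Qed.

Lemma H10_L2 (u : jet3) : H10 S3 Om u -> L2 u.1 /\ forall i, L2 (u.2 i).
Proof. by move=> [/W1_L2]. Qed.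

(** Each term of the sum defining [W1N] lies between 0 and the whole sum, so one limit in the
    extended reals gives strong convergence of the function and of every derivative. *)
Lemma H10_approx (u : jet3) : H10 S3 Om u ->
  exists phi : nat -> R3 -> R, [/\ forall n, test_fun Om (phi n),
    strong_cvg phi u.1 & forall i, strong_cvg (fun n => 'D_(e3 R i) (phi n)) (u.2 i)].
Proof.
move=> Hu; have [Lu Ldu] := H10_L2 Hu.
have [_ [phi [tphi cphi]]] := Hu; exists phi.
have Lphi n : L2 (phi n).
  by apply: continuous_L2; apply: smooth_continuous; exact: test_fun_smooth (tphi n).
have Ldphi n i : L2 ('D_(e3 R i) (phi n)).
  by apply: continuous_L2; apply: smooth_pder_continuous; exact: test_fun_smooth (tphi n).
have E n : W1N S3 Om 2%:E (cjet (phi n) - u) =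
    (nrm (phi n - u.1) + \sum_i nrm ('D_(e3 R i) (phi n) - u.2 i))%:E.
  by rewrite W1N2//= => [|i]; exact: L2_B.
have {}cphi : nrm (phi n - u.1) + \sum_i nrm ('D_(e3 R i) (phi n) - u.2 i)
   @[n --> \oo] --> (0 : R).
  rewrite (_ : (fun _ => _) = (fun n => fine (W1N S3 Om 2%:E (cjet (phi n) - u)))).
    exact: fine_cvg cphi.
  by apply/funext => n; rewrite E.
split=> //.
- split=> //; apply: (squeeze_cvgr _ (cvg_cst 0) cphi).
  apply: nearW => n; rewrite nrm_ge0 lerDl sumr_ge0// => i _; exact: nrm_ge0.
- move=> i; split=> //; apply: (squeeze_cvgr _ (cvg_cst 0) cphi).
  apply: nearW => n; rewrite nrm_ge0 /= (bigD1 i)//=.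
  rewrite addrCA lerDl addr_ge0 ?nrm_ge0// sumr_ge0// => j _; exact: nrm_ge0.
Qed.

(** For a test function in place of [w] this is the definition of the weak derivative of [Z]; both
    sides are continuous in [w]. The boundary condition rests on [w] alone, which later admits a
    pressure as [Z]. *)
Lemma H10_ibp (w Z : jet3) i : H10 S3 Om w -> W1 S3 Om 2%:E Z ->
  ip w.1 (Z.2 i) = - ip (w.2 i) Z.1.
Proof.
move=> /H10_approx[phi [tphi c0 c1]] WZ; have [LZ LdZ] := W1_L2 WZ.
have [_ _ wZ] := WZ.
have H1 := strong_cvg_ip mOm c0 (strong_cvg_cst mOm (LdZ i)).
apply: (cvg_unique _ H1) => //.
rewrite (_ : (fun _ => _) = (fun n => - ip ('D_(e3 R i) (phi n)) Z.1)).
  apply: cvgN; exact: (strong_cvg_ip mOm (c1 i) (strong_cvg_cst mOm LZ)).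
apply/funext => n; apply: etrans (ipC _ _ _ _) _; apply: oppr_inj.
rewrite opprK; apply: etrans (esym (wZ i _ (tphi n))) _; exact: ipC.
Qed.

(* Both sides equal [- ip u.1 (d_i d_j v)] when [v] is a test function. *)
Lemma H10_symmetry (u v : jet3) i j : H10 S3 Om u -> H10 S3 Om v ->
  ip (u.2 i) (v.2 j) = ip (u.2 j) (v.2 i).
Proof.
move=> Hu /H10_approx[phi [tphi c0 c1]]; have [Lu Ldu] := H10_L2 Hu.
have H1 := strong_cvg_ip mOm (strong_cvg_cst mOm (Ldu i)) (c1 j).
apply: (cvg_unique _ H1) => //.
rewrite (_ : (fun _ => _) = (fun n => ip (u.2 j) ('D_(e3 R i) (phi n)))).
  exact: (strong_cvg_ip mOm (strong_cvg_cst mOm (Ldu j)) (c1 i)).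
apply/funext => n; apply: oppr_inj.
have ibp k l : - ip (u.2 k) ('D_(e3 R l) (phi n)) =
    ip u.1 ('D_(e3 R k) ('D_(e3 R l) (phi n))).
  have W : W1 S3 Om 2%:E (cjet ('D_(e3 R l) (phi n))).
    apply: smooth_W1; first by rewrite ler1n.
    by apply: smooth_on_derive; exact: test_fun_smooth (tphi n).
  by rewrite (@H10_ibp _ _ k Hu W).
apply: etrans (ibp i j) _; apply: etrans _ (esym (ibp j i)).
have E : 'D_(e3 R i) ('D_(e3 R j) (phi n)) = 'D_(e3 R j) ('D_(e3 R i) (phi n)).
  apply/funext => x.
  exact: (smooth_derive_comm _ _ _ (test_fun_smooth (tphi n))).
exact: (f_equal (fun g => ip u.1 g) E).
Qed.

End sobolev.

(** * The vertical Poincaré inequality *)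

Section poincare.
Context (R : realType).
Local Notation R3 := (R * R * R)%type.
Local Notation S3 := (space3 R).
Local Notation jet3 := (jet S3).
Variables (Om : set R3) (B : R).
Hypothesis oOm : open Om.
Hypothesis OmB : Om `<=` box3 B.
Local Notation L2 := (inL (leb3 R) (Om : set (pt S3)) 2%:E).
Local Notation ip := (@inner _ (pt S3) R (leb3 R) Om).
Local Notation nrm := (@norm2 _ (pt S3) R (leb3 R) Om).
Local Notation mO := (mOm oOm).

Lemma is_derive_snd (x v : R3) : is_derive x v (snd : R3 -> R) v.2.
Proof.
have H : h^-1 *: (((snd : R3 -> R) \o shift x) (h *: v) - x.2) @[h --> 0^'] --> v.2.
  apply: cvg_near_cst; near=> h.
  rewrite /= addrK scalerA mulVf ?scale1r//.
  by near: h; exact: nbhs_dnbhs_neq.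
split; first exact: cvgP H.
exact: (cvg_lim (@norm_hausdorff _ _) H).
Unshelve. all: by end_near. Qed.

Lemma continuous_snd3 : continuous (snd : R3 -> R).
Proof. by move=> x; exact: cvg_snd. Qed.

(* [phi^2] is the vertical derivative of [z phi^2] up to [2 z phi d_z phi]. *)
Lemma poincare_test (phi : R3 -> R) : test_fun Om phi ->
  nrm phi <= 2 * `|B| * nrm ('D_(e3 R vert) phi).
Proof.
move=> tphi; have sphi := test_fun_smooth tphi.
have cphi := smooth_continuous sphi.
have cdphi : continuous ('D_(e3 R vert) phi) by exact: smooth_pder_continuous sphi.
have dphi x : derivable phi x (e3 R vert) by apply: smooth_on_derivable sphi _.
set dp := 'D_(e3 R vert) phi in cdphi *.
pose z : R3 -> R := snd.
have dzp x : is_derive x (e3 R vert) (z * phi) (phi x + z x * dp x).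
  have := is_deriveM (is_derive_snd x (e3 R vert)) (derivableP (dphi x)).
  by rewrite addrC [phi x *: _]mulr1.
have dE : 'D_(e3 R vert) (z * phi) = (fun x => phi x + z x * dp x).
  by apply/funext => x; have [_ ->] := dzp x.
have czd : continuous (fun x => z x * dp x).
  by move=> x; apply: cvgM; [exact: continuous_snd3|exact: cdphi].
have := @c1_ibp _ Om (z * phi) phi vert.
rewrite dE => /(_ _ _ _ tphi) ibp.
have {}ibp : ip (z * phi) dp = - ip (fun x => phi x + z x * dp x) phi.
  apply: ibp.
  - by move=> x; apply: cvgM; [exact: continuous_snd3|exact: cphi].
  - by move=> x; have [] := dzp x.
  - by move=> x; apply: cvgD; [exact: cphi|exact: czd].
have Lphi : L2 phi := continuous_L2 oOm OmB cphi.
have Ldp : L2 dp := continuous_L2 oOm OmB cdphi.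
have Lzd : L2 (fun x => z x * dp x) := continuous_L2 oOm OmB czd.
have E1 : ip (z * phi) dp = ip (fun x => z x * dp x) phi.
  by apply: eq_Rintegral => x _; rewrite !fctE mulrAC.
have E2 : ip (fun x => phi x + z x * dp x) phi = ip phi phi + ip (fun x => z x * dp x) phi.
  exact: (ipDl mO Lphi Lzd Lphi).
have E : ip phi phi = - (2 * ip (fun x => z x * dp x) phi).
  move: ibp; rewrite E1 E2; set a := ip phi phi; set b := ip _ phi.
  clear; lra.
have CS := cauchy_schwarz mO Lzd Lphi.
have zb : nrm (fun x => z x * dp x) <= `|B| * nrm dp.
  apply: (nrm_mulb mO _ _ Ldp).
    by apply: measurable_funS (continuous_measurable3 continuous_snd3).
  by move=> x /OmB [_ /=]; rewrite in_itv /= -ler_norml.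
have key : nrm phi ^+ 2 <= (2 * `|B| * nrm dp) * nrm phi.
  rewrite sqr_nrm E.
  have zb' := ler_wpM2r (nrm_ge0 (leb3 R) Om phi) zb.
  apply: le_trans (ler_norm _) _; rewrite normrN normrM gtr0_norm// -!mulrA.
  apply: ler_wpM2l => //; rewrite mulrA.
  exact: le_trans CS zb'.
have [p0|p0] := eqVneq (nrm phi) 0.
  by rewrite p0 !mulr_ge0// nrm_ge0.
rewrite -(@ler_pM2r _ (nrm phi)) -?expr2//.
by rewrite lt_neqAle eq_sym p0 nrm_ge0.
Qed.

Lemma strong_cvg_nrm (f_ : nat -> R3 -> R) (f : R3 -> R) :
  @strong_cvg _ (pt S3) R (leb3 R) Om f_ f -> nrm (f_ n) @[n --> \oo] --> nrm f.
Proof.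
move=> cf; have c2 := strong_cvg_ip mO cf cf.
exact: (cvg_comp _ _ c2 (@sqrt_continuous R _)).
Qed.

(** Only the vertical derivative appears on the right. It is [eps] times the vertical component of
    the scaled gradient, and this gains a power of [eps] for dilated fields. *)
Lemma poincare (u : jet3) : H10 S3 Om u ->
  nrm u.1 <= 2 * `|B| * nrm (u.2 vert).
Proof.
move=> /(H10_approx oOm OmB)[phi [tphi c0 c1]].
have l0 := strong_cvg_nrm c0; have l1 := strong_cvg_nrm (c1 vert).
have l2 : 2 * `|B| * nrm ('D_(e3 R vert) (phi n)) @[n --> \oo] -->
  2 * `|B| * nrm (u.2 vert) by exact: cvgMl_tmp l1.
apply: (ler_cvg_to l0 l2); apply: nearW => n.
exact: poincare_test (tphi n).
Qed.

End poincare.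

(** * Incompressibility and the Korn identity *)

Section divergence.
Context (R : realType).
Local Notation R3 := (R * R * R)%type.
Local Notation S3 := (space3 R).
Local Notation jet3 := (jet S3).
Variables (Om : set R3) (B : R).
Hypothesis oOm : open Om.
Hypothesis OmB : Om `<=` box3 B.
Local Notation L2 := (inL (leb3 R) (Om : set (pt S3)) 2%:E).
Local Notation ip := (@inner _ (pt S3) R (leb3 R) Om).
Local Notation nrm := (@norm2 _ (pt S3) R (leb3 R) Om).
Local Notation mO := (mOm oOm).
Variable eps : R.

Definition scal (j : 'I_3) : R := if j == vert then eps^-1 else 1.

Lemma gradeE (u : jet3) j : grade eps u j = scal j *: (u.2 j : pt S3 -> R).
Proof.
apply/funext => x; rewrite /grade /scal !fctE; case: ifP => _ //.
by rewrite scale1r.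
Qed.

Lemma L2_grade (u : jet3) j : (forall i, L2 (u.2 i)) -> L2 (grade eps u j).
Proof. by move=> Lu; rewrite gradeE; apply: L2_Z. Qed.

Lemma symeE (v : 'I_3 -> jet3) i j :
  syme eps v i j = 2^-1 *: ((grade eps (v i) j : pt S3 -> R) + grade eps (v j) i).
Proof. by apply/funext => x; rewrite /syme !fctE mulrC. Qed.

Lemma L2_syme (v : 'I_3 -> jet3) i j : (forall k l, L2 ((v k).2 l)) ->
  L2 (syme eps v i j).
Proof.
move=> Lv; rewrite symeE; apply: L2_Z; apply: L2_D; exact: L2_grade.
Qed.

Lemma diveE (v : 'I_3 -> jet3) :
  dive eps v = \sum_i scal i *: ((v i).2 i : pt S3 -> R).
Proof.
apply/funext => x; rewrite /dive fct_sumE; apply: eq_bigr => i _.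
by rewrite gradeE.
Qed.

Lemma L2_dive (v : 'I_3 -> jet3) : (forall k l, L2 ((v k).2 l)) -> L2 (dive eps v).
Proof. by move=> Lv; rewrite diveE; apply: L2_sum => i; apply: L2_Z. Qed.

Lemma ip_gradeE (u w : jet3) i j : (forall k, L2 (u.2 k)) -> (forall k, L2 (w.2 k)) ->
  ip (grade eps u i) (grade eps w j) = scal i * scal j * ip (u.2 i) (w.2 j).
Proof.
move=> Lu Lw; rewrite !gradeE (ipZl mO)//; last exact: L2_Z.
by rewrite (ipZr mO)// mulrA.
Qed.

Section incompressible.
Variable u : 'I_3 -> jet3.
Hypothesis Hu : forall i, H10 S3 Om (u i).
Hypothesis div0 : forall psi : jet3, H10 S3 Om psi ->
  \int[leb3 R]_(x in Om) (\sum_i (u i).1 x * grade eps psi i x) = 0.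

Let Lu i : L2 (u i).1. Proof. by have [] := H10_L2 (Hu i). Qed.
Let Ldu i j : L2 ((u i).2 j). Proof. by have [_] := H10_L2 (Hu i); exact. Qed.
Let Ldiv : L2 (dive eps u). Proof. exact: L2_dive. Qed.

(** [u] has zero boundary values, so each component is integrated by parts against an arbitrary
    W^{1,2} function. *)
Lemma integral_grade_dive (Z : jet3) : W1 S3 Om 2%:E Z ->
  \int[leb3 R]_(x in Om) (\sum_i (u i).1 x * grade eps Z i x) = - ip (dive eps u) Z.1.
Proof.
move=> WZ; have [LZ LdZ] := W1_L2 WZ.
rewrite (integral_sum_ip mO Lu (fun i => L2_grade i LdZ)).
rewrite diveE (ip_suml mO) => [|i|]; [|exact: L2_Z|exact: LZ].
rewrite -sumrN; apply: eq_bigr => i _.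
rewrite gradeE (ipZr mO)// (ipZl mO)//.
by rewrite (H10_ibp oOm OmB i (Hu i) WZ) mulrN.
Qed.

(* The divergence of the approximating test functions is again a test
   function, so [dive eps u] is orthogonal to itself. *)
Lemma nrm_dive0 : nrm (dive eps u) = 0.
Proof.
have ort (psi : R3 -> R) : test_fun Om psi -> ip (dive eps u) psi = 0.
  move=> tpsi; have Hpsi := test_H10 oOm OmB tpsi.
  apply: oppr_inj; rewrite oppr0.
  apply: etrans (div0 Hpsi); apply: esym; apply: integral_grade_dive.
  by case: Hpsi.
have ort2 j : ip (dive eps u) ((u j).2 j) = 0.
  have [phi [tphi c0 c1]] := H10_approx oOm OmB (Hu j).
  have c := strong_cvg_ip mO (strong_cvg_cst mO Ldiv) (c1 j).
  apply: (cvg_unique _ c) => //.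
  rewrite (_ : (fun _ => _) = cst 0); first exact: cvg_cst.
  apply/funext => n; apply: ort; exact: test_fun_derive (tphi n).
rewrite /norm2 [X in ip _ X]diveE (ip_sumr mO) => [|i|]; [|exact: L2_Z|exact: Ldiv].
rewrite big1 ?sqrtr0// => i _.
by rewrite (ipZr mO)// ort2 mulr0.
Qed.

Lemma ip_dive0 g : L2 g -> ip (dive eps u) g = 0.
Proof. by move=> Lg; apply: (nrm0_ip mO Ldiv Lg nrm_dive0). Qed.

(** The constraint for functions that do not vanish on the boundary, obtained because the divergence
    itself has zero norm. It is what allows functions of x' alone, among them the limit pressure, as
    [Z]. *)
Lemma integral_grade0 (Z : jet3) : W1 S3 Om 2%:E Z ->
  \int[leb3 R]_(x in Om) (\sum_i (u i).1 x * grade eps Z i x) = 0.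
Proof.
by move=> WZ; rewrite integral_grade_dive// ip_dive0 ?oppr0//; case: (W1_L2 WZ).
Qed.

(** Expanding the symmetric parts leaves the cross terms of the gradient with its transpose. By
    [H10_symmetry] they sum to the squared norm of the divergence, which is zero. *)
Lemma korn : 2 * (\sum_i \sum_j ip (syme eps u i j) (syme eps u i j)) =
  \sum_i \sum_j ip (grade eps (u i) j) (grade eps (u i) j).
Proof.
pose g (i j : 'I_3) : pt S3 -> R := grade eps (u i) j.
have Lg i j : L2 (g i j) by exact: L2_grade.
have cross : \sum_i \sum_j ip (g i j) (g j i) = 0.
  rewrite -[RHS](ip_dive0 Ldiv) [X in ip X _]diveE (ip_suml mO) => [|i|];
    [|exact: L2_Z|exact: Ldiv].
  apply: eq_bigr => i _; rewrite diveE (ip_sumr mO) => [|j|];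
    [|exact: L2_Z|exact: L2_Z].
  apply: eq_bigr => j _; rewrite ip_gradeE// (ipZl mO)//; last exact: L2_Z.
  rewrite (ipZr mO)// (H10_symmetry oOm OmB j i (Hu i) (Hu j)).
  by rewrite mulrCA mulrA.
have E i j : ip (syme eps u i j) (syme eps u i j) =
   4^-1 * (ip (g i j) (g i j) + ip (g j i) (g j i) + 2 * ip (g i j) (g j i)).
  have LL := L2_D (Lg i j) (Lg j i).
  rewrite symeE (ipZl mO _ LL); last exact: L2_Z.
  rewrite (ipZr mO _ LL LL) (ipDl mO (Lg i j) (Lg j i) LL).
  rewrite (ipDr mO (Lg i j) (Lg j i) (Lg i j)) (ipDr mO (Lg i j) (Lg j i) (Lg j i)).
  have C : ip (g j i) (g i j) = ip (g i j) (g j i) by exact: ipC.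
  rewrite C; move: (ip (g i j) (g i j)) (ip (g j i) (g j i)) (ip (g i j) (g j i)).
  by move=> a b c; field.
under eq_bigr do under eq_bigr do rewrite E.
under eq_bigr do rewrite -mulr_sumr !big_split/= -mulr_sumr.
rewrite -mulr_sumr !big_split/= -mulr_sumr cross mulr0 addr0.
rewrite [X in _ + X]exchange_big/=.
by move: (\sum_i _) => a; field.
Qed.

End incompressible.
End divergence.

(** * Columns of the layer *)

Section vertical_integral.
Context (R : realType).
Local Notation R2 := (R * R)%type.
Local Notation R3 := (R * R * R)%type.

(** The integral runs over the whole line instead of the column: it is applied to functions
    supported in a box, so the height [h] never enters the differentiation under the integral. *)
Definition vint (F : R3 -> R) (x : R2) : R := \int[leb1 R]_z F (x, z).

Definition supp_in (M : R) (F : R3 -> R) := forall x, ~ box3 M x -> F x = 0.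

Local Notation seg M := ([set` `[(- M)%R, M]] : set (measurableTypeR R)).

Lemma vint_seg (M : R) (F : R3 -> R) (x : R2) : supp_in M F ->
  vint F x = \int[leb1 R]_(z in seg M) F (x, z).
Proof.
move=> F0; rewrite [RHS]Rintegral_mkcond; apply: eq_Rintegral => z _.
rewrite /patch; case: ifPn => //; rewrite notin_setE => nz.
by apply: F0 => -[_].
Qed.

Lemma continuous_slice (F : R3 -> R) (x : R2) : continuous F -> continuous (fun z => F (x, z)).
Proof.
exact: (continuous_compT (continuous_pair (@cst_continuous _ _ _) (@continuous_idfun _))).
Qed.

Lemma slice_integrable (M : R) (F : R3 -> R) (x : R2) : continuous F ->
  (leb1 R).-integrable (seg M) (EFin \o (fun z => F (x, z))).
Proof.
move=> cF; apply: continuous_compact_integrable; first exact: segment_compact.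
by apply: continuous_subspaceT; exact: continuous_slice.
Qed.

Lemma slice_integrableT (M : R) (F : R3 -> R) (x : R2) : supp_in M F ->
  continuous F -> (leb1 R).-integrable setT (EFin \o (fun z => F (x, z))).
Proof.
move=> F0 cF.
have -> : EFin \o (fun z => F (x, z)) = (EFin \o (fun z => F (x, z))) \_ (seg M).
  apply/funext => z; rewrite /patch; case: ifPn => //; rewrite notin_setE => nz.
  by congr EFin; apply: F0 => -[_].
have mseg : measurable (seg M) by exact: measurable_itv.
by apply/(integrable_mkcond _ mseg); exact: slice_integrable.
Qed.

Lemma vintE (M : R) (F : R3 -> R) (x : R2) : supp_in M F -> continuous F ->
  (\int[leb1 R]_z (F (x, z))%:E = (vint F x)%:E)%E.
Proof.
move=> F0 cF; rewrite /vint /Rintegral fineK//.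
exact: integrable_fin_num (slice_integrableT x F0 cF).
Qed.

Lemma vint_continuous (M : R) (F : R3 -> R) : supp_in M F -> continuous F -> continuous (vint F).
Proof.
move=> F0 cF x; apply/cvgrPdist_le => e e0.
pose m := fine (leb1 R (seg M)).
have m0 : 0 <= m by rewrite fine_ge0.
(* [m] is the length of the segment; the added 1 keeps the quotient meaningful when the segment is
   degenerate. *)
pose d := e / (m + 1).
have d0 : 0 < d by rewrite divr_gt0//; lra.
have cov : near_covering ([set` `[(- M)%R, M]] : set R).
  by apply/compact_near_coveringP; exact: segment_compact.
(* Compactness of the segment makes the continuity of [F] at the points [(x, z)] uniform in [z]. *)
have H : \forall y \near x, [set` `[(- M)%R, M]] `<=`
    (fun z => `|F (x, z) - F (y, z)| <= d).
  apply: (cov _ (nbhs x) (fun y z => `|F (x, z) - F (y, z)| <= d)) => z _.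
  have d20 : 0 < d / 2 by rewrite divr_gt0.
  have := cF (x, z) => /cvgrPdist_lt /(_ _ d20) Hz.
  have Hz2 : \forall w \near (z, x), `|F (x, z) - F (x, w.1)| < d / 2.
    have cFx := @continuous_slice F x cF.
    have := cFx z => /cvgrPdist_lt /(_ _ d20) Hz'.
    have sw : w.1 @[w --> (z, x)] --> z by exact: cvg_fst.
    exact: sw _ Hz'.
  have Hz3 : \forall w \near (z, x), `|F (x, z) - F (w.2, w.1)| < d / 2.
    have sw : (w.2, w.1) @[w --> (z, x)] --> (x, z).
      exact: (cvg_pair cvg_snd cvg_fst).
    exact: sw _ Hz.
  near=> w.
  have h2 : `|F (x, z) - F (x, w.1)| < d / 2 by near: w; exact: Hz2.
  have h3 : `|F (x, z) - F (w.2, w.1)| < d / 2 by near: w; exact: Hz3.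
  rewrite -(subrKA (F (x, z))) (splitr d) (le_trans (ler_normD _ _))//.
  by rewrite lerD// ltW// distrC.
near=> y.
have Hy : [set` `[(- M)%R, M]] `<=` (fun z => `|F (x, z) - F (y, z)| <= d).
  by near: y; exact: H.
rewrite !(vint_seg _ F0) -RintegralB//; [|exact: slice_integrable..].
have ifd : (leb1 R).-integrable (seg M) (EFin \o (fun z => F (x, z) - F (y, z))).
  rewrite (_ : _ \o _ = ((fun z => (F (x, z))%:E) \- (fun z => (F (y, z))%:E))%E) //.
  by apply: integrableB => //; exact: slice_integrable.
apply: le_trans (le_normr_Rintegral _ ifd) _ => //.
apply: (@le_trans _ _ (\int[leb1 R]_(z in seg M) d)).
  apply: le_Rintegral => //.
    have := integrable_norm ifd; exact.
  apply: continuous_compact_integrable; first exact: segment_compact.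
  by apply: continuous_subspaceT; exact: cst_continuous.
rewrite Rintegral_cst// -/m /d -mulrA ler_piMr ?(ltW e0)//.
by rewrite mulrC ler_pdivrMr; lra.
Unshelve. all: by end_near. Qed.

Definition lift2 (v : R2) : R3 := (v, 0).

(** Differentiation under the integral sign, for the one-parameter family of translates of [F] along
    the horizontal vector [v]. *)
Lemma vint_derive (M : R) (F : R3 -> R) (x v : R2) : supp_in M F -> continuous F ->
  (forall y, derivable F y (lift2 v)) -> continuous ('D_(lift2 v) F) ->
  is_derive x v (vint F) (vint ('D_(lift2 v) F) x).
Proof.
move=> F0 cF dF cdF.
have dF0 : supp_in M ('D_(lift2 v) F) by move=> y; exact: derive_outside_box.
pose f (t : R) (z : R) : R := F ((x, z) + t *: lift2 v).
have dline (t z : R) : is_derive t 1 (f ^~ z) ('D_(lift2 v) F ((x, z) + t *: lift2 v)).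
  exact: is_derive_line.
have fE (t z : R) : f t z = F (x + t *: v, z).
  by rewrite /f; congr F; congr (_, _); rewrite /= [t *: 0]mulr0 addr0.
have [C HC] := compact_range_bounded (@compact_box3 _ M) cdF.
(* A constant dominates: the derivative is bounded by [C] on the box and zero outside. *)
pose G (z : R) : R := `|C|.
have mseg : measurable (seg M) by exact: measurable_itv.
have I0 : (`](-1)%R, 1%R[%classic : set R) 0 by rewrite /= in_itv /= ltrN10 ltr01.
have intf (t : R) : (`](-1)%R, 1%R[%classic : set R) t ->
    (leb1 R).-integrable (seg M) (EFin \o f t).
  move=> _; rewrite (_ : f t = (fun z => F (x + t *: v, z))).
    exact: slice_integrable.
  by apply/funext => z; exact: fE.
have derf (t z : R) : (`](-1)%R, 1%R[%classic : set R) t -> seg M z -> derivable (f ^~ z) t 1.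
  by move=> _ _; have [] := dline t z.
have G0 (z : R) : 0 <= G z by exact: normr_ge0.
have intG : (leb1 R).-integrable (seg M) (EFin \o G).
  apply: continuous_compact_integrable; first exact: segment_compact.
  by apply: continuous_subspaceT; exact: cst_continuous.
have d1E (t z : R) : partial1of2 f t z = 'D_(lift2 v) F ((x, z) + t *: lift2 v).
  by rewrite partial1of2E; have [_] := dline t z.
have Gub (t z : R) : (`](-1)%R, 1%R[%classic : set R) t -> seg M z ->
    `|partial1of2 f t z| <= G z.
  move=> _ _; rewrite d1E /G.
  have [b|nb] := pselect (box3 M ((x, z) + t *: lift2 v)).
    exact: le_trans (HC _ b) (ler_norm _).
  by rewrite (dF0 _ nb) normr0.
have := cvg_differentiation_under_integral mseg I0 intf derf G0 intG Gub.
have -> : \int[leb1 R]_(z in seg M) partial1of2 f 0 z = vint ('D_(lift2 v) F) x.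
  rewrite (vint_seg _ dF0); apply: eq_Rintegral => z _.
  by rewrite d1E scale0r addr0.
have -> : (fun h => h^-1 *: (\int[leb1 R]_(z in seg M) f (h + 0) z - \int[leb1 R]_(z in seg M) f 0 z))
  = (fun h => h^-1 *: ((vint F \o shift x) (h *: v) - vint F x)).
  apply/funext => h; congr (_ *: (_ - _)).
    rewrite /= (vint_seg _ F0); apply: eq_Rintegral => z _.
    by rewrite fE addr0 addrC.
  rewrite (vint_seg _ F0); apply: eq_Rintegral => z _.
  by rewrite fE scale0r addr0.
move=> H; split; first exact: cvgP H.
exact: (cvg_lim (@norm_hausdorff _ _) H).
Qed.

Lemma iter_derive_supp (M : R) (F : R3 -> R) (s : seq R3) : supp_in M F -> supp_in M (iter_derive s F).
Proof.
move=> F0; elim: s => [|v s IH] //= x.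
by apply: derive_outside_box.
Qed.

Lemma smooth_on_iter (V : normedModType R) U (f : V -> R) s :
  smooth_on U f -> smooth_on U (iter_derive s f).
Proof.
move=> sf; elim: s => [|v s IH]; first exact: sf.
exact: (smooth_on_derive v IH).
Qed.

Lemma vint_iter_derive (M : R) (F : R3 -> R) (s : seq R2) : smooth_on setT F -> supp_in M F ->
  iter_derive s (vint F) = vint (iter_derive (map lift2 s) F).
Proof.
move=> sF F0; elim: s => [|v s IH] //.
rewrite /iter_derive /= -/(iter_derive s (vint F)) IH.
apply/funext => x.
have sG := smooth_on_iter (map lift2 s) sF.
have := @vint_derive M (iter_derive (map lift2 s) F) x v.
case=> //.
- exact: iter_derive_supp.
- exact: smooth_continuous.
- by move=> y; apply: smooth_on_derivable sG _.
- by apply: smooth_continuous; exact: smooth_on_derive.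
Qed.

(** Every iterated derivative of a column integral is the column integral of an iterated derivative,
    so continuity and derivability need to be known for one integration only. *)
Lemma smooth_vint (M : R) (F : R3 -> R) : smooth_on setT F -> supp_in M F -> smooth_on setT (vint F).
Proof.
move=> sF F0 s x _; rewrite (vint_iter_derive _ sF F0).
have sG := smooth_on_iter (map lift2 s) sF.
have G0 := iter_derive_supp (map lift2 s) F0.
split; first by apply: (vint_continuous G0); exact: smooth_continuous.
move=> v; have [] := @vint_derive M (iter_derive (map lift2 s) F) x v => //.
- exact: smooth_continuous.
- by move=> y; apply: smooth_on_derivable sG _.
- by apply: smooth_continuous; exact: smooth_on_derive.
Qed.

(* Integrating a test function of the layer along columns gives a test function
   of [om]: this transfers weak derivatives from [om] to the layer. *)
Lemma test_fun_vint (om : set R2) (Om : set R3) (F : R3 -> R) :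
  (forall x, Om x -> om x.1) -> test_fun Om F -> test_fun om (vint F).
Proof.
move=> Omom tF; have [M F0] := test_fun_box tF.
have [sF cF FOm] := tF.
pose K := fst @` closure [set x | F x != 0].
have cK : compact K.
  apply: continuous_compact cF; apply: continuous_subspaceT => x; exact: cvg_fst.
have sub : closure [set x | vint F x != 0] `<=` K.
  have clK : closed K by apply: compact_closed cK; exact: norm_hausdorff.
  rewrite [X in _ `<=` X]((closure_id K).1 clK); apply: closure_subset => x /= Fx.
  apply: contrapT => nK; move/eqP: Fx; apply.
  rewrite /vint (_ : (fun _ => _) = cst 0); first by rewrite Rintegral_cst// mul0r.
  apply/funext => z; apply: supp_outside => xz; apply: nK.
  by exists (x, z).
split; first exact: smooth_vint sF F0.
- by apply: subclosed_compact cK sub; exact: closed_closure.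
- by move=> x /sub [y /FOm /Omom + <-].
Qed.

Lemma lift2_e2 i : lift2 (e2 R i) = e3 R (horiz i).
Proof. by rewrite /lift2 /e2 /e3 /=; case: i => -[|[|]]. Qed.

Lemma vint_pder (Om : set R3) (F : R3 -> R) (i : 'I_2) (x : R2) : test_fun Om F ->
  'D_(e2 R i) (vint F) x = vint ('D_(e3 R (horiz i)) F) x.
Proof.
move=> tF; have [M F0] := test_fun_box tF; have [sF cF FOm] := tF.
rewrite -lift2_e2; have [] := @vint_derive M F x (e2 R i) F0 => //.
- exact: smooth_continuous.
- by move=> y; apply: smooth_on_derivable sF _.
- by apply: smooth_continuous; exact: smooth_on_derive.
Qed.

End vertical_integral.

Section layers.
Context (R : realType).
Local Notation R2 := (R * R)%type.
Local Notation R3 := (R * R * R)%type.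
Local Notation S3 := (space3 R).
Local Notation P2 := (plane2 R).
Variables (om : set R2) (h : R2 -> R) (B : R).
Hypothesis oom : open om.
Hypothesis omB : om `<=` box2 B.
Hypothesis ch : forall x, om x -> {for x, continuous h}.
Hypothesis hB : forall x, om x -> h x <= B.
Local Notation Om := (layer om h).
Local Notation L2 := (inL (leb3 R) (Om : set (pt S3)) 2%:E).
Local Notation ip := (@inner _ (pt S3) R (leb3 R) Om).
Local Notation nrm := (@norm2 _ (pt S3) R (leb3 R) Om).
Local Notation L22 := (inL (leb2 R) (om : set (pt P2)) 2%:E).
Local Notation ip2 := (@inner _ (pt P2) R (leb2 R) om).
Local Notation nrm2 := (@norm2 _ (pt P2) R (leb2 R) om).

Lemma layer_open : open Om.
Proof.
rewrite openE => -[x z] [/= ox /andP[z0 zh]].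
have omx : nbhs x om by apply: open_nbhs_nbhs.
have c1 : y.1 @[y --> (x, z)] --> x by exact: cvg_fst.
have c2 : y.2 @[y --> (x, z)] --> z by exact: cvg_snd.
have c3 : h y.1 @[y --> (x, z)] --> h x by exact: cvg_comp c1 (ch ox).
have c4 : h y.1 - y.2 @[y --> (x, z)] --> h x - z by exact: cvgB c3 c2.
rewrite /interior /=; near=> y; split => /=.
  by near: y; exact: c1 _ omx.
apply/andP; split.
  by near: y; exact: (cvgr_gt z c2).
rewrite -subr_gt0; near: y; apply: (cvgr_gt (h x - z) c4).
by rewrite subr_gt0.
Unshelve. all: by end_near. Qed.

Lemma layer_box : Om `<=` box3 B.
Proof.
move=> [x z] [/= ox /andP[z0 zh]]; split=> /=; first exact: omB.
have := hB ox; rewrite in_itv /= => hx; apply/andP; split; lra.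
Qed.

Local Notation mO := (mOm layer_open).

Lemma mom : measurable (om : set (pt P2)).
Proof. exact: open_measurable2. Qed.

Local Notation seg M := ([set` `[(- M)%R, M]] : set (measurableTypeR R)).

(** Square root of the length of a vertical segment that contains every column. It bounds the
    operator that extends a planar L2 function to the layer as a constant along columns. *)
Definition column_const : R := Num.sqrt (fine (leb1 R (seg B))).

Lemma measurable_fst_layer (v : R2 -> R) : measurable_fun om (v : pt P2 -> R) ->
  measurable_fun (Om : set (pt S3)) ((fun x => v x.1) : pt S3 -> R).
Proof.
move=> mv; apply: (@measurable_comp _ _ _ (pt S3) (pt P2) _ om _ Om fst mom).
- by move=> _ [x [ox _] <-].
- exact: mv.
- by apply: measurable_funS (@measurable_fst _ _ _ _).
Qed.

Lemma fst_L2 (v : R2 -> R) : L22 v ->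
  L2 (fun x => v x.1) /\ nrm (fun x => v x.1) <= column_const * nrm2 v.
Proof.
move=> Lv; have mv := inL_measurable mom Lv.
have mvO := measurable_fst_layer mv.
have key : (\int[leb3 R]_(x in Om) (v x.1 ^+ 2)%:E <=
    (column_const ^+ 2)%:E * (ip2 v v)%:E)%E.
  (* The layer is enlarged to the cylinder over [om] with vertical side [seg B]; there the integrand
     is a product and Tonelli separates it. *)
  pose F (x : pt S3) : \bar R := ((v \_ om) x.1 ^+ 2 * \1_(seg B) x.2)%:E.
  have mF : measurable_fun setT F.
    apply/measurable_EFinP; apply: measurable_funM.
      apply: measurable_funX.
      apply: (measurableT_comp _ (@measurable_fst _ _ _ _)).
      by apply/(measurable_restrictT _ mom).
    apply: (measurableT_comp _ (@measurable_snd _ _ _ _)).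
    by apply: measurable_indic; exact: measurable_itv.
  apply: (@le_trans _ _ (\int[leb3 R]_x F x)%E).
    rewrite [leLHS]integral_mkcond; apply: ge0_le_integral => //=.
    - by move=> x _; rewrite /patch; case: ifP => // _; rewrite lee_fin sqr_ge0.
    - apply/(measurable_restrictT _ mO); apply/measurable_EFinP.
      exact: measurable_funX.
    - move=> x _; rewrite /patch /F; case: ifPn => xO.
        rewrite inE in xO; have [_ xB] := layer_box xO; have [ox _] := xO.
        by rewrite /patch mem_set// indicE mem_set// mulr1.
      by rewrite lee_fin mulr_ge0 ?sqr_ge0// indicE.
  rewrite (leb3_tonelli mF); last first.
    by move=> x; rewrite lee_fin mulr_ge0 ?sqr_ge0// indicE.
  have E x : (\int[leb1 R]_z F (x, z) = ((v \_ om) x ^+ 2)%:E * leb1 R (seg B))%E.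
    rewrite /F /=; under eq_integral do rewrite EFinM.
    rewrite ge0_integralZl//; last 2 first.
    - by apply/measurable_EFinP; apply: measurable_indic; exact: measurable_itv.
    - by rewrite lee_fin sqr_ge0.
    by rewrite integral_indic ?setIT//; exact: measurable_itv.
  under eq_integral do rewrite E.
  have fB : leb1 R (seg B) = (column_const ^+ 2)%:E.
    rewrite /column_const sqr_sqrtr ?fine_ge0// fineK// ge0_fin_numE//.
    exact: leb1_itv.
  rewrite fB ge0_integralZr//; last 3 first.
  - apply/measurable_EFinP; apply: measurable_funX.
    by apply/(measurable_restrictT _ mom).
  - by move=> x _; rewrite lee_fin sqr_ge0.
  - by rewrite lee_fin sqr_ge0.
  rewrite muleC; apply: lee_wpmul2l; first by rewrite lee_fin sqr_ge0.
  rewrite -(integral_sqr mom Lv) [leRHS]integral_mkcond le_eqVlt; apply/orP; left.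
  apply/eqP; apply: eq_integral => x _; rewrite /patch; case: ifP => // _.
  by rewrite expr0n.
have LL : L2 (fun x => v x.1).
  apply: (inL2_sqr mO) => //; apply: le_lt_trans key _.
  by rewrite -EFinM ltry.
split=> //.
rewrite -(ler_pXn2r (ltn0Sn 1)) ?nnegrE ?mulr_ge0 ?sqrtr_ge0 ?nrm_ge0//.
by rewrite exprMn !sqr_nrm -lee_fin EFinM -(integral_sqr mO LL).
Qed.

(** As [g] vanishes outside the layer, the integral extends to the whole space, where Fubini takes
    [v] out of the vertical integral. *)
Lemma ip_fst (v : R2 -> R) (g : R3 -> R) M : L22 v -> continuous g -> supp_in M g ->
  (forall x, ~ Om x -> g x = 0) -> ip (fun x => v x.1) g = ip2 v (vint g).
Proof.
move=> Lv cg gM g0; have [Lvf _] := fst_L2 Lv.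
have Lg : L2 g := continuous_L2 layer_open layer_box cg.
have ivg := ip_integrable mO Lvf Lg.
have E : (fun x : pt S3 => v x.1 * g x) \_ Om = (fun x => (v \_ om) x.1 * g x).
  apply/funext => x; rewrite /patch; case: ifPn => xO.
    by rewrite inE in xO; have [ox _] := xO; rewrite mem_set.
  by rewrite notin_setE in xO; rewrite g0// mulr0.
have ivg' : (leb3 R).-integrable setT (EFin \o (fun x => (v \_ om) x.1 * g x)).
  rewrite -E -restrict_EFin; exact/(integrable_mkcond _ mO).
rewrite /inner Rintegral_mkcond E [RHS]Rintegral_mkcond /Rintegral.
congr fine; apply: etrans (leb3_fubini ivg') _; apply: eq_integral => x _.
have -> : (\int[leb1 R]_z (EFin \o (fun x => ((v \_ om) x.1 * g x)%R)) (x, z) =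
    ((v \_ om) x)%:E * \int[leb1 R]_z (g (x, z))%:E)%E.
  rewrite /=; under eq_integral do rewrite EFinM.
  by rewrite integralZl//; exact: slice_integrableT gM cg.
rewrite (vintE _ gM cg) -EFinM /patch; congr EFin; case: ifP => _ //.
by rewrite mul0r.
Qed.

Lemma fst_ibp (P : jet P2) (phi : R3 -> R) (i : 'I_2) : W1 P2 om 2%:E P -> test_fun Om phi ->
  ip (fun x => P.1 x.1) ('D_(e3 R (horiz i)) phi) = - ip (fun x => P.2 i x.1) phi.
Proof.
move=> [LP LdP wP] tphi; have [M F0] := test_fun_box tphi.
have sphi := test_fun_smooth tphi.
have tphi2 := test_fun_derive (e3 R (horiz i)) tphi.
have cphi := smooth_continuous sphi.
have cphi2 := smooth_continuous (test_fun_smooth tphi2).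
have F2 : supp_in M ('D_(e3 R (horiz i)) phi) by move=> x; exact: derive_outside_box.
rewrite (ip_fst LP cphi2 F2); last by move=> x nx; exact: test_fun_outside tphi2 nx.
rewrite (ip_fst (LdP i) cphi F0); last by move=> x nx; exact: test_fun_outside tphi nx.
have tv : test_fun om (vint phi) by apply: (test_fun_vint _ tphi) => x [].
have H := wP i _ tv; apply: etrans H.
apply: eq_Rintegral => x _; congr (_ * _).
by apply: esym; exact: vint_pder tphi.
Qed.

(** The vertical derivative of [phi] integrates to zero on each vertical line, and [v] is constant
    there. *)
Lemma vert_ibp (v : R2 -> R) (phi : R3 -> R) : L22 v -> test_fun Om phi ->
  ip (fun x => v x.1) ('D_(e3 R vert) phi) = 0.
Proof.
move=> Lv tphi; have [M F0] := test_fun_box tphi.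
have sphi := test_fun_smooth tphi.
have tphi2 := test_fun_derive (e3 R vert) tphi.
have cphi2 := smooth_continuous (test_fun_smooth tphi2).
have F2 : supp_in M ('D_(e3 R vert) phi) by move=> x; exact: derive_outside_box.
rewrite (ip_fst Lv cphi2 F2); last by move=> x nx; exact: test_fun_outside tphi2 nx.
rewrite -[RHS](ip0l (leb2 R) mom v) ipC; apply: eq_Rintegral => x _.
congr (_ * _); rewrite /vint /Rintegral (integral_pder_line2 F0)//.
by move=> y; apply: smooth_on_derivable sphi _.
Qed.

(** The lift of a planar Sobolev function. Its vertical derivative is zero, so its scaled gradient
    contains no factor [eps^-1] and does not depend on [eps]. *)
Definition fst_jet (P : jet P2) : jet S3 :=
  (fun x => P.1 x.1, fun j x => if unlift vert j is Some i then P.2 i x.1 else 0).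

Lemma horizE (i : 'I_2) : horiz i = lift vert i.
Proof. by apply/val_inj; rewrite /= /bump leqNgt ltn_ord. Qed.

Lemma fst_jet_horiz P i : (fst_jet P).2 (horiz i) = (fun x => P.2 i x.1).
Proof. by apply/funext => x; rewrite /= horizE liftK. Qed.

Lemma fst_jet_vert P : (fst_jet P).2 vert = 0.
Proof. by apply/funext => x; rewrite /= unlift_none. Qed.

Lemma ord3_ind (Q : 'I_3 -> Prop) : (forall i, Q (horiz i)) -> Q vert -> forall j, Q j.
Proof.
move=> Qh Qv j; have [i ->|->] := unliftP vert j; last exact: Qv.
by rewrite -horizE.
Qed.

Lemma fst_W1 (P : jet P2) : W1 P2 om 2%:E P -> W1 S3 Om 2%:E (fst_jet P).
Proof.
move=> WP; have [LP LdP wP] := WP; split.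
- by have [] := fst_L2 LP.
- apply: ord3_ind => [i|]; first by rewrite fst_jet_horiz; have [] := fst_L2 (LdP i).
  by rewrite fst_jet_vert; exact: L2_0.
- apply: ord3_ind => [i|] phi tphi.
    by rewrite fst_jet_horiz; exact: fst_ibp.
  rewrite fst_jet_vert; apply: etrans (vert_ibp LP tphi) _.
  by apply: esym; apply: etrans (f_equal -%R (ip0l (leb3 R) mO phi)) _; rewrite oppr0.
Qed.

End layers.

Section column_integrals.
Context (R : realType).
Local Notation R2 := (R * R)%type.
Local Notation R3 := (R * R * R)%type.
Local Notation S3 := (space3 R).
Local Notation P2 := (plane2 R).
Variables (om : set R2) (h : R2 -> R) (B : R).
Hypothesis oom : open om.
Hypothesis omB : om `<=` box2 B.
Hypothesis ch : forall x, om x -> {for x, continuous h}.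
Local Notation Om := (layer om h).
Local Notation mO := (mOm (layer_open oom ch)).
Local Notation seg x := (`]0, h x[%classic : set (measurableTypeR R)).

Lemma layer_patch (v : R3 -> R) x z :
  (v \_ Om) (x, z) = if x \in om then ((fun z => v (x, z)) \_ (seg x)) z else 0.
Proof.
rewrite /patch; case: ifPn => xO; case: ifPn => xo.
- rewrite mem_set//; rewrite inE in xO; case: xO => _ /=; rewrite in_itv/= => /andP[-> ->]//.
- by rewrite inE in xO; case: xO => /= /mem_set; rewrite (negbTE xo).
- case: ifPn => // zs; exfalso; move/negP: xO; apply; rewrite inE; split=> /=.
    by rewrite inE in xo.
  by move: zs; rewrite inE /= in_itv.
- by [].
Qed.

(** Turns an integral over the layer against a function of x' into a planar integral of the flux
    through columns, the form in which the limit divergence equation is stated. *)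
Lemma column_integral (v : R3 -> R) (c : R2 -> R) :
  (leb3 R).-integrable (Om : set (pt S3)) (EFin \o (v : pt S3 -> R)) -> continuous c ->
  (leb2 R).-integrable (om : set (pt P2))
    (EFin \o (fun x => (\int[leb1 R]_(z in seg x) v (x, z)) * c x)) /\
  \int[leb3 R]_(x in Om) (v x * c x.1) =
  \int[leb2 R]_(x in om) ((\int[leb1 R]_(z in seg x) v (x, z)) * c x).
Proof.
move=> iv cc.
have moo := mom oom.
pose g : pt S3 -> R := v \_ Om.
have ig : (leb3 R).-integrable setT (EFin \o g).
  by rewrite /g -restrict_EFin; exact/(integrable_mkcond _ mO).
pose S (x : pt P2) : \bar R := (\int[leb1 R]_z (g (x, z))%:E)%E.
have iS : (leb2 R).-integrable setT S by exact: (leb3_integrable_fubini ig).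
have Sv x : om x -> \int[leb1 R]_(z in seg x) v (x, z) = fine (S x).
  move=> ox; rewrite Rintegral_mkcond /Rintegral /S; congr fine.
  by apply: eq_integral => z _; rewrite /g layer_patch mem_set.
have S0 x : ~ om x -> S x = 0%E.
  move=> ox; rewrite /S; apply: integral0_eq => z _.
  by rewrite /g layer_patch memNset.
have mc : measurable_fun setT (c : pt P2 -> R) by exact: continuous_measurable2.
have mfS : measurable_fun setT (fun x => fine (S x)).
  by apply: (measurableT_comp (@fine_measurable R setT measurableT)); exact: measurable_int iS.
have ifS : (leb2 R).-integrable setT (EFin \o (fun x => fine (S x))).
  apply: le_integrable iS => //; first exact/measurable_EFinP.
  by move=> x _ /=; case: (S x) => //= *; rewrite ?normr0 ?leey.
have [M0 cM0] := compact_range_bounded (@compact_box2 R B) cc.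
(* The weight is cut off outside [om]: [c] is bounded on the box that contains [om], and the cut-off
   makes the bound global. *)
pose d : pt P2 -> R := (c : pt P2 -> R) \_ om.
have md : measurable_fun setT d.
  by apply/(measurable_restrictT _ moo); exact: measurable_funTS.
have dM x : `|d x| <= `|M0|.
  rewrite /d /patch; case: ifPn => [|_]; last by rewrite normr0.
  by rewrite inE => ox; apply: le_trans (cM0 _ (omB ox)) (ler_norm _).
have im : (leb2 R).-integrable setT (EFin \o (fun x => fine (S x) * d x)).
  apply: (@le_integrable _ _ _ _ _ _ _ (fun x => `|M0|%:E * (EFin \o (fun x => fine (S x))) x)%E).
  - by [].
  - by apply/measurable_EFinP; exact: measurable_funM.
  - move=> x _ /=; rewrite lee_fin normrM (normrM `|M0|) normr_id mulrC.
    by apply: ler_wpM2r => //; exact: normr_ge0.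
  - exact: integrableZl.
have E2 : (fun x => \int[leb1 R]_(z in seg x) v (x, z) * c x) \_ om =
    (fun x => fine (S x) * d x).
  apply/funext => x; rewrite /d /patch; case: ifPn => [|_]; last by rewrite mulr0.
  by rewrite inE => ox; rewrite Sv.
split.
  by apply/(integrable_mkcond _ moo); rewrite restrict_EFin E2.
have E3 : (fun x : pt S3 => v x * c x.1) \_ Om = (fun x => g x * d x.1).
  apply/funext => x; rewrite /g /d /patch; case: ifPn => xO; last by rewrite mul0r.
  by rewrite inE in xO; have [ox _] := xO; rewrite mem_set.
have ig3 : (leb3 R).-integrable setT (EFin \o (fun x : pt S3 => g x * d x.1)).
  apply: (@le_integrable _ _ _ _ _ _ _ (fun x => `|M0|%:E * (EFin \o g) x)%E).
  - by [].
  - apply/measurable_EFinP; apply: measurable_funM.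
      by apply/measurable_EFinP; exact: measurable_int ig.
    exact: (measurableT_comp md (@measurable_fst _ _ _ _)).
  - move=> x _ /=; rewrite lee_fin normrM (normrM `|M0|) normr_id mulrC.
    by apply: ler_wpM2r => //; exact: normr_ge0.
  - exact: integrableZl.
rewrite Rintegral_mkcond E3 [RHS]Rintegral_mkcond E2 /Rintegral; congr fine.
apply: etrans (leb3_fubini ig3) _.
apply: ae_eq_integral => //.
- exact: measurable_int (leb3_integrable_fubini ig3).
- exact: measurable_int im.
(* Only almost every column is integrable; on those the weight can be taken out of the inner
   integral. *)
have := @ae_integrable1 _ _ _ _ R (sleb2 R) (@lebesgue_measure R) _ ig.
apply: filterS => x ix _.
under eq_integral do rewrite /= EFinM.
rewrite integralZr// EFinM; congr (_ * _)%E.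
by rewrite fineK//; exact: integrable_fin_num ix.
Qed.

End column_integrals.

Section fst_composition.
Context (R : realType).
Local Notation R2 := (R * R)%type.
Local Notation R3 := (R * R * R)%type.
Implicit Types phi : R2 -> R.

(** The difference quotients on both sides are the same by computation. *)
Lemma derive_fst phi (v : R3) : 'D_v (phi \o fst) = 'D_(v.1) phi \o fst.
Proof. by []. Qed.

Lemma iter_derive_fst phi (s : seq R3) :
  iter_derive s (phi \o fst) = iter_derive (map fst s) phi \o fst.
Proof. by elim: s => //= v s ->. Qed.

Lemma smooth_fst phi : smooth_on setT phi -> smooth_on setT (phi \o (fst : R3 -> R2)).
Proof.
move=> sphi s x _; rewrite iter_derive_fst.
have [c d] := sphi (map fst s) x.1 I.
split; last by move=> v; exact: (d v.1).
exact: (continuous_comp (@cvg_fst _ _ _ _ _) c).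
Qed.

Lemma pder_fst_vert phi : 'D_(e3 R vert) (phi \o fst) = 0 :> (R3 -> R).
Proof.
have e : (e3 R vert).1 = 0 by congr pair.
by rewrite derive_fst e; apply/funext => x; exact: derive0.
Qed.
End fst_composition.

(** * Dilation of the layer *)

Section scaling.
Context (R : realType).
Local Notation R3 := (R * R * R)%type.
Local Notation S3 := (space3 R).
Local Notation T1 := (measurableTypeR R).
Variable c : R.
Hypothesis c0 : 0 < c.

Definition scl (z : T1) : T1 := c * z.

Lemma measurable_scl : measurable_fun setT scl.
Proof. exact: measurable_funM. Qed.

Definition pscl : set T1 -> \bar R := pushforward (leb1 R) scl.

Let pscl0 : pscl set0 = 0%E.
Proof. by rewrite /pscl /pushforward preimage_set0 measure0. Qed.

Let pscl_ge0 A : (0 <= pscl A)%E.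
Proof. by rewrite /pscl /pushforward; exact: (measure_ge0 (leb1 R)). Qed.

Let pscl_sigma_additive : semi_sigma_additive pscl.
Proof.
move=> F mF tF mUF; rewrite /pscl /pushforward preimage_bigcup.
apply: measure_semi_sigma_additive.
- by move=> n; rewrite -[X in measurable X]setTI; exact: measurable_scl.
- apply/trivIsetP => /= i j _ _ ij; rewrite -preimage_setI.
  by move/trivIsetP : tF => /(_ _ _ _ _ ij) ->//; rewrite preimage_set0.
- by rewrite -preimage_bigcup -[X in measurable X]setTI; exact: measurable_scl.
Qed.

HB.instance Definition _ := isMeasure.Build _ _ _ pscl pscl0 pscl_ge0 pscl_sigma_additive.

Definition mscl : {measure set T1 -> \bar R} := mscale (NngNum (ltW c0)) pscl.

(** [mscl], which is [c] times the image of Lebesgue measure under [scl], agrees with Lebesgue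
    measure on half-open intervals and hence on all measurable sets. The change of variables is then
    integration against an image measure. *)
Lemma ge0_integral_scl (f : T1 -> \bar R) : measurable_fun setT f ->
  (forall z, 0 <= f z)%E ->
  (\int[leb1 R]_z f (scl z) = (c^-1)%:E * \int[leb1 R]_z f z)%E.
Proof.
move=> mf f0.
have E (A : set T1) : measurable A ->
    leb1 R A = mscl A.
  move=> mA; apply: (lebesgue_measure_unique (mu := mscl)) => //.
  move=> _ [[a b]] _ <-.
  have P : scl @^-1` [set` `]a, b]] = [set` `](c^-1 * a), (c^-1 * b)]].
    apply/seteqP; split=> z /=; rewrite !in_itv /= /scl ltr_pdivrMl// ler_pdivlMl//.
  apply: (@etrans _ _ (c%:E * leb1 R [set` `](c^-1 * a)%R, (c^-1 * b)%R]])%E); last first.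
    exact: (f_equal (fun X : set T1 => c%:E * leb1 R X)%E (esym P)).
  rewrite /leb1 /= !lebesgue_measure_itv /= !lte_fin ltr_pM2l ?invr_gt0//.
  case: ifP => _; last by rewrite mule0.
  by rewrite -EFinB -EFinM -mulrBr mulrA mulfV ?mul1r// gt_eqF.
have -> : (\int[leb1 R]_z f z = \int[mscl]_z f z)%E.
  by apply: eq_measure_integral => A mA _; exact: E.
rewrite ge0_integral_mscale//= /pscl (ge0_integral_pushforward measurable_scl)//.
by rewrite muleA -EFinM mulVf ?mul1e// gt_eqF.
Qed.

Definition dilation (x : R3) : R3 := (x.1, c * x.2).

Lemma measurable_dil : measurable_fun setT (dilation : pt S3 -> pt S3).
Proof.
apply: measurable_fun_pair; first exact: measurable_fst.
by apply: measurable_funM => //; exact: measurable_snd.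
Qed.

Lemma ge0_integral_dil (F : pt S3 -> \bar R) : measurable_fun setT F ->
  (forall x, 0 <= F x)%E ->
  (\int[leb3 R]_x F (dilation x) = (c^-1)%:E * \int[leb3 R]_x F x)%E.
Proof.
move=> mF F0.
have mFd : measurable_fun setT (fun x : pt S3 => F (dilation x)).
  exact: (measurableT_comp mF measurable_dil).
have ci : (0 <= (c^-1)%:E)%E by rewrite lee_fin invr_ge0 ltW.
rewrite (leb3_tonelli mFd)// (leb3_tonelli mF)//.
have mG : measurable_fun setT (fun x => \int[leb1 R]_z F (x, z))%E.
  exact: (@measurable_fun_fubini_tonelli_F _ _ _ _ R (@lebesgue_measure R) F mF).
rewrite -ge0_integralZl//; last by move=> x _; exact: integral_ge0.
apply: eq_integral => x _.
rewrite -(@ge0_integral_scl (fun z => F (x, z)))//.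
exact: (measurableT_comp mF (@measurable_pair1 _ _ _ _ x)).
Qed.

Section two_sets.
Variables (U V : set (pt S3)).
Hypothesis mU : measurable U.
Hypothesis mV : measurable V.
Hypothesis UV : forall x, V x <-> U (dilation x).
Local Notation L2U := (inL (leb3 R) U 2%:E).
Local Notation L2V := (inL (leb3 R) V 2%:E).
Local Notation ipU := (@inner _ (pt S3) R (leb3 R) U).
Local Notation ipV := (@inner _ (pt S3) R (leb3 R) V).

Lemma dil_sqr (g : pt S3 -> R) : L2U g ->
  L2V (fun x => g (dilation x)) /\
  ipV (fun x => g (dilation x)) (fun x => g (dilation x)) = c^-1 * ipU g g.
Proof.
move=> Lg; have mg := inL_measurable mU Lg.
have mgd : measurable_fun V (fun x : pt S3 => g (dilation x)).
  apply: (@measurable_comp _ _ _ (pt S3) (pt S3) _ U g V dilation mU).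
  - by move=> _ [x /UV Vx <-].
  - exact: mg.
  - by apply: measurable_funS measurable_dil.
have E : (\int[leb3 R]_(x in V) (g (dilation x) ^+ 2)%:E =
   (c^-1)%:E * \int[leb3 R]_(x in U) (g x ^+ 2)%:E)%E.
  rewrite integral_mkcond [in RHS]integral_mkcond -ge0_integral_dil.
  - apply: eq_integral => x _; rewrite /patch.
    have -> // : (x \in V) = (dilation x \in U).
    by apply/idP/idP; rewrite !inE => /UV.
  - apply/(measurable_restrictT _ mU); apply/measurable_EFinP.
    exact: measurable_funX.
  - by move=> x; rewrite /patch; case: ifP => // _; rewrite lee_fin sqr_ge0.
have LV : L2V (fun x => g (dilation x)).
  apply: (inL2_sqr mV) => //; rewrite E (integral_sqr mU Lg) -EFinM.
  exact: ltry.
split=> //; apply: EFin_inj.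
by rewrite -(integral_sqr mV LV) E (integral_sqr mU Lg) EFinM.
Qed.

(** The change of variables is proved for nonnegative integrands; polarization carries it from
    squares to inner products. *)
Lemma polarization (W : set (pt S3)) (mW : measurable W) (g k : pt S3 -> R) :
  inL (leb3 R) W 2%:E g -> inL (leb3 R) W 2%:E k ->
  @inner _ (pt S3) R (leb3 R) W g k =
   4^-1 * (@inner _ (pt S3) R (leb3 R) W (g + k) (g + k) - @inner _ (pt S3) R (leb3 R) W (g - k) (g - k)).
Proof.
move=> Lg Lk; have Ls := L2_D Lg Lk; have Ld := L2_B Lg Lk.
rewrite (ipBl mW Lg Lk Ld) (ipBr mW Lg Lk Lg) (ipBr mW Lg Lk Lk).
rewrite (ipDl mW Lg Lk Ls) (ipDr mW Lg Lk Lg) (ipDr mW Lg Lk Lk) (ipC _ _ k g).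
by move: (inner _ _ _ _) (inner _ _ _ _) (inner _ _ _ _) => a b d; field.
Qed.

Lemma dil_ip (g k : pt S3 -> R) : L2U g -> L2U k ->
  ipV (fun x => g (dilation x)) (fun x => k (dilation x)) = c^-1 * ipU g k.
Proof.
move=> Lg Lk; have [LVg _] := dil_sqr Lg; have [LVk _] := dil_sqr Lk.
rewrite (polarization mV LVg LVk) (polarization mU Lg Lk).
have [_ H1] := dil_sqr (L2_D Lg Lk); have [_ H2] := dil_sqr (L2_B Lg Lk).
apply: etrans (_ : 4^-1 * (c^-1 * ipU (g + k) (g + k) - c^-1 * ipU (g - k) (g - k)) = _).
  by rewrite -H1 -H2.
by rewrite -mulrBr mulrCA.
Qed.

End two_sets.
End scaling.

Lemma cvg_sum_fin (R : realType) (I : finType) (F : I -> nat -> R) (l : I -> R) :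
  (forall i, F i n @[n --> \oo] --> l i) ->
  \sum_i F i n @[n --> \oo] --> \sum_i l i.
Proof.
move=> Fl.
suff H (r : seq I) : \sum_(i <- r) F i n @[n --> \oo] --> \sum_(i <- r) l i by exact: H.
elim: r => [|i r IH].
  by rewrite big_nil; under eq_fun do rewrite big_nil; exact: cvg_cst.
by rewrite big_cons; under eq_fun do rewrite big_cons; exact: cvgD.
Qed.

Section derive_scaling.
Context (R : realType) (V : normedModType R).

Lemma derive_scale (f : V -> R) (x v : V) (c : R) : derivable f x v ->
  'D_(c *: v) f x = c * 'D_v f x.
Proof.
move=> df.
have x0 : x = x + 0 *: v by rewrite scale0r addr0.
have x0' : x = x + 0 *: (c *: v) by rewrite scale0r addr0.
have df0 : derivable f (x + 0 *: v) v by rewrite -x0.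
have h1 := @is_derive_line R V f x v 0 df0.
have cc : is_derive (0 : R) 1 (fun t : R => c * t) c.
  have := @is_deriveZ R R R id c (0 : R) 1 1 (is_derive_id _ _).
  by rewrite [c *: 1]mulr1.
have h1' : is_derive (c * 0) 1 (fun t : R => f (x + t *: v)) ('D_v f (x + 0 *: v)).
  by rewrite mulr0.
have := is_derive1_comp h1' cc.
rewrite -x0.
have -> : (fun t : R => f (x + t *: v)) \o (fun t : R => c * t) =
   (fun t : R => f (x + t *: (c *: v))).
  by apply/funext => t; rewrite /= scalerA mulrC.
move=> h2.
pose F (t : R) := f (x + t *: (c *: v)).
have E : (fun h : R => h^-1 *: ((F \o shift 0) (h *: 1) - F 0)) =
    (fun h => h^-1 *: ((f \o shift x) (h *: (c *: v)) - f x)).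
  apply/funext => h; rewrite /F /= scale0r !addr0 [h *: 1]mulr1.
  by rewrite (addrC x).
have [_ d2] := h2; move: d2; rewrite /derive -/F E => ->.
by rewrite mulrC.
Qed.

End derive_scaling.

Section dilated_functions.
Context (R : realType).
Local Notation R3 := (R * R * R)%type.
Local Notation S3 := (space3 R).
Local Notation jet3 := (jet S3).
Variable c : R.
Hypothesis c0 : 0 < c.
Local Notation dil := (@dilation R c).

Lemma dil_lin (h : R) (v x : R3) : dil (h *: v + x) = h *: dil v + dil x.
Proof.
by case: v x => v1 v2 [x1 x2]; rewrite /dilation /=; congr (_, _); rewrite /= mulrDr [c * (_ *: _)]mulrCA.
Qed.

Lemma dil_quot (f : R3 -> R) (x v : R3) :
  (fun h : R => h^-1 *: (((f \o dil) \o shift x) (h *: v) - (f \o dil) x)) =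
  (fun h => h^-1 *: ((f \o shift (dil x)) (h *: dil v) - f (dil x))).
Proof. by apply/funext => h; rewrite /= dil_lin. Qed.

Lemma derive_dil (f : R3 -> R) (v : R3) : 'D_v (f \o dil) = 'D_(dil v) f \o dil.
Proof. by apply/funext => x; rewrite /derive dil_quot. Qed.

Lemma derivable_dil (f : R3 -> R) (x v : R3) : derivable f (dil x) (dil v) ->
  derivable (f \o dil) x v.
Proof. by rewrite /derivable dil_quot. Qed.

Lemma iter_derive_dil (f : R3 -> R) s :
  iter_derive s (f \o dil) = iter_derive (map dil s) f \o dil.
Proof.
elim: s => [|v s IH] //.
apply: etrans (_ : 'D_v (iter_derive s (f \o dil)) = _); first by [].
by rewrite IH derive_dil.
Qed.

Lemma continuous_dil : continuous dil.
Proof.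
apply: continuous_pair; first by move=> x; exact: cvg_fst.
by move=> x; apply: cvgM; [exact: cvg_cst|exact: cvg_snd].
Qed.

Lemma smooth_dil (f : R3 -> R) : smooth_on setT f -> smooth_on setT (f \o dil).
Proof.
move=> sf s x _; rewrite iter_derive_dil.
have [cs ds] := sf (map dil s) (dil x) I; split.
  apply: (@continuous_comp _ _ _ dil (iter_derive (map dil s) f) x).
    exact: continuous_dil.
  exact: cs.
by move=> v; apply: derivable_dil; exact: ds.
Qed.

Lemma dilK : cancel dil (@dilation R c^-1).
Proof.
by case=> x z; rewrite /dilation /= mulrA mulVf ?mul1r// gt_eqF.
Qed.

Lemma dilVK : cancel (@dilation R c^-1) dil.
Proof.
by case=> x z; rewrite /dilation /= mulrA mulfV ?mul1r// gt_eqF.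
Qed.

Lemma continuous_dilV : continuous (@dilation R c^-1).
Proof.
apply: continuous_pair; first by move=> x; exact: cvg_fst.
by move=> x; apply: cvgM; [exact: cvg_cst|exact: cvg_snd].
Qed.

Variables (U V : set R3).
Hypothesis UV : forall x, V x <-> U (dil x).

Lemma test_fun_dil (f : R3 -> R) : test_fun U f -> test_fun V (f \o dil).
Proof.
move=> [sf cf fU].
pose K := @dilation R c^-1 @` closure [set x | f x != 0].
have cK : compact K.
  by apply: continuous_compact cf; apply: continuous_subspaceT; exact: continuous_dilV.
have clK : closed K by apply: compact_closed cK; exact: norm_hausdorff.
have sub : closure [set x | (f \o dil) x != 0] `<=` K.
  rewrite [X in _ `<=` X]((closure_id K).1 clK); apply: closure_subset => x /= fx.
  by exists (dil x); [exact: subset_closure|rewrite dilK].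
split; first exact: smooth_dil.
- by apply: subclosed_compact cK sub; exact: closed_closure.
- by move=> x /sub [y /fU Uy <-]; apply/UV; rewrite dilVK.
Qed.

Definition dscal (j : 'I_3) : R := if j == vert then c else 1.

Lemma dil_e3 j : dil (e3 R j) = dscal j *: e3 R j.
Proof.
rewrite /dscal /dilation; case: j => -[|[|[|//]]] p; rewrite /e3 /= ?scale1r ?mulr0//.
by congr (_, _, _); rewrite /= [_ *: _]mulr0.
Qed.

Lemma pder_dil (f : R3 -> R) j : smooth_on setT f ->
  'D_(e3 R j) (f \o dil) = (fun x => dscal j * 'D_(e3 R j) f (dil x)).
Proof.
move=> sf; rewrite derive_dil dil_e3; apply/funext => x /=.
by rewrite derive_scale//; apply: smooth_on_derivable sf _.
Qed.

(* The vertical component of the gradient absorbs the dilation factor, so that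
   [grade c (dilj v)] is the plain gradient of [v]. *)
Definition dilj (v : jet3) : jet3 :=
  (fun x => v.1 (dil x), fun j x => dscal j * v.2 j (dil x)).

Hypothesis oU : open U.
Hypothesis oV : open V.
Variable B : R.
Hypothesis VB : V `<=` box3 B.
Variable B' : R.
Hypothesis UB : U `<=` box3 B'.
Local Notation mU := (mOm oU).
Local Notation mV := (mOm oV).
Local Notation nrmU := (@norm2 _ (pt S3) R (leb3 R) U).
Local Notation nrmV := (@norm2 _ (pt S3) R (leb3 R) V).
Local Notation ipV := (@inner _ (pt S3) R (leb3 R) V).

(** Against a fixed test function both sides of the weak derivative identity are continuous for
    strong convergence, so the limits of the functions and of their gradients fit together. *)
Lemma H10_closed (w : jet3) (phi : nat -> R3 -> R) :
  (forall n, test_fun V (phi n)) ->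
  @strong_cvg _ (pt S3) R (leb3 R) V phi w.1 ->
  (forall i, @strong_cvg _ (pt S3) R (leb3 R) V (fun n => 'D_(e3 R i) (phi n)) (w.2 i)) ->
  H10 S3 V w.
Proof.
move=> tphi c1 c2; have [Lphi Lw n1] := c1.
split; first split.
- exact: Lw.
- by move=> i; have [] := c2 i.
- move=> i psi tpsi.
  have Lpsi := continuous_L2 oV VB (smooth_continuous (test_fun_smooth tpsi)).
  have tdpsi := test_fun_derive (e3 R i) tpsi.
  have Ldpsi := continuous_L2 oV VB (smooth_continuous (test_fun_smooth tdpsi)).
  have H1 := strong_cvg_ip mV c1 (strong_cvg_cst mV Ldpsi).
  have H2 := cvgN (strong_cvg_ip mV (c2 i) (strong_cvg_cst mV Lpsi)).
  apply: (cvg_unique _ H1) => //.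
  rewrite (_ : (fun _ => _) = (fun n => - ipV ('D_(e3 R i) (phi n)) psi)); first exact: H2.
  apply/funext => n.
  by apply: smooth_ibp => //; exact: test_fun_smooth (tphi n).
- exists phi; split=> //.
  have E n : W1N S3 V 2%:E (classical_jet S3 (phi n) - w) =
    (nrmV (phi n - w.1)%R + \sum_i nrmV ('D_(e3 R i) (phi n) - w.2 i)%R)%:E.
    rewrite (W1N2 oV)//=; first by apply: L2_B.
    by move=> i; have [L1 L2' _] := c2 i; apply: L2_B.
  rewrite (_ : (fun _ => _) = (fun n =>
     (nrmV (phi n - w.1)%R + \sum_i nrmV ('D_(e3 R i) (phi n) - w.2 i)%R)%:E)); last first.
    by apply/funext => n; exact: E.
  apply/fine_cvgP; split; first exact: nearW.
  rewrite /comp /=.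
  rewrite -[X in _ --> X](_ : 0 + \sum_(i < 3) 0 = 0 :> R); last by rewrite big1 ?addr0.
  apply: cvgD => //; apply: cvg_sum_fin => i.
  by have [_ _] := c2 i.
Qed.

Lemma strong_cvg_dil (f_ : nat -> pt S3 -> R) (f : pt S3 -> R) :
  @strong_cvg _ (pt S3) R (leb3 R) U f_ f ->
  @strong_cvg _ (pt S3) R (leb3 R) V (fun n x => f_ n (dil x)) (fun x => f (dil x)).
Proof.
move=> [L1 L cv]; split.
- by move=> n; have [] := dil_sqr c0 mU mV UV (L1 n).
- by have [] := dil_sqr c0 mU mV UV L.
- have E n : nrmV ((fun x => f_ n (dil x)) - (fun x => f (dil x))) =
      Num.sqrt c^-1 * nrmU (f_ n - f).
    have [_ H] := dil_sqr c0 mU mV UV (L2_B (L1 n) L).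
    by rewrite /norm2 -sqrtrM ?invr_ge0 ?ltW// -H.
  rewrite (_ : (fun _ => _) = (fun n => Num.sqrt c^-1 * nrmU (f_ n - f))); last first.
    by apply/funext => n; exact: E.
  by rewrite -[0](mulr0 (Num.sqrt c^-1)); exact: cvgMl_tmp.
Qed.

Lemma H10_dil (v : jet3) : H10 S3 U v -> H10 S3 V (dilj v).
Proof.
move=> /(H10_approx oU UB)[phi [tphi p0 p1]].
apply: (@H10_closed _ (fun n => phi n \o dil)).
- by move=> n; exact: test_fun_dil.
- exact: strong_cvg_dil p0.
- move=> i; have H := strong_cvgZ mV (dscal i) (strong_cvg_dil (p1 i)).
  rewrite (_ : (fun n => 'D_(e3 R i) (phi n \o dil)) =
     (fun n => dscal i *: (fun x : pt S3 => 'D_(e3 R i) (phi n) (dil x)))); last first.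
    apply/funext => n; exact: pder_dil (test_fun_smooth (tphi n)).
  exact: H.
Qed.

Lemma grade_dilj (v : jet3) j x : grade c (dilj v) j x = v.2 j (dil x).
Proof.
rewrite /grade /dilj /dscal /=; case: (j == vert); last by rewrite mul1r.
by rewrite mulrA mulVf ?mul1r// gt_eqF.
Qed.

End dilated_functions.

(** * The pressure estimate *)

Lemma norm_sum_le (R : realType) n (F : 'I_n -> R) (c : R) :
  (forall i, `|F i| <= c) -> `|\sum_i F i| <= n%:R * c.
Proof.
move=> Fc; apply: le_trans (ler_norm_sum _ _ _) _.
apply: le_trans (ler_sum _ (fun i _ => Fc i)) _.
by rewrite sumr_const card_ord mulr_natl.
Qed.

(** [S1], [S2], [S3] and [P] stand for the viscous, drag, force and pressure terms of the momentum
    equation for a dilated field, and [s] for eps^(-1/2). After multiplication by [eps] all powers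
    of [eps] cancel except the one in [s]. *)
Lemma grad_arith (R : realType) (eps A b s m1 m2 S1 S2 S3 P : R) : 0 < eps ->
  `|S1| <= 3 * (3 * (A / eps * s)) -> `|S2| <= 3 * (A * (b * (eps * s))) ->
  `|S3| <= 2 * (A * (b * (eps * s))) ->
  m1 * S1 + m2 * eps ^- 2 * S2 - P = eps ^- 2 * S3 ->
  `|eps * P| <= (`|m1| * (3 * (3 * A)) + `|m2| * (3 * (A * b)) + 2 * (A * b)) * s.
Proof.
move=> e0 h1 h2 h3 E.
have en : eps != 0 by rewrite gt_eqF.
have -> : eps * P = m1 * (eps * S1) + m2 * (eps^-1 * S2) - eps^-1 * S3.
  have -> : P = m1 * S1 + m2 * eps ^- 2 * S2 - eps ^- 2 * S3 by rewrite -E; ring.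
  by field.
have {}h1 : `|eps * S1| <= 3 * (3 * A) * s.
  rewrite normrM gtr0_norm//.
  apply: le_trans (ler_wpM2l (ltW e0) h1) _.
  by rewrite le_eqVlt; apply/orP; left; apply/eqP; field.
have {}h2 : `|eps^-1 * S2| <= 3 * (A * b) * s.
  rewrite normrM gtr0_norm ?invr_gt0//.
  have ei : 0 <= eps^-1 by rewrite invr_ge0 ltW.
  apply: le_trans (ler_wpM2l ei h2) _.
  by rewrite le_eqVlt; apply/orP; left; apply/eqP; field.
have {}h3 : `|eps^-1 * S3| <= 2 * (A * b) * s.
  rewrite normrM gtr0_norm ?invr_gt0//.
  have ei : 0 <= eps^-1 by rewrite invr_ge0 ltW.
  apply: le_trans (ler_wpM2l ei h3) _.
  by rewrite le_eqVlt; apply/orP; left; apply/eqP; field.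
apply: le_trans (ler_normB _ _) _.
have -> : (`|m1| * (3 * (3 * A)) + `|m2| * (3 * (A * b)) + 2 * (A * b)) * s =
  `|m1| * (3 * (3 * A) * s) + `|m2| * (3 * (A * b) * s) + 2 * (A * b) * s by ring.
apply: lerD h3; apply: le_trans (ler_normD _ _) _.
by apply: lerD; rewrite normrM; apply: ler_wpM2l.
Qed.

Section pressure.
Context (R : realType).
Local Notation R2 := (R * R)%type.
Local Notation R3 := (R * R * R)%type.
Local Notation S3 := (space3 R).
Local Notation P2 := (plane2 R).
Local Notation jet3 := (jet S3).
Variables (om : set R2) (h : R2 -> R) (B : R).
Hypothesis oom : open om.
Hypothesis omB : om `<=` box2 B.
Hypothesis ch : forall x, om x -> {for x, continuous h}.
Hypothesis hB : forall x, om x -> h x <= B.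
Local Notation Om := (layer om h).
Local Notation L2 := (inL (leb3 R) (Om : set (pt S3)) 2%:E).
Local Notation ip := (@inner _ (pt S3) R (leb3 R) Om).
Local Notation nrm := (@norm2 _ (pt S3) R (leb3 R) Om).
Local Notation oOm := (layer_open oom ch).
Local Notation OmB := (layer_box omB hB).
Local Notation mO := (mOm oOm).

Variables (mu mueff K : R) (f : 'I_2 -> R2 -> R).
Hypothesis Lf : forall i, Lr P2 om 2%:E (f i).
Variable eps : R.
Hypothesis eps0 : 0 < eps.
Variables (u : 'I_3 -> jet3) (p : R3 -> R).
Hypothesis Hu : forall i, H10 S3 Om (u i).
Hypothesis Lp : Lr S3 Om 2%:E p.
Hypothesis mom_eq : forall v : 'I_3 -> jet3, (forall i, H10 S3 Om (v i)) ->
  2 * mueff * \int[leb3 R]_(x in Om)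
      (\sum_i \sum_j syme eps u i j x * syme eps v i j x)
  + mu / K * eps ^- 2 * \int[leb3 R]_(x in Om) (\sum_i (u i).1 x * (v i).1 x)
  - \int[leb3 R]_(x in Om) (p x * dive eps v x)
  = \int[leb3 R]_(x in Om) (eps ^- 2 * \sum_i f i x.1 * (v (horiz i)).1 x).

Definition fst_fun (g : R2 -> R) : pt S3 -> R := fun x => g x.1.

Lemma L2_fst_fun (g : R2 -> R) : Lr P2 om 2%:E g -> L2 (fst_fun g).
Proof. by move=> Lg; have [] := fst_L2 oom omB ch hB Lg. Qed.

Lemma mom_ip (v : 'I_3 -> jet3) : (forall i, H10 S3 Om (v i)) ->
  2 * mueff * (\sum_i \sum_j ip (syme eps u i j) (syme eps v i j))
  + mu / K * eps ^- 2 * (\sum_i ip (u i).1 (v i).1)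
  - ip p (dive eps v)
  = eps ^- 2 * \sum_i ip (fst_fun (f i)) (v (horiz i)).1.
Proof.
move=> Hv; have := mom_eq Hv.
have Lu i : L2 (u i).1 by have [] := H10_L2 (Hu i).
have Ldu i j : L2 ((u i).2 j) by have [_] := H10_L2 (Hu i); exact.
have Lv i : L2 (v i).1 by have [] := H10_L2 (Hv i).
have Ldv i j : L2 ((v i).2 j) by have [_] := H10_L2 (Hv i); exact.
have Lff i := L2_fst_fun (Lf i).
have E1 := integral_sum2_ip mO (fun i j => L2_syme eps i j Ldu) (fun i j => L2_syme eps i j Ldv).
have E2 := integral_sum_ip mO Lu Lv.
have E3 := integral_sum_ip mO (fun i => L2_Z (eps ^- 2) (Lff i)) (fun i => Lv (horiz i)).
move=> E; apply: etrans (etrans E _).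
  by rewrite E1 E2.
rewrite mulr_sumr; apply: etrans (etrans E3 _).
  by apply: eq_Rintegral => x _; rewrite mulr_sumr; apply: eq_bigr => i _; rewrite mulrA.
by apply: eq_bigr => i _; rewrite (ipZl mO).
Qed.

Local Notation Ome := (layer om (fun x' => eps * h x')).

Lemma che x : om x -> {for x, continuous (fun x' => eps * h x')}.
Proof. by move=> ox; apply: cvgM; [exact: cvg_cst|exact: ch]. Qed.

(** One box has to contain both the cross-section, of size [B], and the heights of the thin layer,
    of size [eps * B]. *)
Definition Beps := Num.max B (eps * B).

Lemma omBe : om `<=` box2 Beps.
Proof. by move=> x /omB; apply: box2_le; rewrite /Beps le_max lexx. Qed.

Lemma hBe x : om x -> eps * h x <= Beps.
Proof. by move=> /hB hx; rewrite /Beps le_max ler_pM2l// hx orbT. Qed.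

Local Notation oOme := (layer_open oom che).
Local Notation OmeB := (layer_box omBe hBe).
Local Notation mOe := (mOm oOme).
Local Notation nrme := (@norm2 _ (pt S3) R (leb3 R) Ome).

Lemma layer_dil x : Om x <-> Ome (dilation eps x).
Proof.
by rewrite /layer /dilation /=; split=> -[ox /andP[z0 zh]]; split=> //;
  move: z0 zh; rewrite pmulr_rgt0// ltr_pM2l// => -> ->.
Qed.

Lemma layer_dilV x : Ome x <-> Om (dilation eps^-1 x).
Proof. by rewrite layer_dil /dilation /= mulrA mulfV ?mul1r ?gt_eqF//; case: x. Qed.

Definition dilf (g : R3 -> R) : pt S3 -> R := fun x => g (dilation eps x).

Lemma nrm_dilf g : Lr S3 Ome 2%:E g -> L2 (dilf g) /\
  nrm (dilf g) = Num.sqrt eps^-1 * nrme g.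
Proof.
move=> Lg; have [LV H] := dil_sqr eps0 mOe mO layer_dil Lg; split=> //.
by rewrite /norm2 -sqrtrM ?invr_ge0 ?ltW// -H.
Qed.

Lemma L2_undilate : Lr S3 Ome 2%:E (undilate eps p).
Proof.
have ei : 0 < eps^-1 by rewrite invr_gt0.
have [H _] := dil_sqr ei mO mOe layer_dilV Lp.
rewrite (_ : undilate eps p = (fun x => p (dilation eps^-1 x)))//.
by apply/funext => x; rewrite /undilate /dilation mulrC.
Qed.

Lemma dilf_undilate : dilf (undilate eps p) = p.
Proof.
by apply/funext => -[x z]; rewrite /dilf /undilate /dilation /= mulrAC mulfV ?mul1r// gt_eqF.
Qed.

Variable A : R.
Hypothesis uA : forall i, nrm (u i).1 <= A.
Hypothesis duA : forall i j, nrm (syme eps u i j) <= A / eps.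
Hypothesis fA : forall i, nrm (fst_fun (f i)) <= A.

(** The factors 3 and 2 count the entries or components in the viscous, drag and force sums;
    [2 * |B|] is the Poincaré constant. *)
Definition grad_const : R :=
  `|2 * mueff| * (3 * (3 * A)) + `|mu / K| * (3 * (A * (2 * `|B|)))
  + 2 * (A * (2 * `|B|)).

Lemma grad_bound (v : 'I_3 -> jet3) : (forall i, H10 S3 Ome (v i)) ->
  (\sum_i W1N S3 Ome 2%:E (v i) <= 1)%E ->
  `|\int[leb3 R]_(x in Ome) (undilate eps p x * \sum_i (v i).2 i x)|
   <= grad_const * Num.sqrt eps^-1.
Proof.
move=> Hv v1.
have Lv i : Lr S3 Ome 2%:E (v i).1 by have [] := H10_L2 (Hv i).
have Ldv i j : Lr S3 Ome 2%:E ((v i).2 j) by have [_] := H10_L2 (Hv i); exact.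
have dv1 i j : nrme ((v i).2 j) <= 1.
  rewrite -lee_fin; apply: le_trans v1.
  have -> : (\sum_i W1N S3 Ome 2%:E (v i))%E =
     (\sum_i (nrme (v i).1 + \sum_j nrme ((v i).2 j)))%:E.
    rewrite -sumEFin; apply: eq_bigr => k _; exact: (W1N2 oOme (Lv k) (Ldv k)).
  rewrite lee_fin (bigD1 i)//= (bigD1 j)//=.
  have := nrm_ge0 (leb3 R) Ome (v i).1.
  have : 0 <= \sum_(k < 3 | k != j) nrme ((v i).2 k).
    by apply: sumr_ge0 => k _; exact: nrm_ge0.
  have : 0 <= \sum_(k < 3 | k != i) (nrme (v k).1 + \sum_j nrme ((v k).2 j)).
    apply: sumr_ge0 => k _; apply: addr_ge0; first exact: nrm_ge0.
    by apply: sumr_ge0 => l _; exact: nrm_ge0.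
  move: (nrme _) (nrme _) (\sum_(k < 3 | k != j) _) (\sum_(k < 3 | k != i) _).
  move=> a b c d; lra.
pose w i : jet3 := dilj eps (v i).
have Hw i : H10 S3 Om (w i).
  exact: (H10_dil eps0 layer_dil oOme oOm OmB OmeB (Hv i)).
have Lw i : L2 (w i).1 by have [] := H10_L2 (Hw i).
have Ldw i j : L2 ((w i).2 j) by have [_] := H10_L2 (Hw i); exact.
(* The factor by which dilation to the fixed layer multiplies L2 norms. *)
set s := Num.sqrt eps^-1.
have s0 : 0 <= s by exact: sqrtr_ge0.
have gE i j : grade eps (w i) j = dilf ((v i).2 j).
  by apply/funext => x; exact: grade_dilj.
have gw i j : nrm (grade eps (w i) j) <= s.
  rewrite gE; have [_ ->] := nrm_dilf (Ldv i j).
  by rewrite -[leRHS]mulr1 ler_wpM2l.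
have Lg i j : L2 (grade eps (w i) j) by exact: L2_grade.
have sw i j : nrm (syme eps w i j) <= s.
  rewrite symeE (nrmZ mO); last exact: L2_D (Lg i j) (Lg j i).
  have := nrmD_le mO (Lg i j) (Lg j i).
  have := gw i j; have := gw j i.
  rewrite ger0_norm ?invr_ge0//.
  move: (nrm _) (nrm _) (nrm _) => a b d ha hb hd.
  by rewrite ler_pdivrMl//; lra.
(* The vertical derivative of [w] carries a factor [eps] from the dilation, and Poincaré passes it
   on to [w]. *)
have ww i : nrm (w i).1 <= 2 * `|B| * (eps * s).
  apply: le_trans (poincare oOm OmB (Hw i)) _.
  apply: ler_wpM2l; first by rewrite mulr_ge0.
  have -> : (w i).2 vert = eps *: (grade eps (w i) vert : pt S3 -> R).
    rewrite gE; apply/funext => x.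
    by rewrite /w /dilj /= /dscal eqxx.
  by rewrite (nrmZ mO _ (Lg i vert)) gtr0_norm// ler_pM2l.
(* The factor [eps] is the Jacobian; the plain divergence on the thin layer becomes the scaled
   divergence of [w]. *)
have key : \int[leb3 R]_(x in Ome) (undilate eps p x * \sum_i (v i).2 i x) =
    eps * ip p (dive eps w).
  have LG : inL (leb3 R) (Ome : set (pt S3)) 2%:E (\sum_i ((v i).2 i : pt S3 -> R)).
    by apply: L2_sum => i; exact: Ldv.
  have := dil_ip eps0 mOe mO layer_dil L2_undilate LG.
  have -> : (fun x : pt S3 => undilate eps p (dilation eps x)) = p by exact: dilf_undilate.
  have -> : (fun x : pt S3 => (\sum_i ((v i).2 i : pt S3 -> R)) (dilation eps x)) = dive eps w.
    apply/funext => x; rewrite fct_sumE /dive; apply: eq_bigr => i _.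
    by rewrite gE.
  move=> ->; rewrite mulrA mulfV ?gt_eqF// mul1r; apply: eq_Rintegral => x _.
  by rewrite fct_sumE.
have A0 : 0 <= A by exact: le_trans (nrm_ge0 (leb3 R) Om _) (uA vert).
have Lu i : L2 (u i).1 by have [] := H10_L2 (Hu i).
have Ldu i j : L2 ((u i).2 j) by have [_] := H10_L2 (Hu i); exact.
set b := 2 * `|B|.
have ipb (g k : pt S3 -> R) (x y : R) : L2 g -> L2 k -> nrm g <= x -> nrm k <= y -> `|ip g k| <= x * y.
  move=> Lg' Lk gx ky; apply: le_trans (cauchy_schwarz mO Lg' Lk) _.
  by apply: ler_pM => //; exact: nrm_ge0.
have S1 : `|\sum_i \sum_j ip (syme eps u i j) (syme eps w i j)| <= 3 * (3 * (A / eps * s)).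
  apply: norm_sum_le => i; apply: norm_sum_le => j.
  by apply: ipb => //; exact: L2_syme.
have S2 : `|\sum_i ip (u i).1 (w i).1| <= 3 * (A * (b * (eps * s))).
  by apply: norm_sum_le => i; apply: ipb.
have S3' : `|\sum_i ip (fst_fun (f i)) (w (horiz i)).1| <= 2 * (A * (b * (eps * s))).
  by apply: norm_sum_le => i; apply: ipb => //; exact: L2_fst_fun.
by rewrite key; apply: (grad_arith eps0 S1 S2 S3' (mom_ip Hw)).
Qed.

(* Fields on the thin layer are dilated to [Om] and used as test functions in the
   momentum equation. *)
Lemma grad_Hm1N_bound :
  (grad_Hm1N S3 Ome (undilate eps p) <= (grad_const * Num.sqrt eps^-1)%:E)%E.
Proof.
apply: ge_ereal_sup => _ [v [Hv v1] <-]; rewrite lee_fin.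
exact: grad_bound.
Qed.

Variables (C : R) (p0 : jet P2) (p1 : R3 -> R).
Hypothesis dec : pressure_decomposition om h C eps (undilate eps p) p0 p1.

Lemma L2_p1 : L2 (dilf p1).
Proof. by have [_ Lp1 _ _] := dec; have [] := nrm_dilf Lp1. Qed.

(** One factor eps^(-1/2) comes from dilating [p1], another from the bound on the pressure gradient;
    together with eps^2 they leave eps. *)
Lemma nrm_p1 : eps ^+ 2 * nrm (dilf p1) <= `|C| * grad_const * eps.
Proof.
have [Wp0 Lp1 _ bound] := dec.
have [_ ->] := nrm_dilf Lp1.
have gb := grad_Hm1N_bound.
(* The zero field is admissible in the supremum. Nonnegativity is used to replace [C], whose sign is
   unspecified, by its absolute value. *)
have g0 : (0 <= grad_Hm1N S3 Ome (undilate eps p))%E.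
  pose z : jet3 := classical_jet S3 0.
  have zE : z = 0.
    congr (_, _); apply/funext => i; apply/funext => x; exact: derive_cst.
  have Hz : H10 S3 Ome z by exact: (test_H10 oOme OmeB (test_fun0 Ome)).
  have W0 : W1N S3 Ome 2%:E z = 0%E.
    have [Lz Ldz] := H10_L2 Hz; rewrite (W1N2 oOme Lz Ldz) zE /=.
    by rewrite /norm2 (ip0l (leb3 R) mOe) sqrtr0 big1 ?addr0.
  apply: (@le_trans _ _ (`|\int[leb3 R]_(x in Ome) (undilate eps p x * \sum_i z.2 i x)|%:E)).
    by rewrite lee_fin.
  apply: ereal_sup_ubound; exists (fun=> z) => //; split=> //.
  by rewrite big1.
have LNp1 : LN S3 Ome 2%:E p1 = (nrme p1)%:E by exact: (LN2 oOme Lp1).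
have gc0 : 0 <= grad_const * Num.sqrt eps^-1.
  by rewrite -lee_fin; exact: le_trans g0 gb.
have np1 : nrme p1 <= `|C| * (grad_const * Num.sqrt eps^-1).
  rewrite -lee_fin -LNp1; apply: (@le_trans _ _ (C%:E * grad_Hm1N S3 Ome (undilate eps p))%E).
    apply: le_trans bound; rewrite leeDr// mule_ge0//.
      by rewrite lee_fin powR_ge0.
    by apply: adde_ge0; [exact: Lnorm_ge0|apply: sume_ge0 => i _; exact: Lnorm_ge0].
  apply: (@le_trans _ _ (`|C|%:E * grad_Hm1N S3 Ome (undilate eps p))%E).
    by apply: lee_wpmul2r => //; rewrite lee_fin ler_norm.
  by rewrite EFinM; apply: lee_wpmul2l.
have s0 : 0 <= Num.sqrt eps^-1 by exact: sqrtr_ge0.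
apply: le_trans (ler_wpM2l (sqr_ge0 eps) (ler_wpM2l s0 np1)) _.
have ss : Num.sqrt eps^-1 * Num.sqrt eps^-1 = eps^-1.
  by rewrite -expr2 sqr_sqrtr// invr_ge0 ltW.
rewrite le_eqVlt; apply/orP; left; apply/eqP.
transitivity (`|C| * grad_const * (eps ^+ 2 * (Num.sqrt eps^-1 * Num.sqrt eps^-1))); first ring.
rewrite ss; field; exact: lt0r_neq0.
Qed.

(** The decomposition holds almost everywhere on the thin layer, so its defect has zero norm there.
    Dilation preserves this, and [nrm0_ip] removes the defect from the product. *)
Lemma decomposed_ip (g : R3 -> R) : L2 g ->
  ip p g = ip (fst_fun p0.1) g + ip (dilf p1) g.
Proof.
move=> Lg; have [[Lp0 _ _] Lp1 aedec _] := dec.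
have Lp0e : inL (leb3 R) (Ome : set (pt S3)) 2%:E (fst_fun p0.1).
  by have [] := fst_L2 oom omBe che hBe Lp0.
pose D : pt S3 -> R := (undilate eps p : pt S3 -> R) - fst_fun p0.1 - p1.
have LD : inL (leb3 R) (Ome : set (pt S3)) 2%:E D.
  by apply: L2_B Lp1; apply: L2_B Lp0e; exact: L2_undilate.
have D0 : nrme D = 0.
  rewrite /norm2 /inner /Rintegral.
  rewrite (@ae_eq_integral _ (pt S3) R (leb3 R) Ome (cst 0%E)) ?integral0 ?sqrtr0//.
  - exact: mOe.
  - have mD := inL_measurable mOe LD.
    by apply/measurable_EFinP; exact: measurable_funM.
  - apply: (negligibleS _ aedec) => x /= nP Hx; apply: nP => Ox.
    by rewrite /D !fctE Hx// /fst_fun addrAC addrK subrr mulr0.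
have [LdD nD] := nrm_dilf LD.
move: nD; rewrite D0 mulr0 => nD.
have H0 := nrm0_ip mO LdD Lg nD.
have E : dilf D = (p : pt S3 -> R) - fst_fun p0.1 - dilf p1.
  by apply/funext => x; rewrite /D /dilf !fctE -[in RHS]dilf_undilate.
have Lp0' := L2_fst_fun Lp0.
move: H0; rewrite E (ipBl mO (L2_B Lp Lp0') L2_p1 Lg) (ipBl mO Lp Lp0' Lg).
move: (ip p g) (ip _ g) (ip _ g) => a b c Eq.
by move/eqP: Eq; rewrite -addrA -opprD subr_eq0 => /eqP.
Qed.

End pressure.

(** * Traces of smooth functions *)

Section raw_integral.
Context d (T : measurableType d) (R : realType).

Lemma sintegral_null (mu : set T -> \bar R) (f : T -> R) : mu set0 = 0%E ->
  (forall x, f x = 0) -> sintegral mu f = 0%E.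
Proof.
move=> mu0 f0; apply: fsbig1 => x _.
have [->|x0] := eqVneq x 0; first by rewrite mul0e.
rewrite (_ : f @^-1` [set x] = set0) ?mu0 ?mule0//.
by apply/seteqP; split=> y //=; rewrite f0 => xE; move: x0; rewrite -xE eqxx.
Qed.

Import HBNNSimple.

(* [mu] is only assumed to be a set function, so that this applies to [surface]. *)
Lemma integral_null (mu : set T -> \bar R) (D : set T) (f : T -> \bar R) :
  mu set0 = 0%E -> (forall x, D x -> f x = 0%E) ->
  (\int[mu]_(x in D) f x = 0)%E.
Proof.
move=> mu0 f0.
have fD : f \_ D = cst 0%E.
  apply/funext => x; rewrite /patch; case: ifPn => // /set_mem; exact: f0.
have sup0 : ereal_sup [set sintegral mu h |
    h in [set h : {nnsfun T >-> R} | forall x, (((h x)%:E : \bar R) <= 0)%E]] = 0%E.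
  apply/eqP; rewrite eq_le; apply/andP; split.
    apply: ge_ereal_sup => _ [h h0 <-]; rewrite sintegral_null// => x.
    by apply/le_anti; rewrite fun_ge0 andbT; have := h0 x; rewrite lee_fin.
  apply: ereal_sup_ubound; exists nnsfun0 => //=.
  by rewrite sintegral_null.
rewrite /integral fD.
have -> : ((cst 0 : T -> \bar R)^\+ = cst 0)%E.
  by apply/funext => x; rewrite funeposE /= maxxx.
have -> : ((cst 0 : T -> \bar R)^\- = cst 0)%E.
  by apply/funext => x; rewrite funenegE /= oppr0 maxxx.
by rewrite /= [X in (X - X)%E]sup0 sube0.
Qed.

End raw_integral.

Section surface_measure.
Context (R : realType).
Local Notation R3 := (R * R * R)%type.

Lemma sqdiam0 : @sqdiam R set0 = 0%E.
Proof.
rewrite /sqdiam set0X image_set0 ereal_sup0.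
by apply/max_idPl; exact: leNye.
Qed.

Lemma sqdiam_ge0 (A : set R3) : (0 <= sqdiam A)%E.
Proof. by rewrite /sqdiam le_max lexx. Qed.

Lemma surface0 : @surface R set0 = 0%E.
Proof.
rewrite /surface.
have E (delta : R) : 0 < delta -> ereal_inf [set (\sum_(k <oo) sqdiam (B k))%E |
    B in [set B : nat -> set R3 |
      set0 `<=` \bigcup_k B k /\ forall k, (sqdiam (B k) <= delta%:E)%E]] = 0%E.
  move=> d0; apply/eqP; rewrite eq_le; apply/andP; split.
    apply: ereal_inf_lbound; exists (fun=> set0).
      by split=> // k; rewrite sqdiam0 lee_fin ltW.
    by rewrite eseries0// => k _ _; exact: sqdiam0.
  apply: le_ereal_inf_tmp => _ [B _ <-]; apply: nneseries_ge0 => k _ _.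
  exact: sqdiam_ge0.
have -> : [set ereal_inf [set (\sum_(k <oo) sqdiam (B k))%E |
    B in [set B : nat -> set R3 |
      set0 `<=` \bigcup_k B k /\ forall k, (sqdiam (B k) <= delta%:E)%E]]
    | delta in [set delta : R | (0 < delta)%R]] = [set 0%E].
  apply/seteqP; split=> x /=.
    by move=> [delta d0 <-]; exact: E.
  by move=> ->; exists 1; [exact: ltr01|exact: E ltr01].
by rewrite ereal_sup1 mule0.
Qed.

(* The constant sequence approximates [zeta], and the surface integral of the
   zero function only uses [surface set0 = 0]. *)
Lemma has_trace_smooth (U : set R3) (r B : R) (Gam : set R3) (zeta g : R3 -> R) :
  open U -> U `<=` box3 B -> 1 <= r -> smooth_on setT zeta ->
  measurable_fun (Gam : set (pt (space3 R))) (g : pt (space3 R) -> R) ->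
  (forall x, Gam x -> g x = zeta x) ->
  has_trace U r Gam (classical_jet (space3 R) zeta) g.
Proof.
move=> oU UB r1 sz mg gz; exists (fun=> zeta); split=> //.
- rewrite (_ : (fun _ => _) = cst 0%E); first exact: cvg_cst.
  apply/funext => n; rewrite subrr /W1N.
  have Z : LN (space3 R) U r%:E 0 = 0%E.
    rewrite /LN (_ : EFin \o _ = cst 0%E).
      by rewrite Lnorm0// eqe gt_eqF// (lt_le_trans ltr01 r1).
    by apply/funext => x; rewrite /= /patch; case: ifP.
  by rewrite Z big1 ?addr0.
- rewrite (_ : (fun _ => _) = cst 0%E); first exact: cvg_cst.
  apply/funext => n; apply: integral_null; first exact: surface0.
  by move=> x Gx; rewrite gz// subrr normr0 powR0// gt_eqF// (lt_le_trans ltr01 r1).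
Qed.

End surface_measure.

(** * Pairing of Lebesgue spaces with conjugate exponents *)

Section pairing.
Context d (T : measurableType d) (R : realType).
Variables (mu : {measure set T -> \bar R}) (U : set T).
Hypothesis mU : measurable U.
Variables (p q : R).
Hypothesis p1 : 1 <= p.
Hypothesis q0 : 0 < q.
Hypothesis pq : p^-1 + q^-1 = 1.

Let p0 : 0 < p. Proof. exact: lt_le_trans ltr01 p1. Qed.

Lemma pair_linl (a : R) (f g k : T -> R) : inL mu U p%:E f -> inL mu U p%:E g ->
  inL mu U q%:E k -> inner mu U (a *: f + g) k = a * inner mu U f k + inner mu U g k.
Proof.
move=> Lf Lg Lk.
have [i1 _] := hoelder_in mU p0 q0 pq Lf Lk.
have [i2 _] := hoelder_in mU p0 q0 pq Lg Lk.
have Laf : inL mu U p%:E (a *: f).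
  by rewrite -[a *: f]addr0; apply: inL_lin => //; exact: inL0.
have [i3 _] := hoelder_in mU p0 q0 pq Laf Lk.
rewrite -RintegralZl// -RintegralD//; last first.
  rewrite (_ : _ \o _ = EFin \o (fun x => (a *: f) x * k x))//.
  by apply/funext => x; rewrite /= !fctE mulrA.
by apply: eq_Rintegral => x _; rewrite !fctE mulrDl mulrA.
Qed.

Lemma pair_bound (k : T -> R) : inL mu U q%:E k -> forall f, inL mu U p%:E f ->
  (`|inner mu U f k|%:E <= (fine (normL mu U q%:E k))%:E * normL mu U p%:E f)%E.
Proof.
move=> Lk f Lf; have [_ H] := hoelder_in mU p0 q0 pq Lf Lk.
by rewrite (inL_fine Lk) muleC.
Qed.

End pairing.

(** * Passage to the limit in the flow *)

Lemma energy_gap_arith (R : comNzRingType) (c m a b d a' b' d' : R) :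
  c * (a - 2 * b + d) + m * (a' - 2 * b' + d') =
  c * a + m * a' - 2 * (m * b' + c * b) + (c * d + m * d').
Proof. by ring. Qed.

Lemma sum_horiz (V : nmodType) (F : 'I_3 -> V) :
  \sum_i F i = \sum_i F (horiz i) + F vert.
Proof. by rewrite big_ord_recr. Qed.

Section sequences.
Context (R : realType).
Local Notation R2 := (R * R)%type.
Local Notation R3 := (R * R * R)%type.
Local Notation S3 := (space3 R).
Local Notation P2 := (plane2 R).
Local Notation jet3 := (jet S3).
Variables (om : set R2) (h : R2 -> R) (B : R).
Hypothesis oom : open om.
Hypothesis omB : om `<=` box2 B.
Hypothesis ch : forall x, om x -> {for x, continuous h}.
Hypothesis hB : forall x, om x -> h x <= B.
Local Notation Om := (layer om h).
Local Notation L2 := (inL (leb3 R) (Om : set (pt S3)) 2%:E).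
Local Notation ip := (@inner _ (pt S3) R (leb3 R) Om).
Local Notation nrm := (@norm2 _ (pt S3) R (leb3 R) Om).
Local Notation strong_cvg := (@strong_cvg _ (pt S3) R (leb3 R) Om).
Local Notation oOm := (layer_open oom ch).
Local Notation OmB := (layer_box omB hB).
Local Notation mO := (mOm oOm).

Variables (mu mueff K C : R) (f : 'I_2 -> R2 -> R).
Hypothesis mu0 : 0 < mu.
Hypothesis mueff0 : 0 < mueff.
Hypothesis K0 : 0 < K.
Hypothesis Lf : forall i, Lr P2 om 2%:E (f i).
Variable e : nat -> R.
Hypothesis e0 : forall n, 0 < e n.
Hypothesis ecvg : e n @[n --> \oo] --> 0.
Variables (U : nat -> 'I_3 -> jet3) (P : nat -> R3 -> R).
Variables (P0 : nat -> jet P2) (P1 : nat -> R3 -> R).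
Hypothesis HU : forall n i, H10 S3 Om (U n i).
Hypothesis LP : forall n, Lr S3 Om 2%:E (P n).
Hypothesis mom_eq : forall n (v : 'I_3 -> jet3), (forall i, H10 S3 Om (v i)) ->
  2 * mueff * \int[leb3 R]_(x in Om)
      (\sum_i \sum_j syme (e n) (U n) i j x * syme (e n) v i j x)
  + mu / K * e n ^- 2 * \int[leb3 R]_(x in Om) (\sum_i (U n i).1 x * (v i).1 x)
  - \int[leb3 R]_(x in Om) (P n x * dive (e n) v x)
  = \int[leb3 R]_(x in Om) (e n ^- 2 * \sum_i f i x.1 * (v (horiz i)).1 x).
Hypothesis div_eq : forall n (psi : jet3), H10 S3 Om psi ->
  \int[leb3 R]_(x in Om) (\sum_i (U n i).1 x * grade (e n) psi i x) = 0.
Hypothesis dec : forall n,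
  pressure_decomposition om h C (e n) (undilate (e n) (P n)) (P0 n) (P1 n).
Variables (Gam : set R3) (us : 'I_2 -> @zjet R) (ps : jet P2).
Hypothesis Vus : forall i, Vz_zero om h 2 Gam (us i).
Hypothesis Wps : W1 P2 om 2%:E ps.
Hypothesis Wu : forall i, weak_cvg (Vz_zero om h 2 Gam) (VzN Om 2)
            (fun n => zjet_of (U n (horiz i))) (us i).
Hypothesis W3 : weak_cvg (Lr S3 Om 2%:E) (LN S3 Om 2%:E) (fun n => (U n vert).1) 0.
Hypothesis WP : weak_cvg (W1 P2 om 2%:E) (W1N P2 om 2%:E)
        (fun n => e n ^+ 2 *: P0 n) ps.

Let LU n i : L2 (U n i).1. Proof. by have [] := H10_L2 (HU n i). Qed.
Let LdU n i j : L2 ((U n i).2 j). Proof. by have [_] := H10_L2 (HU n i); exact. Qed.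
Let Lus i : L2 (us i).1. Proof. by have [[]] := Vus i. Qed.
Let Ldus i : L2 (us i).2. Proof. by have [[]] := Vus i. Qed.
Let Lff i : L2 (fst_fun (f i)). Proof. exact: (L2_fst_fun oom omB ch hB (Lf i)). Qed.
Let Lps i : L2 (fst_fun (ps.2 i)).
Proof. by apply: (L2_fst_fun oom omB ch hB); have [_ H _] := Wps; exact: H. Qed.

(** The pairing is a functional bounded by [nrm a + nrm b] times the graph norm. Value and vertical
    derivative are tested together so that a whole weak equation passes to the limit at once. *)
Lemma weak_u i (a b : pt S3 -> R) : L2 a -> L2 b ->
  ip (U n (horiz i)).1 a + ip ((U n (horiz i)).2 vert) b @[n --> \oo] -->
  ip (us i).1 a + ip (us i).2 b.
Proof.
move=> La Lb; have [_ _ wc] := Wu i.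
apply: (wc (fun v => ip v.1 a + ip v.2 b)).
  move=> t v w [[Lv Ldv _] _] [[Lw Ldw _] _] /=.
  rewrite (ip_linl mO t Lv Lw La) (ip_linl mO t Ldv Ldw Lb).
  by rewrite mulrDr addrACA.
exists (nrm a + nrm b) => v [[Lv Ldv _] _].
rewrite /VzN (LN2 oOm Lv) (LN2 oOm Ldv) -EFinD -EFinM lee_fin.
apply: le_trans (ler_normD _ _) _.
have h1 := cauchy_schwarz mO Lv La; have h2 := cauchy_schwarz mO Ldv Lb.
apply: le_trans (lerD h1 h2) _.
have := nrm_ge0 (leb3 R) Om v.1; have := nrm_ge0 (leb3 R) Om v.2.
have := nrm_ge0 (leb3 R) Om a; have := nrm_ge0 (leb3 R) Om b.
by move: (nrm a) (nrm b) (nrm v.1) (nrm v.2) => x y z t *; nra.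
Qed.

Lemma weak_u1 i (a : pt S3 -> R) : L2 a ->
  ip (U n (horiz i)).1 a @[n --> \oo] --> ip (us i).1 a.
Proof.
move=> La; have := @weak_u i a 0 La (L2_0 _ _).
have ip0r (k : pt S3 -> R) : ip k 0 = 0.
  by apply: etrans (ipC _ _ _ _) _; exact: (ip0l _ mO).
by rewrite ip0r addr0; under eq_fun do rewrite ip0r addr0.
Qed.

Lemma weak_u3 (a : pt S3 -> R) : L2 a -> ip (U n vert).1 a @[n --> \oo] --> 0.
Proof.
move=> La; have [_ _ wc] := W3.
rewrite -[X in _ --> X](ip0l (leb3 R) mO a).
apply: (wc (fun v => ip v a)).
  by move=> t v w Lv Lw; rewrite (ip_linl mO t Lv Lw La).
exists (nrm a) => v Lv; rewrite (LN2 oOm Lv) -EFinM lee_fin mulrC.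
exact: (cauchy_schwarz mO Lv La).
Qed.

(** The weak convergence lives on [om], whereas [g] depends on all variables: pairing the lift with
    [g] is a functional on planar Sobolev functions with bound [column_const B * nrm g]. *)
Lemma weak_p0 (g : pt S3 -> R) : L2 g ->
  e n ^+ 2 * ip (fst_fun (P0 n).1) g @[n --> \oo] --> ip (fst_fun ps.1) g.
Proof.
move=> Lg; have [WP0 _ wc] := WP.
have E n : e n ^+ 2 * ip (fst_fun (P0 n).1) g = ip (fst_fun (e n ^+ 2 *: P0 n).1) g.
  have [Lp0 _ _ _] := dec n; have [Lp _ _] := Lp0.
  by rewrite -(ipZl mO _ (L2_fst_fun oom omB ch hB Lp) Lg).
rewrite (_ : (fun _ => _) = (fun n => ip (fst_fun (e n ^+ 2 *: P0 n).1) g)); last first.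
  by apply/funext => n; exact: E.
apply: (wc (fun v => ip (fst_fun v.1) g)).
  move=> t v w [Lv _ _] [Lw _ _].
  exact: (ip_linl mO t (L2_fst_fun oom omB ch hB Lv) (L2_fst_fun oom omB ch hB Lw) Lg).
exists (column_const B * nrm g) => v [Lv Ldv _].
have [Lfv bv] := fst_L2 oom omB ch hB Lv.
have nv0 := nrm_ge0 (leb3 R) Om g.
apply: (@le_trans _ _ ((column_const B * nrm g)%:E * LN P2 om 2%:E v.1)%E); last first.
  apply: lee_wpmul2l; first by rewrite lee_fin mulr_ge0// sqrtr_ge0.
  by rewrite /W1N leeDl// sume_ge0// => i _; exact: Lnorm_ge0.
have -> : LN P2 om 2%:E v.1 = (@norm2 _ (pt P2) R (leb2 R) om v.1)%:E.
  exact: (normL2 (mom oom) Lv).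
rewrite -EFinM lee_fin; apply: le_trans (cauchy_schwarz mO Lfv Lg) _.
by rewrite mulrAC; apply: ler_wpM2r.
Qed.

(** The normalisation under which the energy bounds the gradient uniformly. In the vertical
    direction the two powers of [e n] cancel exactly. *)
Definition scaled_grad n i j : pt S3 -> R := e n *: (grade (e n) (U n i) j : pt S3 -> R).

Lemma scaled_grad_vert n i : scaled_grad n i vert = (U n i).2 vert.
Proof.
rewrite /scaled_grad gradeE /scal eqxx scalerA mulfV ?scale1r// lt0r_neq0//.
Qed.

Lemma L2_scaled_grad n i j : L2 (scaled_grad n i j).
Proof. by apply: L2_Z; exact: L2_grade. Qed.

Definition power n := \sum_i ip (fst_fun (f i)) (U n (horiz i)).1.

(** The momentum equation is tested with [U n] itself and multiplied by [e n ^+ 2]; the Korn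
    identity absorbs the factor 2 in front of the viscous term. *)
Lemma energy n :
  mueff * (\sum_i \sum_j ip (scaled_grad n i j) (scaled_grad n i j)) +
  mu / K * (\sum_i ip (U n i).1 (U n i).1) = power n.
Proof.
have := mom_ip oom omB ch hB Lf (HU n) (@mom_eq n) (HU n).
have Ldiv : L2 (dive (e n) (U n)) by exact: L2_dive.
have -> : ip (P n) (dive (e n) (U n)) = 0.
  by rewrite ipC; apply: (ip_dive0 oOm OmB (HU n) (@div_eq n)); exact: LP.
have := korn oOm OmB (HU n) (@div_eq n).
set S := \sum_i \sum_j ip (syme _ _ _ _) _.
set Gr := \sum_i \sum_j ip (grade _ _ _) _ => SG.
have -> : \sum_i \sum_j ip (scaled_grad n i j) (scaled_grad n i j) = e n ^+ 2 * Gr.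
  rewrite /Gr mulr_sumr; apply: eq_bigr => i _; rewrite mulr_sumr; apply: eq_bigr => j _.
  have Lg : L2 (grade (e n) (U n i) j) by exact: L2_grade.
  by rewrite /scaled_grad (ipZl mO _ Lg (L2_Z _ Lg)) (ipZr mO _ Lg Lg) mulrA expr2.
rewrite -SG subr0 -/(power n); move: {SG} S (\sum_i ip (U n i).1 (U n i).1) (power n) => S V F E.
have en0 : e n != 0 by rewrite lt0r_neq0.
have -> : F = e n ^+ 2 * (e n ^- 2 * F) by rewrite mulrA mulfV ?mul1r// expf_neq0.
by rewrite -E; field; rewrite en0 /= lt0r_neq0.
Qed.

Definition power_lim := \sum_i ip (fst_fun (f i)) (us i).1.

Lemma power_cvg : power n @[n --> \oo] --> power_lim.
Proof.
apply: cvg_sum_fin => i.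
have -> : ip (fst_fun (f i)) (us i).1 = ip (us i).1 (fst_fun (f i)) by exact: ipC.
rewrite (_ : (fun _ => _) = (fun n => ip (U n (horiz i)).1 (fst_fun (f i)))).
  exact: weak_u1.
by apply/funext => n; exact: ipC.
Qed.

Lemma energy_bound : exists2 M, 0 <= M & forall n,
  (forall i, nrm (U n i).1 <= M) /\ (forall i j, nrm (scaled_grad n i j) <= M).
Proof.
have [M0 [_ HM]] := cvg_seq_bounded (cvgP _ power_cvg).
have HM' n : `|power n| <= `|M0| + 1.
  apply: (HM (`|M0| + 1)) => //.
  by rewrite (le_lt_trans (ler_norm M0))// ltrDl ltr01.
set M1 := `|M0| + 1 in HM'.
have muK : 0 < mu / K by rewrite divr_gt0.
have bound n : (forall i, mu / K * ip (U n i).1 (U n i).1 <= M1) /\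
    (forall i j, mueff * ip (scaled_grad n i j) (scaled_grad n i j) <= M1).
  have E := energy n; have := le_trans (ler_norm _) (HM' n); rewrite -E.
  set a := \sum_i \sum_j _; set b := \sum_i _ => ab.
  have a0 i j : ip (scaled_grad n i j) (scaled_grad n i j) <= a.
    rewrite /a (bigD1 i)//= (bigD1 j)//= -addrA lerDl addr_ge0//.
      by apply: sumr_ge0 => l _; exact: ip_ge0.
    by apply: sumr_ge0 => k _; apply: sumr_ge0 => l _; exact: ip_ge0.
  have b0 i : ip (U n i).1 (U n i).1 <= b.
    rewrite /b (bigD1 i)//= lerDl; apply: sumr_ge0 => k _; exact: ip_ge0.
  have ap : 0 <= mueff * a.
    by apply: mulr_ge0; [exact: ltW|apply: le_trans (a0 vert vert); exact: ip_ge0].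
  have bp : 0 <= mu / K * b.
    by apply: mulr_ge0; [exact: ltW|apply: le_trans (b0 vert); exact: ip_ge0].
  split=> [i|i j].
    apply: le_trans (ler_wpM2l (ltW muK) (b0 i)) _.
    by apply: le_trans ab; rewrite lerDr.
  apply: le_trans (ler_wpM2l (ltW mueff0) (a0 i j)) _.
  by apply: le_trans ab; rewrite lerDl.
exists (Num.sqrt ((mu / K)^-1 * M1) + Num.sqrt (mueff^-1 * M1)).
  by rewrite addr_ge0// sqrtr_ge0.
move=> n; have [h1 h2] := bound n; split=> [i|i j].
  apply: (@le_trans _ _ (Num.sqrt ((mu / K)^-1 * M1))); last by rewrite lerDl sqrtr_ge0.
  by rewrite /norm2; apply: ler_wsqrtr; rewrite ler_pdivlMl//; exact: h1.
apply: (@le_trans _ _ (Num.sqrt (mueff^-1 * M1))); last by rewrite lerDr sqrtr_ge0.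
by rewrite /norm2; apply: ler_wsqrtr; rewrite ler_pdivlMl//; exact: h2.
Qed.

Lemma scaled_grad_syme n i j : e n *: (syme (e n) (U n) i j : pt S3 -> R) =
  2^-1 *: (scaled_grad n i j + scaled_grad n j i).
Proof. by rewrite symeE /scaled_grad -scalerDr !scalerA mulrC. Qed.

Lemma p1_cvg (g : pt S3 -> R) : L2 g ->
  e n ^+ 2 * ip (dilf (e n) (P1 n)) g @[n --> \oo] --> 0.
Proof.
move=> Lg; have [M M0 HM] := energy_bound.
(* The pressure estimate takes a single constant for velocity, strain and force, independent of
   [n]. *)
pose A := M + \sum_i nrm (fst_fun (f i)).
have S0 : 0 <= \sum_i nrm (fst_fun (f i)) by apply: sumr_ge0 => i _; exact: nrm_ge0.
have MA : M <= A by rewrite lerDl.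
have fA i : nrm (fst_fun (f i)) <= A.
  apply: (@le_trans _ _ (\sum_i nrm (fst_fun (f i)))); last by rewrite lerDr.
  by rewrite (bigD1 i)//= lerDl sumr_ge0// => k _; exact: nrm_ge0.
have uA n i : nrm (U n i).1 <= A by apply: le_trans MA; have [] := HM n.
have sA n i j : nrm (syme (e n) (U n) i j) <= A / e n.
  rewrite ler_pdivlMr// mulrC -[X in X * _ <= _](gtr0_norm (e0 n)).
  rewrite -(nrmZ mO _ (L2_syme (e n) i j (LdU n))) scaled_grad_syme.
  rewrite (nrmZ mO _ (L2_D (L2_scaled_grad n i j) (L2_scaled_grad n j i))) ger0_norm ?invr_ge0//.
  rewrite ler_pdivrMl//; apply: le_trans (nrmD_le mO (L2_scaled_grad n i j) (L2_scaled_grad n j i)) _.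
  have [_ H] := HM n; apply: le_trans (lerD (H i j) (H j i)) _.
  by rewrite mulr_natl mulr2n lerD.
have Lp1 n : L2 (dilf (e n) (P1 n)) by exact: (L2_p1 oom ch (e0 n) (dec n)).
have np1 n : e n ^+ 2 * nrm (dilf (e n) (P1 n)) <=
    `|C| * grad_const B mu mueff K A * e n.
  exact: (nrm_p1 oom omB ch hB Lf (e0 n) (HU n) (LP n) (@mom_eq n) (uA n) (sA n) fA (dec n)).
apply: norm_cvg0.
apply: (@squeeze_cvgr _ _ _ _ (cst 0) (fun n => `|C| * grad_const B mu mueff K A * e n * nrm g)).
- apply: nearW => n; rewrite normr_ge0/= normrM ger0_norm ?sqr_ge0//.
  apply: le_trans (ler_wpM2l (sqr_ge0 _) (cauchy_schwarz mO (Lp1 n) Lg)) _.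
  by rewrite mulrA; apply: ler_wpM2r; [exact: nrm_ge0|exact: np1].
- exact: cvg_cst.
- rewrite -[X in _ --> X](_ : `|C| * grad_const B mu mueff K A * 0 * nrm g = 0).
    by apply: cvgMr_tmp; apply: cvgMl_tmp.
  by rewrite mulr0 mul0r.
Qed.

Lemma pressure_cvg (g : pt S3 -> R) : L2 g ->
  e n ^+ 2 * ip (P n) g @[n --> \oo] --> ip (fst_fun ps.1) g.
Proof.
move=> Lg; rewrite -[X in _ --> X]addr0.
rewrite (_ : (fun _ => _) = (fun n => e n ^+ 2 * ip (fst_fun (P0 n).1) g +
   e n ^+ 2 * ip (dilf (e n) (P1 n)) g)).
  by apply: cvgD; [exact: weak_p0|exact: p1_cvg].
apply/funext => n; rewrite -mulrDr.
by rewrite (decomposed_ip oom omB ch hB (e0 n) (LP n) (dec n) Lg).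
Qed.

(** A symmetric matrix is orthogonal to the antisymmetric part of another one. *)
Lemma syme_grade eps (u v : 'I_3 -> jet3) :
  (forall i j, L2 ((u i).2 j)) -> (forall i j, L2 ((v i).2 j)) ->
  \sum_i \sum_j ip (syme eps u i j) (syme eps v i j) =
  \sum_i \sum_j ip (syme eps u i j) (grade eps (v i) j).
Proof.
move=> Lu Lv.
have Ls i j : L2 (syme eps u i j) by exact: L2_syme.
have Lg i j : L2 (grade eps (v i) j) by exact: L2_grade.
have E i j : ip (syme eps u i j) (syme eps v i j) =
   2^-1 * ip (syme eps u i j) (grade eps (v i) j) +
   2^-1 * ip (syme eps u j i) (grade eps (v j) i).
  rewrite (symeE eps v) (ipZr mO _ (L2_D (Lg i j) (Lg j i)) (Ls i j)).
  have -> : syme eps u j i = syme eps u i j.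
    by apply/funext => x; rewrite /syme addrC.
  by rewrite (ipDr mO (Lg i j) (Lg j i) (Ls i j)) mulrDr.
under eq_bigr do under eq_bigr do rewrite E.
under eq_bigr do rewrite big_split/=.
rewrite big_split/= [X in _ + X]exchange_big/= -big_split/=.
apply: eq_bigr => i _; rewrite -big_split/=; apply: eq_bigr => j _.
by rewrite -mulrDl; move: (ip _ _) => a; rewrite -[RHS]mul1r; congr (_ * _); field.
Qed.

Definition lim_vel k : pt S3 -> R := if unlift vert k is Some i then (us i).1 else 0.

Lemma lim_vel_horiz i : lim_vel (horiz i) = (us i).1.
Proof. by rewrite /lim_vel horizE liftK. Qed.

Lemma lim_vel_vert : lim_vel vert = 0.
Proof. by rewrite /lim_vel unlift_none. Qed.

Lemma L2_lim_vel k : L2 (lim_vel k).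
Proof.
by elim/ord3_ind: k => [i|]; rewrite ?lim_vel_horiz ?lim_vel_vert//; exact: L2_0.
Qed.

Lemma weak_U k (a : pt S3 -> R) : L2 a -> ip (U n k).1 a @[n --> \oo] --> ip (lim_vel k) a.
Proof.
elim/ord3_ind: k => [i|] La; first by rewrite lim_vel_horiz; exact: weak_u1.
by rewrite lim_vel_vert (ip0l _ mO); exact: weak_u3.
Qed.

(** The weight of direction [j] after rescaling: constantly 1 vertically and vanishing in the limit
    horizontally. *)
Definition tscal n j : R := e n * scal (e n) j.

Lemma tscal_cvg j : tscal n j @[n --> \oo] --> ((j == vert)%:R : R).
Proof.
rewrite /tscal /scal; case: (j == vert).
  rewrite (_ : (fun _ => _) = cst 1); first exact: cvg_cst.
  by apply/funext => n /=; rewrite mulfV// lt0r_neq0.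
by under eq_fun do rewrite mulr1.
Qed.

Definition single_jet (phi : R3 -> R) (i k : 'I_3) : jet3 :=
  classical_jet S3 (if k == i then phi else 0).

Lemma single_H10 phi i k : test_fun Om phi -> H10 S3 Om (single_jet phi i k).
Proof.
move=> tphi; apply: (test_H10 oOm OmB); case: ifP => // _; exact: test_fun0.
Qed.

Lemma grade_cjet0 eps j : grade eps (classical_jet S3 (0 : R3 -> R)) j = 0.
Proof.
apply/funext => x; rewrite /grade /=.
have -> : 'D_(e3 R j) (0 : R3 -> R) x = 0 by exact: derive_cst.
by rewrite mulr0; case: ifP.
Qed.

Lemma L2_test (phi : R3 -> R) : test_fun Om phi -> L2 phi.
Proof.
by move=> tphi; apply: (continuous_L2 oOm OmB); apply: smooth_continuous;
  exact: test_fun_smooth tphi.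
Qed.

Lemma test_ibp n k l (psi : R3 -> R) : test_fun Om psi ->
  ip ((U n k).2 l) psi = - ip (U n k).1 ('D_(e3 R l) psi).
Proof.
move=> tpsi; have [WU _] := HU n k; have [_ _ wU] := WU.
by apply: oppr_inj; rewrite opprK; apply: esym; exact: wU l _ tpsi.
Qed.

(** [syme_grade] leaves the gradient of the test field, whose only component is [phi], and the
    factor 2 cancels the half in the symmetric part. The powers of [e n] are grouped so that every
    factor has a known limit. *)
Lemma viscous_test n (i : 'I_2) phi : test_fun Om phi ->
  e n ^+ 2 * (2 * \sum_k \sum_j ip (syme (e n) (U n) k j)
     (syme (e n) (single_jet phi (horiz i)) k j)) =
  - \sum_j tscal n j *
    (tscal n j * ip (U n (horiz i)).1 ('D_(e3 R j) ('D_(e3 R j) phi)) +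
     e n * ip (U n j).1 ('D_(e3 R (horiz i)) ('D_(e3 R j) phi))).
Proof.
move=> tphi; set v := single_jet phi (horiz i).
have Hv k : H10 S3 Om (v k) by exact: single_H10.
have Ldv k j : L2 ((v k).2 j) by have [_] := H10_L2 (Hv k); exact.
rewrite (syme_grade _ (LdU n) Ldv) (bigD1 (horiz i))//= [X in _ + X]big1 ?addr0; last first.
  move=> k ki; apply: big1 => j _; rewrite /v /single_jet (negbTE ki) grade_cjet0.
  by apply: etrans (ipC _ _ _ _) _; exact: (ip0l _ mO).
rewrite mulrA mulr_sumr -sumrN; apply: eq_bigr => j _.
have tdj := test_fun_derive (e3 R j) tphi.
have Ldj := L2_test tdj.
have Lg k l : L2 (grade (e n) (U n k) l) by exact: L2_grade.
have -> : grade (e n) (v (horiz i)) j = scal (e n) j *: ('D_(e3 R j) phi : pt S3 -> R).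
  by rewrite gradeE /v /single_jet eqxx.
rewrite (ipZr mO _ Ldj (L2_syme (e n) _ _ (LdU n))) symeE.
rewrite (ipZl mO _ (L2_D (Lg _ _) (Lg _ _)) Ldj) (ipDl mO (Lg _ _) (Lg _ _) Ldj).
rewrite !gradeE !(ipZl mO _ (LdU n _ _) Ldj) !(test_ibp _ _ _ tdj).
have -> : scal (e n) (horiz i) = 1.
  by rewrite /scal horizE eq_sym (negbTE (neq_lift _ _)).
by rewrite /tscal; move: (ip _ _) (ip _ _) (scal (e n) j) => a b c; field.
Qed.

(* All derivatives are moved onto [phi], so that only the weak convergence of
   the velocity itself is used. *)
Lemma limit_momentum (i : 'I_2) phi : test_fun Om phi ->
  - mueff * ip (us i).1 ('D_(e3 R vert) ('D_(e3 R vert) phi))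
  + mu / K * ip (us i).1 phi
  = ip (fst_fun (f i)) phi - ip (fst_fun (ps.2 i)) phi.
Proof.
move=> tphi; have Lphi := L2_test tphi.
have tdi := test_fun_derive (e3 R (horiz i)) tphi.
have Ld2 k l : L2 ('D_(e3 R k) ('D_(e3 R l) phi)).
  by apply: L2_test; apply: test_fun_derive; exact: test_fun_derive.
pose v := single_jet phi (horiz i).
have Hv k : H10 S3 Om (v k) by exact: single_H10.
have E n : mueff * (e n ^+ 2 * (2 * \sum_k \sum_j ip (syme (e n) (U n) k j) (syme (e n) v k j)))
   + mu / K * ip (U n (horiz i)).1 phi - e n ^+ 2 * ip (P n) ('D_(e3 R (horiz i)) phi)
   = ip (fst_fun (f i)) phi.
  have := mom_ip oom omB ch hB Lf (HU n) (@mom_eq n) Hv.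
  have -> : \sum_k ip (U n k).1 (v k).1 = ip (U n (horiz i)).1 phi.
    rewrite (bigD1 (horiz i))//= [X in _ + X]big1 ?addr0; last first.
      move=> k ki; rewrite (negbTE ki).
      by apply: etrans (ipC _ _ _ _) _; exact: (ip0l _ mO).
    by rewrite eqxx.
  have -> : dive (e n) v = 'D_(e3 R (horiz i)) phi.
    apply/funext => x; rewrite /dive (bigD1 (horiz i))//= [X in _ + X]big1 ?addr0.
      rewrite /v /single_jet eqxx /grade /=.
      by rewrite horizE eq_sym (negbTE (neq_lift _ _)).
    by move=> k ki; rewrite /v /single_jet (negbTE ki) grade_cjet0.
  have -> : \sum_k ip (fst_fun (f k)) (v (horiz k)).1 = ip (fst_fun (f i)) phi.
    rewrite (bigD1 i)//= [X in _ + X]big1 ?addr0; last first.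
      move=> k ki; rewrite /= !horizE (inj_eq lift_inj) (negbTE ki).
      by apply: etrans (ipC _ _ _ _) _; exact: (ip0l _ mO).
    by rewrite eqxx.
  move: (\sum_i \sum_j _) (ip (U n (horiz i)).1 phi) (ip (P n) _) (ip (fst_fun (f i)) phi) => S V p F Eq.
  have en0 : e n != 0 by rewrite lt0r_neq0.
  have -> : F = e n ^+ 2 * (e n ^- 2 * F) by rewrite mulrA mulfV ?mul1r// expf_neq0.
  by rewrite -Eq; field; rewrite en0 /= lt0r_neq0.
have c1 : mueff * (e n ^+ 2 * (2 * \sum_k \sum_j ip (syme (e n) (U n) k j) (syme (e n) v k j)))
    @[n --> \oo] --> mueff * - \sum_j ((j == vert)%:R : R) *
     ((j == vert)%:R * ip (us i).1 ('D_(e3 R j) ('D_(e3 R j) phi)) +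
      0 * ip (lim_vel j) ('D_(e3 R (horiz i)) ('D_(e3 R j) phi))).
  apply: cvgMl_tmp.
  rewrite (_ : (fun _ => _) = (fun n => - \sum_j tscal n j *
    (tscal n j * ip (U n (horiz i)).1 ('D_(e3 R j) ('D_(e3 R j) phi)) +
     e n * ip (U n j).1 ('D_(e3 R (horiz i)) ('D_(e3 R j) phi))))); last first.
    by apply/funext => n; exact: viscous_test.
  apply: cvgN; apply: cvg_sum_fin => j; apply: cvgM; first exact: tscal_cvg.
  apply: cvgD; first by apply: cvgM; [exact: tscal_cvg|exact: weak_u1].
  by apply: cvgM; [exact: ecvg|exact: weak_U].
have c2 : mu / K * ip (U n (horiz i)).1 phi @[n --> \oo] --> mu / K * ip (us i).1 phi.
  by apply: cvgMl_tmp; exact: weak_u1.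
have c3 := pressure_cvg (L2_test tdi).
have c4 := cvgB (cvgD c1 c2) c3.
have c5 : ip (fst_fun (f i)) phi @[n --> \oo] --> ip (fst_fun (f i)) phi by exact: cvg_cst.
have lim : ip (fst_fun (f i)) phi = mueff * - (\sum_j ((j == vert)%:R : R) *
     ((j == vert)%:R * ip (us i).1 ('D_(e3 R j) ('D_(e3 R j) phi)) +
      0 * ip (lim_vel j) ('D_(e3 R (horiz i)) ('D_(e3 R j) phi)))) +
   mu / K * ip (us i).1 phi - ip (fst_fun ps.1) ('D_(e3 R (horiz i)) phi).
  apply: (cvg_unique _ c5) => //.
  rewrite (_ : (fun _ => _) = (fun n => mueff * (e n ^+ 2 * (2 * \sum_k \sum_j ip (syme (e n) (U n) k j) (syme (e n) v k j)))
   + mu / K * ip (U n (horiz i)).1 phi - e n ^+ 2 * ip (P n) ('D_(e3 R (horiz i)) phi))).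
    exact: c4.
  by apply/funext => n; rewrite E.
have S : \sum_j ((j == vert)%:R : R) *
     ((j == vert)%:R * ip (us i).1 ('D_(e3 R j) ('D_(e3 R j) phi)) +
      0 * ip (lim_vel j) ('D_(e3 R (horiz i)) ('D_(e3 R j) phi))) =
   ip (us i).1 ('D_(e3 R vert) ('D_(e3 R vert) phi)).
  rewrite (bigD1 vert)//= [X in _ + X]big1 => [|j /negbTE ->]; last by rewrite mul0r.
  by rewrite mul1r mul0r !addr0 mul1r.
rewrite lim S.
have -> : ip (fst_fun ps.1) ('D_(e3 R (horiz i)) phi) = - ip (fst_fun (ps.2 i)) phi.
  exact: (fst_ibp oom omB ch hB i Wps tphi).
by rewrite opprK addrK mulrN mulNr.
Qed.

Let g i : pt S3 -> R := fst_fun (f i) - fst_fun (ps.2 i).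
Let Lg i : L2 (g i). Proof. exact: L2_B. Qed.

(** One vertical derivative goes back to [us], so that the equation involves a single derivative of
    [phi] and extends to H10 by density. *)
Lemma limit_momentum_test (i : 'I_2) phi : test_fun Om phi ->
  mueff * ip (us i).2 ('D_(e3 R vert) phi) + mu / K * ip (us i).1 phi = ip (g i) phi.
Proof.
move=> tphi; have tdz := test_fun_derive (e3 R vert) tphi.
have [[_ _ wus] _] := Vus i.
have H : ip (us i).1 ('D_(e3 R vert) ('D_(e3 R vert) phi)) =
    - ip (us i).2 ('D_(e3 R vert) phi) by exact: wus _ tdz.
have L := limit_momentum i tphi; rewrite H mulrNN in L.
apply: etrans L _; apply: esym.
exact: (ipBl mO (Lff i) (Lps i) (L2_test tphi)).
Qed.

Lemma limit_momentum_H10 (i : 'I_2) (w : jet3) : H10 S3 Om w ->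
  mueff * ip (us i).2 (w.2 vert) + mu / K * ip (us i).1 w.1 = ip (g i) w.1.
Proof.
move=> /(H10_approx oOm OmB)[phi [tphi c0 c1]].
have h1 := strong_cvg_ip mO (strong_cvg_cst mO (Ldus i)) (c1 vert).
have h2 := strong_cvg_ip mO (strong_cvg_cst mO (Lus i)) c0.
have h3 := strong_cvg_ip mO (strong_cvg_cst mO (Lg i)) c0.
have h4 : mueff * ip (us i).2 ('D_(e3 R vert) (phi n)) + mu / K * ip (us i).1 (phi n)
   @[n --> \oo] --> mueff * ip (us i).2 (w.2 vert) + mu / K * ip (us i).1 w.1.
  by apply: cvgD; apply: cvgMl_tmp; [exact: h1|exact: h2].
apply: (cvg_unique _ h4) => //.
rewrite (_ : (fun _ => _) = (fun n => ip (g i) (phi n))); first exact: h3.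
by apply/funext => n; exact: limit_momentum_test.
Qed.

(** [us] is not at hand as an element of H10. The equation is tested with the horizontal components
    of [U n], which are, and the result is linear in them, so their weak limit may be inserted. *)
Lemma limit_momentum_us (i : 'I_2) :
  mueff * ip (us i).2 (us i).2 + mu / K * ip (us i).1 (us i).1 = ip (g i) (us i).1.
Proof.
(* Paired with a function and its vertical derivative, [a] and [b] give the residual of the limit
   equation; it is zero for every [U n]. *)
pose a : pt S3 -> R := (mu / K) *: (us i).1 - g i.
pose b : pt S3 -> R := mueff *: (us i).2.
have La : L2 a by apply: L2_B => //; exact: L2_Z.
have Lb : L2 b by exact: L2_Z.
have E (v : pt S3 -> R) (w : pt S3 -> R) : L2 v -> L2 w -> ip v a + ip w b =
    mueff * ip (us i).2 w + mu / K * ip (us i).1 v - ip (g i) v.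
  move=> Lv Lw; rewrite /a /b (ipBr mO (L2_Z _ (Lus i)) (Lg i) Lv).
  rewrite (ipZr mO _ (Lus i) Lv) (ipZr mO _ (Ldus i) Lw).
  rewrite (ipC _ _ v (us i).1) (ipC _ _ v (g i)) (ipC _ _ w).
  by rewrite addrC addrA.
have c := @weak_u i a b La Lb.
have z : ip (us i).1 a + ip (us i).2 b = 0.
  apply: (cvg_unique _ c) => //.
  rewrite (_ : (fun _ => _) = cst 0); first exact: cvg_cst.
  apply/funext => n; rewrite (E _ _ (LU n (horiz i)) (LdU n (horiz i) vert)).
  by rewrite (limit_momentum_H10 i (HU n (horiz i))) subrr.
by apply/eqP; rewrite -subr_eq0 -(E _ _ (Lus i) (Ldus i)) z.
Qed.

(** With no vertical derivative in [Z], the singular factor [eps^-1] and the vertical velocity leave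
    the constraint, and what remains is linear in the weakly convergent components. *)
Lemma limit_orthogonal3 (Z : jet3) : W1 S3 Om 2%:E Z -> Z.2 vert = 0 ->
  \sum_i ip (us i).1 (Z.2 (horiz i)) = 0.
Proof.
move=> WZ Zv; have [_ LdZ] := W1_L2 WZ.
have c : \sum_i ip (U n (horiz i)).1 (Z.2 (horiz i)) @[n --> \oo] -->
    \sum_i ip (us i).1 (Z.2 (horiz i)).
  by apply: cvg_sum_fin => i; exact: weak_u1.
apply: (cvg_unique _ c) => //.
rewrite (_ : (fun _ => _) = cst 0); first exact: cvg_cst.
apply/funext => n.
have := integral_grade0 oOm OmB (HU n) (@div_eq n) WZ.
rewrite (integral_sum_ip mO (LU n) (fun i => L2_grade (e n) i LdZ)) sum_horiz.
have -> : grade (e n) Z vert = 0 by rewrite gradeE Zv scaler0.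
rewrite [X in _ + X](_ : _ = 0) ?addr0; last first.
  by apply: etrans (ipC _ _ _ _) _; exact: (ip0l _ mO).
move=> H; rewrite -[RHS]H; apply: eq_bigr => i _; congr (ip _ _).
rewrite gradeE /scal.
by rewrite horizE eq_sym (negbTE (neq_lift _ _)) scale1r.
Qed.

Lemma limit_orthogonal (Z : jet P2) : W1 P2 om 2%:E Z ->
  \sum_i ip (us i).1 (fst_fun (Z.2 i)) = 0.
Proof.
move=> WZ; rewrite -[RHS](limit_orthogonal3 (fst_W1 oom omB ch hB WZ) (fst_jet_vert Z)).
by apply: eq_bigr => i _; rewrite fst_jet_horiz.
Qed.

(** [phi] is lifted to a function constant along columns. Such a lift generally does not vanish on
    top and bottom, so the constraint for W^{1,2} functions is used; Fubini then produces the column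
    fluxes. *)
Lemma limit_divergence (phi : R2 -> R) : smooth_on setT phi ->
  \int[leb2 R]_(x' in om)
    (\sum_i (\int[leb1 R]_(z in `]0, h x'[) (us i).1 (x', z)) * 'D_(e2 R i) phi x') = 0.
Proof.
move=> sphi.
have iu i : (leb3 R).-integrable (Om : set (pt S3)) (EFin \o (us i).1).
  have L1 : L2 (cst 1) by apply: (continuous_L2 oOm OmB); exact: cst_continuous.
  have := ip_integrable mO (Lus i) L1.
  by congr (_.-integrable _ _); apply/funext => x /=; rewrite mulr1.
have cphi i : continuous ('D_(e2 R i) phi).
  exact: smooth_continuous (smooth_on_derive _ sphi).
have H i := column_integral oom omB ch (iu i) (cphi i).
have -> : \int[leb2 R]_(x' in om)
    (\sum_i (\int[leb1 R]_(z in `]0, h x'[) (us i).1 (x', z)) * 'D_(e2 R i) phi x') =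
    \sum_i \int[leb2 R]_(x' in om)
      ((\int[leb1 R]_(z in `]0, h x'[) (us i).1 (x', z)) * 'D_(e2 R i) phi x').
  by apply: (Rintegral_sum _ (mom oom) _).2 => i; have [] := H i.
have := limit_orthogonal3 (smooth_W1 oOm OmB _ (smooth_fst sphi)) (pder_fst_vert phi).
move=> /(_ (ler1n _ 2)) Z; rewrite -[RHS]Z; apply: eq_bigr => i _.
apply: etrans (esym (H i).2) _; apply: eq_Rintegral => x _; congr (_ * _).
Qed.

Definition dissipation := \sum_i (mueff * ip (us i).2 (us i).2 + mu / K * ip (us i).1 (us i).1).

(** The pressure contribution vanishes because [ps] itself is an admissible planar function in
    [limit_orthogonal]. *)
Lemma limit_energy : dissipation = power_lim.
Proof.
rewrite /dissipation /power_lim; under eq_bigr do rewrite limit_momentum_us.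
have -> : \sum_i ip (g i) (us i).1 = \sum_i ip (fst_fun (f i)) (us i).1 -
    \sum_i ip (us i).1 (fst_fun (ps.2 i)).
  rewrite -sumrB; apply: eq_bigr => i _.
  by rewrite /g (ipBl mO (Lff i) (Lps i) (Lus i)) (ipC _ _ (fst_fun (ps.2 i))).
by rewrite limit_orthogonal// subr0.
Qed.

(* The limit of [e n *: grade (e n) (U n k) j]: only the vertical derivatives of
   the horizontal components survive. *)
Definition lim_grad k j : pt S3 -> R :=
  if (j == vert) then (if unlift vert k is Some i then (us i).2 else 0) else 0.

Lemma lim_grad_horiz i : lim_grad (horiz i) vert = (us i).2.
Proof. by rewrite /lim_grad eqxx horizE liftK. Qed.

Lemma lim_grad_vert : lim_grad vert vert = 0.
Proof. by rewrite /lim_grad eqxx unlift_none. Qed.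

Lemma L2_lim_grad k j : L2 (lim_grad k j).
Proof.
rewrite /lim_grad; case: (j == vert); last exact: L2_0.
by case: (unlift _ _) => [i|]; [exact: Ldus|exact: L2_0].
Qed.

Lemma lim_grad_other k j : j != vert -> lim_grad k j = 0.
Proof. by rewrite /lim_grad => /negbTE ->. Qed.

Let ip0r (k : pt S3 -> R) : ip k 0 = 0.
Proof. by apply: etrans (ipC _ _ _ _) _; exact: (ip0l _ mO). Qed.

Lemma sum_lim_grad (F : 'I_3 -> 'I_3 -> pt S3 -> R) :
  \sum_k \sum_j ip (F k j) (lim_grad k j) = \sum_i ip (F (horiz i) vert) (us i).2.
Proof.
have -> : \sum_k \sum_j ip (F k j) (lim_grad k j) = \sum_k ip (F k vert) (lim_grad k vert).
  apply: eq_bigr => k _; rewrite (bigD1 vert)//= [X in _ + X]big1 ?addr0// => j jv.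
  by rewrite lim_grad_other// ip0r.
rewrite sum_horiz lim_grad_vert ip0r addr0; apply: eq_bigr => i _.
by rewrite lim_grad_horiz.
Qed.

Lemma sum_lim_vel (F : 'I_3 -> pt S3 -> R) :
  \sum_k ip (F k) (lim_vel k) = \sum_i ip (F (horiz i)) (us i).1.
Proof.
by rewrite sum_horiz lim_vel_vert ip0r addr0; apply: eq_bigr => i _; rewrite lim_vel_horiz.
Qed.

(* Expanding the squares leaves only the energy identity and products against
   fixed functions, so weak convergence determines the limit. *)
Definition energy_gap n :=
  mueff * (\sum_k \sum_j ip (scaled_grad n k j - lim_grad k j) (scaled_grad n k j - lim_grad k j)) +
  mu / K * (\sum_k ip ((U n k).1 - lim_vel k) ((U n k).1 - lim_vel k)).

Lemma energy_gapE n : energy_gap n = power n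
  - 2 * \sum_i (ip (U n (horiz i)).1 ((mu / K) *: (us i).1) +
                 ip ((U n (horiz i)).2 vert) (mueff *: (us i).2)) + dissipation.
Proof.
have sq (a b : pt S3 -> R) : L2 a -> L2 b ->
    ip (a - b) (a - b) = ip a a - 2 * ip a b + ip b b.
  move=> La Lb; rewrite (ipBl mO La Lb (L2_B La Lb)) !(ipBr mO La Lb)//.
  by rewrite (ipC _ _ b a); ring.
rewrite /energy_gap -energy.
under eq_bigr do under eq_bigr do rewrite (sq _ _ (L2_scaled_grad _ _ _) (L2_lim_grad _ _)).
under [X in _ + _ * X]eq_bigr do rewrite (sq _ _ (LU _ _) (L2_lim_vel _)).
have -> : \sum_k \sum_j (ip (scaled_grad n k j) (scaled_grad n k j) - 2 * ip (scaled_grad n k j) (lim_grad k j) + ip (lim_grad k j) (lim_grad k j))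
  = \sum_k \sum_j ip (scaled_grad n k j) (scaled_grad n k j) - 2 * (\sum_k \sum_j ip (scaled_grad n k j) (lim_grad k j))
    + \sum_k \sum_j ip (lim_grad k j) (lim_grad k j).
  rewrite mulr_sumr -sumrB -big_split; apply: eq_bigr => k _ /=.
  by rewrite mulr_sumr -sumrB -big_split.
have -> : \sum_k (ip (U n k).1 (U n k).1 - 2 * ip (U n k).1 (lim_vel k) + ip (lim_vel k) (lim_vel k))
  = \sum_k ip (U n k).1 (U n k).1 - 2 * (\sum_k ip (U n k).1 (lim_vel k)) + \sum_k ip (lim_vel k) (lim_vel k).
  by rewrite mulr_sumr -sumrB -big_split.
rewrite !sum_lim_grad !sum_lim_vel.
have -> : \sum_i ip (lim_grad (horiz i) vert) (us i).2 = \sum_i ip (us i).2 (us i).2.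
  by apply: eq_bigr => i _; rewrite lim_grad_horiz.
have -> : \sum_i ip (lim_vel (horiz i)) (us i).1 = \sum_i ip (us i).1 (us i).1.
  by apply: eq_bigr => i _; rewrite lim_vel_horiz.
have -> : \sum_i ip (scaled_grad n (horiz i) vert) (us i).2 = \sum_i ip ((U n (horiz i)).2 vert) (us i).2.
  by apply: eq_bigr => i _; rewrite scaled_grad_vert.
rewrite /dissipation !big_split/=.
have -> : \sum_i ip (U n (horiz i)).1 (mu / K *: (us i).1) =
    mu / K * \sum_i ip (U n (horiz i)).1 (us i).1.
  rewrite mulr_sumr; apply: eq_bigr => i _.
  exact: (ipZr mO _ (Lus i) (LU n (horiz i))).
have -> : \sum_i ip ((U n (horiz i)).2 vert) (mueff *: (us i).2) =
    mueff * \sum_i ip ((U n (horiz i)).2 vert) (us i).2.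
  rewrite mulr_sumr; apply: eq_bigr => i _.
  exact: (ipZr mO _ (Ldus i) (LdU n (horiz i) vert)).
rewrite -!mulr_sumr.
exact: energy_gap_arith.
Qed.

Lemma energy_gap_cvg0 : energy_gap n @[n --> \oo] --> 0.
Proof.
rewrite (_ : energy_gap = fun n => power n
  - 2 * \sum_i (ip (U n (horiz i)).1 ((mu / K) *: (us i).1) +
                 ip ((U n (horiz i)).2 vert) (mueff *: (us i).2)) + dissipation); last first.
  by apply/funext => n; exact: energy_gapE.
have c : \sum_i (ip (U n (horiz i)).1 ((mu / K) *: (us i).1) +
    ip ((U n (horiz i)).2 vert) (mueff *: (us i).2)) @[n --> \oo] --> dissipation.
  rewrite /dissipation; apply: cvg_sum_fin => i.
  have -> : mueff * ip (us i).2 (us i).2 + mu / K * ip (us i).1 (us i).1 =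
      ip (us i).1 ((mu / K) *: (us i).1) + ip (us i).2 (mueff *: (us i).2).
    by rewrite (ipZr mO _ (Lus i) (Lus i)) (ipZr mO _ (Ldus i) (Ldus i)) addrC.
  exact: (@weak_u i _ _ (L2_Z _ (Lus i)) (L2_Z _ (Ldus i))).
have z : power_lim - 2 * dissipation + dissipation = 0 by rewrite limit_energy; ring.
rewrite -[X in _ --> X]z.
exact: (cvgD (cvgB power_cvg (cvgMl_tmp (a := 2) c)) (cvg_cst dissipation)).
Qed.

(** The gap is a sum of nonnegative squares with positive coefficients, so each summand tends to
    zero with it. *)
Lemma strong_cvg_le_energy_gap (v : nat -> pt S3 -> R) (v0 : pt S3 -> R) (c : R) :
  0 < c -> (forall n, c * ip (v n - v0) (v n - v0) <= energy_gap n) ->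
  (forall n, L2 (v n)) -> L2 v0 -> strong_cvg v v0.
Proof.
move=> c0 H Lv Lv0.
have cv : ip (v n - v0) (v n - v0) @[n --> \oo] --> 0.
  apply: (@squeeze_cvgr _ _ _ _ (cst 0) (fun n => c^-1 * energy_gap n)).
  - by apply: nearW => n /=; rewrite ip_ge0/= ler_pdivlMl.
  - exact: cvg_cst.
  - rewrite -[X in _ --> X](mulr0 c^-1); apply: cvgMl_tmp; exact: energy_gap_cvg0.
split=> //; rewrite -[X in _ --> X](@sqrtr0 R).
apply: (cvg_comp _ _ cv); exact: sqrt_continuous.
Qed.

Lemma scaled_grad_strong k j : strong_cvg (fun n => scaled_grad n k j) (lim_grad k j).
Proof.
apply: (@strong_cvg_le_energy_gap _ _ mueff) => [//|n|n|]; [|exact: L2_scaled_grad|exact: L2_lim_grad].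
rewrite /energy_gap (bigD1 k)//= (bigD1 j)//= -addrA mulrDr -addrA lerDl addr_ge0//.
  apply: mulr_ge0; first exact: ltW.
  apply: addr_ge0; first by apply: sumr_ge0 => l _; exact: ip_ge0.
  by apply: sumr_ge0 => l _; apply: sumr_ge0 => l' _; exact: ip_ge0.
apply: mulr_ge0; first by rewrite ltW// divr_gt0.
by apply: sumr_ge0 => l _; exact: ip_ge0.
Qed.

Lemma U_strong k : strong_cvg (fun n => (U n k).1) (lim_vel k).
Proof.
have muK : 0 < mu / K by rewrite divr_gt0.
apply: (@strong_cvg_le_energy_gap _ _ (mu / K)) => [//|n|n|]; [|exact: LU|exact: L2_lim_vel].
rewrite /energy_gap [X in _ + _ * X](bigD1 k)//= mulrDr addrCA lerDl addr_ge0//.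
  apply: mulr_ge0; first exact: ltW.
  by apply: sumr_ge0 => l _; apply: sumr_ge0 => l' _; exact: ip_ge0.
apply: mulr_ge0; first exact: ltW.
by apply: sumr_ge0 => l _; exact: ip_ge0.
Qed.

End sequences.

(** * Passage to the limit in the heat equation *)

Section weighted_squares.
Context d (T : measurableType d) (R : realType).
Variables (mu : {measure set T -> \bar R}) (U : set T).
Hypothesis mU : measurable U.
Variables (z : T -> R) (M : R).
Hypothesis mz : measurable_fun U z.
Hypothesis zM : forall x, U x -> `|z x| <= M.

Lemma weighted_squares_integrable (I : finType) (v : I -> T -> R) :
  (forall i, inL mu U 2%:E (v i)) ->
  mu.-integrable U (EFin \o (fun x => (\sum_i v i x ^+ 2) * z x)).
Proof.
move=> Lv; have Lzv i : inL mu U 2%:E (fun x => z x * v i x).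
  by apply: (inL_mulb mU mz zM _ (Lv i)); rewrite ler1n.
have [+ _] := Rintegral_sum (index_enum I) mU (fun i => ip_integrable mU (Lv i) (Lzv i)).
congr (_.-integrable _ _); apply/funext => x /=; congr EFin.
by rewrite mulr_suml; apply: eq_bigr => i _; rewrite expr2 mulrA mulrAC.
Qed.

(** Each weighted square is read as the product of [v i] with [z] times [v i]; both factors converge
    strongly when [v i] does, since [z] is bounded. *)
Lemma weighted_squares (I : finType) (v : I -> T -> R) :
  (forall i, inL mu U 2%:E (v i)) ->
  \int[mu]_(x in U) ((\sum_i v i x ^+ 2) * z x) =
  \sum_i inner mu U (v i) (fun x => z x * v i x).
Proof.
move=> Lv; rewrite -(integral_sum_ip mU Lv); last first.
  by move=> i; apply: (inL_mulb mU mz zM _ (Lv i)); rewrite ler1n.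
apply: eq_Rintegral => x _; rewrite mulr_suml; apply: eq_bigr => i _.
by rewrite expr2 mulrA mulrAC.
Qed.

Lemma weighted_squaresZ (I : finType) (a : R) (v : I -> T -> R) :
  (forall i, inL mu U 2%:E (v i)) ->
  \int[mu]_(x in U) ((\sum_i (a *: v i) x ^+ 2) * z x) =
  a ^+ 2 * \int[mu]_(x in U) ((\sum_i v i x ^+ 2) * z x).
Proof.
move=> Lv; rewrite (weighted_squares Lv) weighted_squares; last first.
  by move=> i; exact: L2_Z.
rewrite mulr_sumr; apply: eq_bigr => i _.
have Lzv : inL mu U 2%:E (fun x => z x * v i x).
  by apply: (inL_mulb mU mz zM _ (Lv i)); rewrite ler1n.
have -> : (fun x => z x * (a *: v i) x) = a *: (fun x => z x * v i x).
  by apply/funext => x; rewrite !fctE /GRing.scale /= mulrCA.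
by rewrite (ipZl mU a (Lv i) (L2_Z a Lzv)) (ipZr mU a Lzv (Lv i)) mulrA expr2.
Qed.

Lemma weighted_squares_cvg (I : finType) (v : nat -> I -> T -> R) (w : I -> T -> R) :
  (forall i, strong_cvg mu U (v ^~ i) (w i)) ->
  \int[mu]_(x in U) ((\sum_i v n i x ^+ 2) * z x) @[n --> \oo] -->
  \int[mu]_(x in U) ((\sum_i w i x ^+ 2) * z x).
Proof.
move=> vw; rewrite (weighted_squares (v := w)); last by move=> i; have [] := vw i.
rewrite (_ : (fun _ => _) = (fun n => \sum_i inner mu U (v n i) (fun x => z x * v n i x))).
  apply: cvg_sum_fin => i.
  exact: (strong_cvg_ip mU (vw i) (strong_cvg_mulb mU mz zM (vw i))).
apply/funext => n; apply: weighted_squares => i.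
by have [H _ _] := vw i; exact: H.
Qed.

End weighted_squares.

Lemma conjugate_exponent (R : realType) (q : R) : 1 < q ->
  1 <= q / (q - 1) /\ q^-1 + (q / (q - 1))^-1 = 1.
Proof.
move=> q1; have q10 : 0 < q - 1 by rewrite subr_gt0.
split; first by rewrite ler_pdivlMr// mul1r lerBlDr lerDl ler01.
by field; rewrite !lt0r_neq0//; exact: lt_trans ltr01 q1.
Qed.

Section diffusion.
Context (R : realType).
Local Notation R2 := (R * R)%type.
Local Notation R3 := (R * R * R)%type.
Local Notation S3 := (space3 R).
Local Notation jet3 := (jet S3).
Variables (om : set R2) (h : R2 -> R) (B : R).
Hypothesis oom : open om.
Hypothesis omB : om `<=` box2 B.
Hypothesis ch : forall x, om x -> {for x, continuous h}.
Hypothesis hB : forall x, om x -> h x <= B.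
Local Notation Om := (layer om h).
Local Notation oOm := (layer_open oom ch).
Local Notation OmB := (layer_box omB hB).
Local Notation mO := (mOm oOm).
Local Notation ip := (@inner _ (pt S3) R (leb3 R) Om).
Variables (k q : R).
Hypothesis q1 : 1 < q.
Local Notation q' := (q / (q - 1)).
Variable e : nat -> R.
Hypothesis e0 : forall n, 0 < e n.
Hypothesis ecvg : e n @[n --> \oo] --> 0.
Variables (Gam : set R3) (T : nat -> jet3) (Ts : @zjet R).
Hypothesis LdT : forall n i, Lr S3 Om q%:E ((T n).2 i).
Hypothesis WT : weak_cvg (Vz_zero om h q Gam) (VzN Om q)
        (fun n => zjet_of (T n)) Ts.
Hypothesis WTh : forall i : 'I_2, weak_cvg (Lr S3 Om q%:E) (LN S3 Om q%:E)
        (fun n => e n *: (T n).2 (horiz i)) 0.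

Let q'1 : 1 <= q'. Proof. by have [] := conjugate_exponent q1. Qed.
Let q0 : 0 < q. Proof. exact: lt_trans ltr01 q1. Qed.
Let q'0 : 0 < q'. Proof. exact: lt_le_trans ltr01 q'1. Qed.
Let qq' : q^-1 + q'^-1 = 1. Proof. by have [] := conjugate_exponent q1. Qed.

(** Vertically [e n ^+ 2] cancels the two factors [e n^-1]. Horizontally one power of [e n] joins
    the derivative of the temperature, which then converges weakly to zero, and the other remains as
    a vanishing factor. *)
Lemma diffusion_cvg (zeta : R3 -> R) : smooth_on setT zeta ->
  e n ^+ 2 * \int[leb3 R]_(x in Om) (k * \sum_i grade (e n) (T n) i x *
      grade (e n) (classical_jet S3 zeta) i x) @[n --> \oo] -->
  \int[leb3 R]_(x in Om) (k * (Ts.2 x * 'D_(e3 R vert) zeta x)).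
Proof.
move=> sz.
have Ldz i : inL (leb3 R) (Om : set (pt S3)) q'%:E ('D_(e3 R i) zeta : pt S3 -> R).
  by apply: (continuous_inL oOm OmB q'1); exact: smooth_pder_continuous.
have igF (g : pt S3 -> R) i : Lr S3 Om q%:E g ->
    (leb3 R).-integrable (Om : set (pt S3)) (EFin \o (fun x => g x * 'D_(e3 R i) zeta x)).
  by move=> Lg; have [] := hoelder_in mO q0 q'0 qq' Lg (Ldz i).
have Lh n i : Lr S3 Om q%:E (e n *: (T n).2 (horiz i)) by have [H _ _] := WTh i; exact: H.
have E n : e n ^+ 2 * \int[leb3 R]_(x in Om) (k * \sum_i grade (e n) (T n) i x *
      grade (e n) (classical_jet S3 zeta) i x) =
    (\sum_i k * (e n * ip (e n *: ((T n).2 (horiz i) : pt S3 -> R)) ('D_(e3 R (horiz i)) zeta))) +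
    k * ip ((T n).2 vert) ('D_(e3 R vert) zeta).
  have en0 : e n != 0 by rewrite lt0r_neq0.
  have -> : \int[leb3 R]_(x in Om) (k * \sum_i grade (e n) (T n) i x *
      grade (e n) (classical_jet S3 zeta) i x) =
      \sum_i k * scal (e n) i ^+ 2 * ip ((T n).2 i) ('D_(e3 R i) zeta).
    rewrite (eq_bigr (fun i => \int[leb3 R]_(x in Om)
        (k * scal (e n) i ^+ 2 * ((T n).2 i x * 'D_(e3 R i) zeta x)))); last first.
      by move=> i _; rewrite RintegralZl//; [exact: mO|exact: igF].
    rewrite -(Rintegral_sum _ mO _).2; last first.
      move=> i; exact: (integrableZl mO (k * scal (e n) i ^+ 2) (igF _ i (LdT n i))).
    apply: eq_Rintegral => x _; rewrite mulr_sumr; apply: eq_bigr => i _.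
    rewrite !gradeE /= !fctE.
    rewrite /GRing.scale /=.
    by move: (scal _ _) (_.2 _ _) ('D_(_) _ _) => a b c; ring.
  have J i : ip (e n *: ((T n).2 (horiz i) : pt S3 -> R)) ('D_(e3 R (horiz i)) zeta) =
      e n * ip ((T n).2 (horiz i)) ('D_(e3 R (horiz i)) zeta).
    rewrite /inner -RintegralZl//; [|exact: mO|exact: (igF _ _ (LdT n (horiz i)))].
    by apply: eq_Rintegral => x _; rewrite mulrA.
  rewrite sum_horiz mulrDr mulr_sumr; congr (_ + _).
    apply: eq_bigr => i _; rewrite J /scal horizE eq_sym (negbTE (neq_lift _ _)).
    by rewrite -horizE; move: (inner _ _ _ _) (e n) => a b; ring.
  by rewrite /scal eqxx; move: (inner _ _ _ _) (e n) en0 => a b b0; field.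
have bnd i (v : pt S3 -> R) : Lr S3 Om q%:E v ->
    (`|ip v ('D_(e3 R i) zeta)|%:E <=
    (fine (normL (leb3 R) (Om : set (pt S3)) q'%:E ('D_(e3 R i) zeta : pt S3 -> R)))%:E *
      LN S3 Om q%:E v)%E.
  by move=> Lv; exact: (pair_bound mO (ltW q1) q'0 qq' (Ldz i) Lv).
have ch1 i : ip (e n *: ((T n).2 (horiz i) : pt S3 -> R)) ('D_(e3 R (horiz i)) zeta)
    @[n --> \oo] --> ip 0 ('D_(e3 R (horiz i)) zeta).
  have [_ _ wc] := WTh i.
  apply: (wc (fun v => ip v ('D_(e3 R (horiz i)) zeta))).
    by move=> a v w Lv Lw; exact: (pair_linl mO (ltW q1) q'0 qq' a Lv Lw (Ldz _)).
  by eexists => v Lv; exact: (bnd _ _ Lv).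
have cv1 : ip ((T n).2 vert) ('D_(e3 R vert) zeta) @[n --> \oo] -->
    ip Ts.2 ('D_(e3 R vert) zeta).
  have [_ _ wc] := WT.
  apply: (wc (fun v => ip v.2 ('D_(e3 R vert) zeta))).
    move=> a v w [[_ Lv _] _] [[_ Lw _] _].
    exact: (pair_linl mO (ltW q1) q'0 qq' a Lv Lw (Ldz _)).
  eexists => v [[_ Lv _] _]; apply: le_trans (bnd vert _ Lv) _.
  apply: lee_wpmul2l; first by rewrite lee_fin fine_ge0// Lnorm_ge0.
  by rewrite /VzN leeDr// Lnorm_ge0.
have LTs : Lr S3 Om q%:E Ts.2 by have [_ [[_ H _] _] _] := WT.
rewrite (RintegralZl _ mO (igF _ vert LTs)).
have -> := funext E.
rewrite -[X in _ --> X]add0r.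
apply: cvgD; last exact: (cvgMl_tmp (a := k) cv1).
rewrite [X in _ --> X](_ : _ = \sum_(i < 2) k * (0 * ip 0 ('D_(e3 R (horiz i)) zeta))).
  apply: cvg_sum_fin => i; apply: cvgMl_tmp; exact: (cvgM ecvg (ch1 i)).
by rewrite big1// => i _; rewrite mul0r mulr0.
Qed.
End diffusion.

Section source.
Context (R : realType).
Local Notation R3 := (R * R * R)%type.
Local Notation S3 := (space3 R).
Local Notation jet3 := (jet S3).
Variables (Om : set R3) (B : R).
Hypothesis oOm : open Om.
Hypothesis OmB : Om `<=` box3 B.
Local Notation mO := (mOm oOm).
Local Notation strong_cvg := (@strong_cvg _ (pt S3) R (leb3 R) Om).
Variables (e : nat -> R) (U : nat -> 'I_3 -> jet3) (us : 'I_2 -> @zjet R).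
Hypothesis U_strong : forall k, strong_cvg (fun n => (U n k).1) (lim_vel us k).
Hypothesis LdU : forall n k j, inL (leb3 R) (Om : set (pt S3)) 2%:E ((U n k).2 j).
Hypothesis scaled_grad_strong : forall k j, strong_cvg (fun n => scaled_grad e U n k j) (lim_grad us k j).

Lemma sum_sqr_lim_vel x : \sum_k lim_vel us k x ^+ 2 = \sum_i (us i).1 x ^+ 2.
Proof.
rewrite sum_horiz lim_vel_vert expr0n addr0; apply: eq_bigr => i _.
by rewrite lim_vel_horiz.
Qed.

(** Each vertical derivative appears in two entries of the symmetric part, with coefficient one half
    in each; the squares add up to one half. This turns [2 * mueff] in the dissipation into
    [mueff]. *)
Lemma sum_sqr_sym_lim_grad x :
  \sum_(p : 'I_3 * 'I_3) (2^-1 *: (lim_grad us p.1 p.2 + lim_grad us p.2 p.1)) x ^+ 2 =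
  2^-1 * \sum_i (us i).2 x ^+ 2.
Proof.
have Ghh (i j : 'I_2) : lim_grad us (horiz i) (horiz j) = 0.
  by apply: lim_grad_other; rewrite horizE eq_sym neq_lift.
have Gvh (j : 'I_2) : lim_grad us vert (horiz j) = 0.
  by apply: lim_grad_other; rewrite horizE eq_sym neq_lift.
have -> : \sum_(p : 'I_3 * 'I_3) (2^-1 *: (lim_grad us p.1 p.2 + lim_grad us p.2 p.1)) x ^+ 2 =
    \sum_i \sum_j (2^-1 * (lim_grad us i j x + lim_grad us j i x)) ^+ 2.
  by rewrite pair_bigA.
rewrite sum_horiz (eq_bigr (fun i => (2^-1 * (us i).2 x) ^+ 2)); last first.
  move=> i _; rewrite sum_horiz big1 => [|j _]; first by rewrite add0r lim_grad_horiz Gvh addr0.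
  by rewrite !Ghh addr0 mulr0 expr0n.
rewrite sum_horiz lim_grad_vert addr0 mulr0 expr0n addr0.
have -> : \sum_i (2^-1 * (lim_grad us vert (horiz i) x + lim_grad us (horiz i) vert x)) ^+ 2 =
    \sum_i (2^-1 * (us i).2 x) ^+ 2.
  by apply: eq_bigr => i _; rewrite lim_grad_horiz Gvh add0r.
rewrite -big_split mulr_sumr; apply: eq_bigr => i _ /=.
by move: ((us i).2 x) => a; field.
Qed.

Lemma source_cvg (a b : R) (zeta : R3 -> R) : continuous zeta ->
  a * \int[leb3 R]_(x in Om) ((\sum_i (U n i).1 x ^+ 2) * zeta x)
  + 2 * b * e n ^+ 2 * \int[leb3 R]_(x in Om)
      ((\sum_i \sum_j syme (e n) (U n) i j x ^+ 2) * zeta x) @[n --> \oo] -->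
  a * \int[leb3 R]_(x in Om) ((\sum_i (us i).1 x ^+ 2) * zeta x)
  + b * \int[leb3 R]_(x in Om) ((\sum_i (us i).2 x ^+ 2) * zeta x).
Proof.
move=> cz; have [M0 zM0] := compact_range_bounded (@compact_box3 R B) cz.
have zM x : Om x -> `|zeta x| <= M0 by move=> /OmB; exact: zM0.
have mz : measurable_fun (Om : set (pt S3)) (zeta : pt S3 -> R).
  by apply: measurable_funTS; exact: continuous_measurable3.
apply: cvgD.
  apply: cvgMl_tmp.
  have <- : \int[leb3 R]_(x in Om) ((\sum_k lim_vel us k x ^+ 2) * zeta x) =
      \int[leb3 R]_(x in Om) ((\sum_i (us i).1 x ^+ 2) * zeta x).
    by apply: eq_Rintegral => x _; rewrite sum_sqr_lim_vel.
  exact: (weighted_squares_cvg mO mz zM U_strong).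
(* The factor [e n ^+ 2] is absorbed into the squares: it is [e n] times the strain that converges
   strongly. *)
pose v n (p : 'I_3 * 'I_3) : pt S3 -> R := e n *: (syme (e n) (U n) p.1 p.2 : pt S3 -> R).
pose w (p : 'I_3 * 'I_3) := 2^-1 *: (lim_grad us p.1 p.2 + lim_grad us p.2 p.1).
have vw p : strong_cvg (v ^~ p) (w p).
  rewrite /v /w; under eq_fun do rewrite scaled_grad_syme.
  exact: (strong_cvgZ mO _ (strong_cvgD mO (scaled_grad_strong _ _) (scaled_grad_strong _ _))).
have := weighted_squares_cvg mO mz zM vw.
move/(cvgMl_tmp (a := 2 * b)) => c.
have vE n : 2 * b * \int[leb3 R]_(x in Om) ((\sum_p v n p x ^+ 2) * zeta x) =
  2 * b * e n ^+ 2 * \int[leb3 R]_(x in Om)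
      ((\sum_i \sum_j syme (e n) (U n) i j x ^+ 2) * zeta x).
  rewrite (weighted_squaresZ mO mz zM); last first.
    by move=> p; exact: (L2_syme (e n) p.1 p.2 (LdU n)).
  rewrite mulrA; congr (_ * _); apply: eq_Rintegral => x _; congr (_ * _).
  by rewrite pair_bigA.
rewrite -(funext vE).
have E : 2 * b * \int[leb3 R]_(x in Om) ((\sum_p w p x ^+ 2) * zeta x) =
    b * \int[leb3 R]_(x in Om) ((\sum_i (us i).2 x ^+ 2) * zeta x).
  have Ldus i : inL (leb3 R) (Om : set (pt S3)) 2%:E (us i).2.
    by rewrite -lim_grad_horiz; have [] := scaled_grad_strong (horiz i) vert.
  have -> : \int[leb3 R]_(x in Om) ((\sum_p w p x ^+ 2) * zeta x) =
      \int[leb3 R]_(x in Om) (2^-1 * ((\sum_i (us i).2 x ^+ 2) * zeta x)).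
    by apply: eq_Rintegral => x _; rewrite sum_sqr_sym_lim_grad mulrA.
  rewrite RintegralZl; last 2 first.
  - exact: mO.
  - exact: (weighted_squares_integrable mO mz zM Ldus).
  by move: (Rintegral _ _ _) => t; field.
by rewrite -E; exact: c.
Qed.
End source.

(** * Admissible heat test functions and the limit system *)

(** Points of the top are approached from below along their column. This is required because [zeta]
    is known to vanish only in the closure of the layer; lateral points lie there by definition of
    the frontier. *)
Lemma Gamma1_closure (R : realType) (om : set (R * R)) (h : R * R -> R) :
  (forall x, om x -> 0 < h x) -> Gamma1 om h `<=` closure (layer om h).
Proof.
move=> h0 [x z] [/= ox ->] A.
have c : continuous (fun t : R => (x, t)).
  by apply: continuous_pair; [exact: cst_continuous|exact: continuous_idfun].
move=> /(c (h x)) nA.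
have nA' : \forall t \near (h x)^'-, A (x, t).
  by rewrite near_withinE; near=> t => _; near: t; exact: nA.
have : \forall t \near (h x)^'-, A (x, t) /\ 0 < t < h x.
  near=> t; split; first by near: t.
  by apply/andP; split; near: t; [exact: nbhs_left_gt (h0 _ ox)|exact: nbhs_left_lt].
move=> /filter_ex [t [At th]]; exists (x, t); split=> //.
Unshelve. all: by end_near.
Qed.

Lemma smooth_heat_test (R : realType) (om : set (R * R)) (h : R * R -> R) (B r : R)
    (zeta : R * R * R -> R) :
  open (layer om h) -> layer om h `<=` box3 B -> 1 <= r ->
  (forall x, om x -> 0 < h x) -> smooth_on setT zeta ->
  (exists O : set (R * R * R), [/\ open O, Gamma1 om h `|` Gammal om h `<=` O
     & forall x, O x -> closure (layer om h) x -> zeta x = 0]) ->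
  W1_zero (layer om h) r (Gamma1 om h `|` Gammal om h) (classical_jet (space3 R) zeta) /\
  has_trace (layer om h) r (Gamma0 om) (classical_jet (space3 R) zeta) zeta.
Proof.
move=> oO OB r1 h0 sz [V [_ GV zV]].
have z0 x : (Gamma1 om h `|` Gammal om h) x -> zeta x = 0.
  move=> Gx; apply: zV; first exact: GV.
  by case: Gx => [G1|[[cl _] _]]; [exact: (Gamma1_closure h0 G1)|exact: cl].
split; last first.
  apply: (has_trace_smooth oO OB r1 sz) => //.
  by apply: measurable_funTS; exact: (continuous_measurable3 (smooth_continuous sz)).
split; first exact: (smooth_W1 oO OB).
by apply: (has_trace_smooth oO OB r1 sz) => // x Gx; rewrite z0.
Qed.

Unset Implicit Arguments.
Theorem theorem4p2 (R : realType)
  (om : set (R * R)) (h : R * R -> R) (hmin hmax : R)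
  (mu mueff K k q : R) (f : 'I_2 -> R * R -> R) (b : R * R -> R)
  (eps0 C : R)
  (u : R -> 'I_3 -> jet (space3 R)) (p : R -> R * R * R -> R)
  (T : R -> jet (space3 R))
  (p0 : R -> jet (plane2 R)) (p1 : R -> R * R * R -> R)
  (e : nat -> R)
  (us : 'I_2 -> zjet) (ps : jet (plane2 R)) (Ts : zjet) :
  open om -> connected om -> om !=set0 -> bounded_set om ->
  lipschitz_boundary om ->
  smooth_on om h -> 0 < hmin ->
  (forall x', om x' -> hmin <= h x' < hmax) ->
  0 < mu -> 0 < mueff -> 0 < K -> 0 < k ->
  1 < q < 3 / 2 ->
  (forall i, Lr (plane2 R) om 2%:E (f i)) ->
  Lr (plane2 R) om +oo%E b ->
  0 < eps0 ->
  (forall eps, 0 < eps < eps0 ->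
    dilated_solution om h mu mueff K k q f b eps (u eps) (p eps) (T eps)) ->
  (forall eps, 0 < eps < eps0 ->
    pressure_decomposition om h C eps (undilate eps (p eps))
      (p0 eps) (p1 eps)) ->
  (forall n, 0 < e n < eps0) -> e n @[n --> \oo] --> 0 ->
  limit_functions om h q u p0 T e us ps Ts ->
  limit_system om h mu mueff K k f b us ps Ts.
Proof.
move=> oom _ _ bom _ sh hmin0 hh mu0 mueff0 K0 k0 /andP[q1 _] Lf _ _ sol dec0 e0e ecvg lim.
have [M omM] := bounded_sub_box2 bom.
(* A single constant bounds the cross-section and the height, so that one box contains the layer. *)
pose B := Num.max M hmax.
have omB : om `<=` box2 B.
  by apply: (subset_trans omM); apply: box2_le; rewrite le_max lexx.
have ch x : om x -> {for x, continuous h} by exact: smooth_on_continuous sh.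
have hB x : om x -> h x <= B.
  by move=> /hh /andP[_ /ltW hx]; rewrite le_max hx orbT.
have h0 x : om x -> 0 < h x by move=> /hh /andP[hx _]; exact: lt_le_trans hmin0 hx.
have e0 n : 0 < e n by have /andP[] := e0e n.
have oO := layer_open oom ch; have OB := layer_box omB hB.
pose U n := u (e n).
have HU n i : H10 (space3 R) (layer om h) (U n i).
  by have [[H _ _] _ _ _] := sol _ (e0e n); exact: H.
have LP n : Lr (space3 R) (layer om h) 2%:E (p (e n)).
  by have [[_ [H _] _] _ _ _] := sol _ (e0e n); exact: H.
have mom_eq n := let: And4 _ H _ _ := sol _ (e0e n) in H.
have div_eq n := let: And4 _ _ H _ := sol _ (e0e n) in H.
have heat_eq n := let: And4 _ _ _ H := sol _ (e0e n) in H.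
have dec n := dec0 _ (e0e n).
have [[Vus Wps _ VTs] [Wu W3 _] WP [WT WTh]] := lim.
have LdU n i j : inL (leb3 R) (layer om h : set (pt (space3 R))) 2%:E ((U n i).2 j).
  by have [_] := H10_L2 (HU n i); exact.
have tr i : ztrace_zero om h (Gamma0 om `|` Gamma1 om h) (us i).1 by have [] := Vus i.
split; [ | | |exact: tr|by have [] := VTs].
- move=> i phi tphi.
  apply: etrans (limit_momentum oom omB ch hB mu0 mueff0 K0 Lf e0 ecvg HU LP mom_eq div_eq dec Wps Wu W3 WP i tphi) _.
  have Lphi := continuous_L2 oO OB (smooth_continuous (test_fun_smooth tphi)).
  have Lff := L2_fst_fun oom omB ch hB (Lf i).
  have Lps : inL (leb3 R) (layer om h : set (pt (space3 R))) 2%:E (fst_fun (ps.2 i)).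
    by have [_ H _] := Wps; exact: (L2_fst_fun oom omB ch hB (H i)).
  exact: esym (ipBl (mOm oO) Lff Lps Lphi).
- move=> phi tphi.
  exact: (limit_divergence oom omB ch hB HU div_eq Vus Wu (test_fun_smooth tphi)).
- move=> zeta sz zO.
  have q'1 : 1 <= q / (q - 1) by have [] := conjugate_exponent q1.
  have [Hz Ht] := smooth_heat_test oO OB q'1 h0 sz zO.
  have LdT n i : Lr (space3 R) (layer om h) q%:E ((T (e n)).2 i).
    by have [[_ _ [[_ H _] _]] _ _ _] := sol _ (e0e n); exact: H.
  have US := U_strong oom omB ch hB mu0 mueff0 K0 Lf e0 ecvg HU LP mom_eq div_eq dec Vus Wps Wu W3 WP.
  have GS := scaled_grad_strong oom omB ch hB mu0 mueff0 K0 Lf e0 ecvg HU LP mom_eq div_eq dec Vus Wps Wu W3 WP.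
  have lhs := diffusion_cvg oom omB ch hB (k := k) q1 e0 ecvg LdT WT WTh sz.
  have power := source_cvg oO OB US LdU GS (a := mu / K) (b := mueff) (smooth_continuous sz).
  have c := cvgD power (cvg_cst (\int[leb2 R]_(x' in om) (b x' * zeta (x', 0)))).
  (* By the heat equation at [e n] the diffusion term and the sources are the same sequence, with
     the bottom flux as a constant term; the two limits found for it must agree. *)
  apply: (cvg_unique _ lhs) => //.
  rewrite (_ : (fun _ => _) = (fun n => mu / K * \int[leb3 R]_(x in layer om h)
      ((\sum_i (U n i).1 x ^+ 2) * zeta x)
    + 2 * mueff * e n ^+ 2 * \int[leb3 R]_(x in layer om h)
      ((\sum_i \sum_j syme (e n) (U n) i j x ^+ 2) * zeta x)
    + \int[leb2 R]_(x' in om) (b x' * zeta (x', 0)))).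
    exact: c.
  by apply/funext => n; exact: heat_eq n _ _ Hz Ht.
Qed.
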